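(* Let $\mathcal C$ be any class of graphs of bounded twin-width. There is an algorithm that, given an $n$-vertex $m$-edge graph $G\in\mathcal C$, outputs a signed tree model of $G$ with $O(n\log n)$ transversal pairs, in time $O((m+n)\log n)$ with high probability, i.e., with probability at least $1-n^{-c}$ for any fixed but arbitrarily large constant $c>0$.
   Context: Twin-width: a trigraph is a graph whose edges are colored black or red. Contracting two vertices $u,v$ of a trigraph replaces them by a new vertex $w$ such that for every other vertex $x$: $wx$ is black if $ux,vx$ are both black edges, $wx$ is absent if neither $ux$ nor $vx$ is an edge, and $wx$ is red otherwise; other edges are unchanged. A graph $G$ (viewed as a trigraph with all edges black) has twin-width at most $d$ if there is a sequence of contractions reducing it to a single vertex such that every intermediate trigraph has maximum red degree at most $d$. A class has bounded twin-width if some $d$ bounds the twin-width of all its members. A transversal pair of a rooted tree $T$ is an unordered pair $uv$ of distinct nodes neither of which is an ancestor of the other; $u\preceq_T v$ means $u$ is an ancestor of $v$ (possibly equal). Two transversal pairs $u_1v_1,u_2v_2$ cross if one of $u_1,v_1$ is a strict ancestor of one of $u_2,v_2$ and vice versa. A signed tree model is a triple $(T,A,B)$ with $T$ a full binary rooted tree and $A,B$ disjoint sets of pairwise non-crossing transversal pairs; the number of transversal pairs is $|A|+|B|$. A pair $u'v'\in A\cup B$ covers a pair of nodes $u,v$ if $u'\preceq_T u$, $v'\preceq_T v$, and no other pair $u''v''\in A\cup B$ has $u'\preceq_T u''\preceq_T u$ and $v'\preceq_T v''\preceq_T v$. The model is a signed tree model of the graph on the leaves of $T$ in which two leaves are adjacent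 iff they are covered by a pair in $B$. *)

(* Defs.v *)
From mathcomp Require Import all_boot all_order all_algebra.
From mathcomp Require Import reals exp.

Set Implicit Arguments.
Unset Strict Implicit.
Unset Printing Implicit Defensive.

Import Order.TTheory GRing.Theory Num.Theory.

Record sgraph (n : nat) := SGraph {
  adj :> rel 'I_n;
  adj_sym : symmetric adj;
  adj_irrefl : irreflexive adj
}.

Definition edges n (G : sgraph n) : {set {set 'I_n}} :=
  [set [set p.1; p.2] | p : 'I_n * 'I_n & G p.1 p.2].

Variant color := NoEdge | Black | Red.

Definition is_red (k : color) : bool := if k is Red then true else false.

Definition merge_color (k l : color) : color :=
  match k, l with
  | Black, Black => Black
  | NoEdge, NoEdge => NoEdge
  | _, _ => Red
  end.

(* The vertices are those in [tv]; colors are meaningless outside [tv]. *)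
Record trigraph (V : finType) := Trigraph {
  tv : {set V};
  tcol : V -> V -> color
}.

Definition trigraph_of n (G : sgraph n) : trigraph 'I_n :=
  Trigraph [set: 'I_n] (fun x y => if G x y then Black else NoEdge).

(* The vertex replacing [u] and [v] reuses the name [u]. *)
Definition contract (V : finType) (H : trigraph V) (u v : V) : trigraph V :=
  Trigraph (tv H :\ v)
    (fun x y =>
       if x == u then
         if y == u then NoEdge else merge_color (tcol H u y) (tcol H v y)
       else if y == u then merge_color (tcol H x u) (tcol H x v)
       else tcol H x y).

Definition red_degree (V : finType) (H : trigraph V) (x : V) : nat :=
  #|[set y in tv H | is_red (tcol H x y)]|.

Definition max_red_degree_le (V : finType) (d : nat) (H : trigraph V) : Prop :=
  forall x, x \in tv H -> red_degree H x <= d.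

Inductive contractible (V : finType) (d : nat) : trigraph V -> Prop :=
| contractible_done (H : trigraph V) :
    max_red_degree_le d H -> #|tv H| <= 1 -> contractible d H
| contractible_step (H : trigraph V) (u v : V) :
    max_red_degree_le d H ->
    u \in tv H -> v \in tv H -> u != v ->
    contractible d (contract H u v) -> contractible d H.

Definition twin_width_le n (d : nat) (G : sgraph n) : Prop :=
  contractible d (trigraph_of G).

Definition graph_class := forall n : nat, sgraph n -> Prop.

Definition bounded_twin_width (C : graph_class) : Prop :=
  exists d : nat, forall (n : nat) (G : sgraph n), C n G -> twin_width_le d G.

(* The root is its own parent. *)
Record rooted_tree (V : finType) := RootedTree {
  root : V;
  parent : V -> V;
  parent_root : parent root = root;
  reach_root : forall v, fconnect parent v root
}.

Section Tree.
Variables (V : finType) (T : rooted_tree V).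

Definition anc (u v : V) : bool := fconnect (parent T) v u.

Definition sanc (u v : V) : bool := (u != v) && anc u v.

Definition children (u : V) : {set V} :=
  [set v | (v != root T) && (parent T v == u)].

Definition is_leaf (u : V) : bool := children u == set0.

Definition full_binary : bool :=
  [forall u, is_leaf u || (#|children u| == 2)].

Definition transversal (P : {set V}) : bool :=
  [exists u, exists v, [&& P == [set u; v], ~~ anc u v & ~~ anc v u]].

Definition cross (P Q : {set V}) : bool :=
  [exists x in P, exists y in Q, sanc x y] &&
  [exists y in Q, exists x in P, sanc y x].

End Tree.

Record signed_tree_model (V : finType) := SignedTreeModel {
  tree : rooted_tree V;
  pairsA : {set {set V}};
  pairsB : {set {set V}};
  tree_full_binary : full_binary tree;
  pairs_disjoint : [disjoint pairsA & pairsB];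
  pairs_transversal :
    forall P, P \in pairsA :|: pairsB -> transversal tree P;
  pairs_noncrossing :
    forall P Q, P \in pairsA :|: pairsB -> Q \in pairsA :|: pairsB ->
    ~~ cross tree P Q
}.

Definition num_pairs (V : finType) (M : signed_tree_model V) : nat :=
  #|pairsA M| + #|pairsB M|.

Definition covers (V : finType) (M : signed_tree_model V) (u' v' u v : V) :
    Prop :=
  [/\ [set u'; v'] \in pairsA M :|: pairsB M,
      anc (tree M) u' u, anc (tree M) v' v &
      forall u'' v'', [set u''; v''] \in pairsA M :|: pairsB M ->
        anc (tree M) u' u'' -> anc (tree M) u'' u ->
        anc (tree M) v' v'' -> anc (tree M) v'' v ->
        [set u''; v''] = [set u'; v']].

(* [lf] identifies the vertices of [G] with the leaves of the tree. *)
Definition model_of n (G : sgraph n) (V : finType) (M : signed_tree_model V)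
    (lf : 'I_n -> V) : Prop :=
  [/\ injective lf,
      forall v, is_leaf (tree M) v <-> exists x, lf x = v &
      forall x y, G x y <->
        exists u' v', [set u'; v'] \in pairsB M /\ covers M u' v' (lf x) (lf y)].

Variant binop := Add | Sub | Mul | Div | Mod | Lt | Eq | And | Or | Xor.

(* Operands are below [2 ^ w]; arithmetic is modulo [2 ^ w], and division by
   zero follows [divn] and [modn]. *)
Definition eval_op (w : nat) (o : binop) (a b : nat) : nat :=
  match o with
  | Add => (a + b) %% 2 ^ w
  | Sub => (a + (2 ^ w - b)) %% 2 ^ w
  | Mul => (a * b) %% 2 ^ w
  | Div => a %/ b
  | Mod => a %% b
  | Lt => (a < b) %% 2 ^ w
  | Eq => (a == b) %% 2 ^ w
  | And => Nat.land a b
  | Or => Nat.lor a b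
  | Xor => Nat.lxor a b
  end.

(* Register operands are register indices; [Read r a] reads into [r] the cell
   whose address is in [a], and [Write a r] writes [r] to that cell. *)
Variant instr :=
| Const (r : nat) (k : nat)
| Op (o : binop) (r a b : nat)
| Read (r a : nat)
| Write (a r : nat)
| Rand (r : nat)
| Jump (pc : nat)
| JumpZero (r : nat) (pc : nat)
| Halt.

Definition program := seq instr.

Record state := State { pc : nat; reg : nat -> nat; mem : nat -> nat }.

Definition fetch (p : program) (s : state) : instr := nth Halt p (pc s).

Definition halted (p : program) (s : state) : bool :=
  if fetch p s is Halt then true else false.

Definition set_reg (s : state) (r x : nat) : state :=
  State (pc s).+1 [eta reg s with r |-> x] (mem s).

(* Unit-cost step; [rnd] is the random word available at this step. *)
Definition step (p : program) (w : nat) (s : state) (rnd : nat) : state :=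
  match fetch p s with
  | Const r k => set_reg s r (k %% 2 ^ w)
  | Op o r a b => set_reg s r (eval_op w o (reg s a) (reg s b))
  | Read r a => set_reg s r (mem s (reg s a))
  | Write a r => State (pc s).+1 (reg s) [eta mem s with reg s a |-> reg s r]
  | Rand r => set_reg s r rnd
  | Jump l => State l (reg s) (mem s)
  | JumpZero r l =>
      State (if reg s r == 0 then l else (pc s).+1) (reg s) (mem s)
  | Halt => s
  end.

Definition run (p : program) (w : nat) (s : state) (tape : seq 'I_(2 ^ w)) :
    state :=
  foldl (fun s' (x : 'I_(2 ^ w)) => step p w s' x) s tape.

(* [T] steps consume at most [T] random words, so the probability is over
   uniform tapes of length [T]. *)
Definition prob_halt (R : realType) (p : program) (w : nat) (s : state)
    (T : nat) : R :=
  (#|[set t : T.-tuple 'I_(2 ^ w) | halted p (run p s t)]|%:R /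
   #|{: T.-tuple 'I_(2 ^ w)}|%:R)%R.

Definition lists_pairs N (l : seq ('I_N * 'I_N)) (S : {set {set 'I_N}}) : bool :=
  perm_eq [seq [set e.1; e.2] | e <- l] (enum S).

Definition pairs_code N (l : seq ('I_N * 'I_N)) : seq nat :=
  size l :: flatten [seq [:: val e.1; val e.2] | e <- l].

Definition graph_code n (es : seq ('I_n * 'I_n)) : seq nat :=
  n :: pairs_code es.

Definition model_code N n (T : rooted_tree 'I_N) (lf : 'I_n -> 'I_N)
    (lA lB : seq ('I_N * 'I_N)) : seq nat :=
  N :: [seq val (parent T v) | v <- enum 'I_N]
    ++ [seq val (lf x) | x <- enum 'I_n]
    ++ pairs_code lA ++ pairs_code lB.

Definition word_size (alpha n : nat) : nat := alpha * (trunc_log 2 n).+1.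

(* The reduction modulo [2 ^ w] has no effect when the input fits in words. *)
Definition init_state (w : nat) (input : seq nat) : state :=
  State 0 (fun=> 0) (fun a => nth 0 input a %% 2 ^ w).

(* The output starts at the address held in register 0. *)
Definition outputs_model n (G : sgraph n) (s : state) N
    (M : signed_tree_model 'I_N) : Prop :=
  exists (lf : 'I_n -> 'I_N) (lA lB : seq ('I_N * 'I_N)),
    [/\ model_of G M lf,
        lists_pairs lA (pairsA M), lists_pairs lB (pairsB M) &
        forall i, i < size (model_code (tree M) lf lA lB) ->
          mem s (reg s 0 + i) = nth 0 (model_code (tree M) lf lA lB) i].

Definition start (alpha n : nat) (es : seq ('I_n * 'I_n)) : state :=
  init_state (word_size alpha n) (graph_code es).

(* Main.v *)
(** Keep a set of alive vertices, one for each root of a growing binary forest.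
    A round samples every alive vertex with probability [1 / q] for a constant
    [q], splits the alive vertices into classes by their neighbourhoods in the
    sample, and walks through the vertices: if the previous alive vertex [u] of
    the class of [v] and [v] itself are told apart by at most [L = O(log n)]
    alive vertices [x], then [u] is merged into [v], and the pairs formed by the
    root of [u] with the roots of these [x] and of [v] are recorded, signed by
    adjacency to [u].  So there are never more than [(L + 1) * (n - 1)] pairs,
    and only the running time is random.  If the twin-width is at most [d], the
    vertices have only [O(|S|)] neighbourhoods in a set [S]: at the first
    contraction that identifies two elements of [S], at most [d + 1] parts tell
    them apart, and each part has boundedly many neighbourhoods in [S], so one
    of the two elements can be removed.  With probability at least 1/2 the
    sample is small and every two vertices of a class are close, and then at
    most three quarters of the alive vertices survive the round.  Their expected
    number thus drops by a factor 7/8 in each round, which takes time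
    [O(m + n)], and Markov's inequality concludes. *)

(* Correctness rests on a dichotomy for any two distinct vertices: either they are covered with the
   right sign, or no recorded pair lies above them and their adjacency is that of the alive vertices
   representing them. Merging [u] into [v] changes the represented adjacency only towards the
   vertices telling [u] from [v]; exactly these, and [v], get a pair. New pairs join current roots,
   so they never come between an older pair and the leaves it covers. Nodes are numbered by
   creation, which turns ancestry and crossing into inequalities.

   While a round runs the alive set shrinks, which only brings vertices closer. So if classes
   consist of pairwise close vertices at the start, only the last member of each survives, and the
   survivors have distinct traces. Each vertex precedes at most one other in its class, so each
   adjacency list is read boundedly often.

   Probability is handled by counting tapes: those not halted after [R] rounds are weighed against
   the number of alive vertices, which builds Markov's inequality into one induction on [R]. *)
Require Import Defs.
From mathcomp Require Import all_boot all_order all_algebra.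
From mathcomp Require Import reals exp.
From mathcomp Require Import zify lra.
From Stdlib Require Import FunctionalExtensionality.

Set Implicit Arguments.
Unset Strict Implicit.
Unset Printing Implicit Defensive.

(** * Traces in graphs of bounded twin-width *)

Section Traces.
Variables (n : nat) (G : sgraph n).
Implicit Types (X : {set 'I_n}) (D : {set 'I_n}).

Definition trace X (y : 'I_n) : {set 'I_n} := [set z in X | G y z].
Definition traces X D : {set {set 'I_n}} := trace X @: D.

Lemma tracesP X D (S : {set 'I_n}) :
  reflect (exists2 y, y \in D & S = trace X y) (S \in traces X D).
Proof. exact: imsetP. Qed.

(** [part] sends a vertex of [G] to the trigraph vertex that has absorbed it. Black and absent edges
    are reliable between whole parts; a red edge says nothing. *)
Definition homogeneous (H : trigraph 'I_n) (part : 'I_n -> 'I_n) : Prop :=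
  (forall x, part x \in tv H) /\
  (forall x y, part x != part y ->
     match tcol H (part x) (part y) with
     | Black => G x y
     | NoEdge => ~~ G x y
     | Red => true
     end).

Lemma homogeneous_id : homogeneous (trigraph_of G) id.
Proof. by split=> [x|x y _] /=; [rewrite inE | case: (boolP (G x y))]. Qed.

Lemma homogeneous_contract H u v part :
  u \in tv H -> u != v -> homogeneous H part ->
  homogeneous (contract H u v) (fun x => if part x == v then u else part x).
Proof.
move=> uH uv [h1 h2]; split=> [x|x y] /=.
  by rewrite !inE; case: (eqVneq (part x) v) => [_|->]; rewrite ?uv ?uH ?h1.
move: (h2 x y) (h1 x) (h1 y) => {}h2 _ _.
case: (eqVneq (part x) v) h2 => [->|xv]; case: (eqVneq (part y) v) => [->|yv] h2;
  rewrite ?eqxx //=.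
- by move=> uy; rewrite [part y == u]eq_sym (negbTE uy);
    move: (h2 isT); case: (tcol H u _); case: (tcol H v _).
- by move=> xu; rewrite (negbTE xu); move: (h2 xv); case: (tcol H _ u); case: (tcol H _ v).
- case: (eqVneq (part x) u) h2 => [-> h2 uy|xu h2 xy].
    by rewrite [part y == u]eq_sym (negbTE uy); move: (h2 uy); case: (tcol H u _); case: (tcol H v _).
  case: (eqVneq (part y) u) h2 => [->|yu] h2; last exact: h2.
  by move: (h2 xu); case: (tcol H _ u); case: (tcol H _ v).
Qed.

(** At the critical contraction at most [d.+1] parts matter, the merged one and its red neighbours.
    Each of them meets at most [d.+2] vertices of [X] in itself or across a red edge, hence has at
    most [2 ^ d.+2] traces. *)
Definition trace_const (d : nat) := d.+1 * 2 ^ d.+2.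

(* All vertices of one part have the same neighbours in [X] outside the parts
   that are red to it. *)
Lemma card_traces_part H part q X (Y : {set 'I_n}) :
  homogeneous H part ->
  #|[set z in X | (part z == q) || is_red (tcol H q (part z))]| <= #|Y| ->
  #|traces X [set y | part y == q]| <= 2 ^ #|Y|.
Proof.
move=> [h1 h2] leY.
set W := [set z in X | _] in leY.
apply: leq_trans (leq_pexp2l (isT : 0 < 2) leY).
rewrite -card_powerset -[#|traces _ _|](card_in_imset (f := fun S => S :&: W)) //; last first.
  move=> S1 S2 /tracesP[y1]; rewrite inE => /eqP y1q ->.
  move=> /tracesP[y2]; rewrite inE => /eqP y2q -> /setP e.
  apply/setP => z; move: (e z); rewrite !inE.
  case: (boolP (z \in X)) => //= zX; case: eqP => //= [|/eqP pz]; rewrite ?andbT //.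
  case E : (tcol H q (part z)) => /=; rewrite ?andbT //.
    move: (h2 y1 z) (h2 y2 z); rewrite y1q y2q eq_sym pz E.
    by move=> /(_ isT)/negbTE-> /(_ isT)/negbTE->.
  move: (h2 y1 z) (h2 y2 z); rewrite y1q y2q eq_sym pz E.
  by move=> /(_ isT)-> /(_ isT)->.
apply: subset_leq_card; apply/subsetP => S /imsetP[S' _ ->].
by rewrite powersetE subsetIr.
Qed.

Lemma card_traces_setU X D1 D2 : #|traces X (D1 :|: D2)| <= #|traces X D1| + #|traces X D2|.
Proof. by rewrite /traces imsetU cardsU leq_subr. Qed.

Lemma card_traces_bigcup (I : finType) (P : {set I}) X (F : I -> {set 'I_n}) c :
  (forall i, i \in P -> #|traces X (F i)| <= c) ->
  #|traces X (\bigcup_(i in P) F i)| <= #|P| * c.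
Proof.
move=> h; rewrite -sum_nat_const.
elim/big_rec2 : _ => [|i y1 y2 /h hi le]; first by rewrite /traces imset0 cards0.
by apply: leq_trans (card_traces_setU _ _ _) _; rewrite leq_add.
Qed.

(* At the first contraction that puts two vertices [x], [x'] of [X] in a common
   part, only vertices in at most [d.+1] parts tell [x] from [x']. *)
Lemma exists_removable (d : nat) (H : trigraph 'I_n) (part : 'I_n -> 'I_n) X :
  contractible d H -> homogeneous H part -> {in X &, injective part} -> 1 < #|X| ->
  exists x x' D, [/\ x \in X, x' \in X, x != x',
    forall y, y \notin D -> G y x = G y x' & #|traces X D| <= trace_const d].
Proof.
move=> ct; elim: ct part => {H} [H _ le1|H u v _ uH vH uv ct IH] part hom inj X1.
  have : #|part @: X| <= #|tv H|.
    by apply: subset_leq_card; apply/subsetP => _ /imsetP[x _ ->]; case: hom.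
  by rewrite card_in_imset // => /leq_trans/(_ le1); rewrite leqNgt X1.
set part' := fun x => if part x == v then u else part x.
have hom' : homogeneous (contract H u v) part' by exact: homogeneous_contract.
have [inj'|] := boolP [forall x in X, forall y in X, (part' x == part' y) ==> (x == y)].
  apply: (IH part') => // x y xX yX e.
  by move/forall_inP/(_ _ xX)/forall_inP/(_ _ yX)/implyP : inj' => /(_ _)/eqP; apply; apply/eqP.
(* The red degrees that count are those after the contraction, where the two vertices share the part
   [u]. *)
have {}IH : max_red_degree_le d (contract H u v) by case: (ct).
case/forall_inPn => x xX; case/forall_inPn => x' x'X; rewrite negb_imply => /andP[/eqP e xx'].
have pu : part' x = u.
  move: e; rewrite /part'; case: eqP => // xv; case: eqP => // x'v e.
  by move/eqP: xx'; case; apply: inj.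
set H' := contract H u v in hom' IH *.
pose P q := q |: [set r in tv H' | is_red (tcol H' q r)].
have uH' : u \in tv H' by rewrite !inE uv uH.
clearbody H'.
have cP q : q \in tv H' -> #|P q| <= d.+1.
  by move=> qH; rewrite /P cardsU1; apply: (leq_add (leq_b1 _) (IH _ qH)).
have sP q : q \in P u -> q \in tv H' by rewrite in_setU1 => /orP[/eqP->//|]; rewrite inE => /andP[].
exists x, x', (\bigcup_(q in P u) [set y | part' y == q]).
split=> //.
  move=> y /bigcupP yD; have := hom'.2 x y; have := hom'.2 x' y.
  rewrite -e pu -![G _ y]adj_sym; have [yu|yu] := eqVneq u (part' y).
    by case: yD; exists (part' y); rewrite !inE -?yu ?eqxx.
  case E: (tcol H' u (part' y)) => [||].
  - by move=> /(_ isT)/negbTE-> /(_ isT)/negbTE->.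
  - by move=> /(_ isT)-> /(_ isT)->.
  by case: yD; exists (part' y); rewrite inE ?eqxx // !inE E hom'.1 orbT.
apply: leq_trans (card_traces_bigcup (c := 2 ^ d.+2) _) _; last by rewrite leq_mul2r cP ?orbT.
move=> q /sP qH.
(* [part] is injective on [X], so [x] and [x'] are the only members of [X] in the two contracted
   parts; dropping [x'] restores injectivity. *)
have inj' : {in X :\ x' &, injective part'}.
  move=> a b; rewrite !in_setD1 => /andP[ax' aX] /andP[bx' bX].
  have key c : c \in X -> c != x' -> part c \in [:: u; v] -> c = x.
    move: e; rewrite pu /part' !inE => ex' cX cx' /orP[]/eqP ec.
    - move: pu; rewrite /part'; case: eqP => [xv _|_ xu]; last by apply: inj => //; rewrite ec xu.
      move: ex'; case: eqP => [x'v _|_ x'u]; last by case/eqP: cx'; apply: inj => //; rewrite ec.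
      by case/eqP: xx'; apply: inj => //; rewrite xv.
    - move: pu; rewrite /part'; case: eqP => [xv _|_ xu]; first by apply: inj => //; rewrite ec xv.
      move: ex'; case: eqP => [x'v _|_ x'u]; first by case/eqP: cx'; apply: inj => //; rewrite ec.
      by case/eqP: xx'; apply: inj => //; rewrite xu.
  have pin c : part c \in [:: u; v] -> part' c = u.
    by rewrite /part' !inE; case: (eqVneq (part c) v) => // _; rewrite orbF => /eqP.
  have pout c : part c \notin [:: u; v] -> part' c = part c /\ part c != u.
    by rewrite /part' !inE negb_or => /andP[-> /negbTE->].
  have [pa|pa] := boolP (part a \in [:: u; v]); have [pb|pb] := boolP (part b \in [:: u; v]).
  - by rewrite (key a) // (key b).
  - by rewrite (pin a) //; case: (pout b pb) => -> /eqP + eb; case.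
  - by rewrite (pin b) //; case: (pout a pa) => -> /eqP.
  - by case: (pout a pa) => -> _; case: (pout b pb) => -> _; apply: inj.
have [Y cY] : exists Y : {set 'I_n},
   #|[set z in X | (part' z == q) || is_red (tcol H' q (part' z))]| <= #|Y| <= d.+2.
  set W := [set z in X | _]; exists W; rewrite leqnn /=.
  (* [x'] contributes one; the rest of [W] maps injectively into [P q], of size at most [d.+1]. *)
  rewrite (cardsD1 x' W); apply: (@leq_add _ _ 1 d.+1); first exact: leq_b1.
  rewrite -[#|_ :\ _|](card_in_imset (f := part')); last first.
    by apply: sub_in2 inj' => z; rewrite !inE => /and3P[-> ->].
  apply: leq_trans (cP q qH); apply: subset_leq_card; apply/subsetP => _ /imsetP[z + ->].
  by rewrite !inE hom'.1 => /and3P[].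
case/andP: cY => cY Yd.
apply: leq_trans (card_traces_part hom' cY) _.
by rewrite leq_pexp2l.
Qed.

(** Induction on [#|X|], removing [x]. The traces of [D] are few, and any other trace contains [x]
    exactly when it contains [x'], so its restriction to [X :\ x] determines it. *)
Lemma card_traces_le (d : nat) X : twin_width_le d G ->
  #|traces X setT| <= trace_const d * #|X| + 1.
Proof.
move=> tw; have [m] := ubnP #|X|; elim: m X => // m IH X Xm.
have [X1|X1] := leqP #|X| 1.
  apply: (@leq_trans (2 ^ #|X|)); last first.
    rewrite /trace_const !expnS; move: (expn_gt0 2 d).
    by case: #|X| X1 => [|[]] //=; nia.
  rewrite -card_powerset; apply: subset_leq_card; apply/subsetP => _ /tracesP[y _ ->].
  by rewrite powersetE; apply/subsetP => z; rewrite inE => /andP[].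
have [x [x' [D [xX x'X xx' DG cD]]]] :=
  exists_removable tw (homogeneous_id) (in2W (@inj_id _)) X1.
have := IH (X :\ x); rewrite (cardsD1 x X) xX in Xm *.
move=> /(_ Xm) {}IH.
have : #|traces X setT :\: traces X D| <= #|traces (X :\ x) setT|.
  rewrite -[#|_ :\: _|](card_in_imset (f := fun S => S :\ x)).
    apply: subset_leq_card; apply/subsetP => _ /imsetP[_ /setDP[/tracesP[y _ ->] _] ->].
    apply/imsetP; exists y => //; apply/setP => z; rewrite !inE; by rewrite andbA.
  move=> _ _ /setDP[/tracesP[y1 _ ->] y1D] /setDP[/tracesP[y2 _ ->] y2D].
  have {}y1D : y1 \notin D by apply: contra y1D => y1D; apply: imset_f.
  have {}y2D : y2 \notin D by apply: contra y2D => y2D; apply: imset_f.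
  move/setP => e; apply/setP => z.
  have [->|zx] := eqVneq z x; last by move: (e z); rewrite !inE zx.
  rewrite !inE xX /= !DG //.
  by move: (e x'); rewrite !inE eq_sym xx' x'X.
have := cardsID (traces X D) (traces X setT).
have := subset_leq_card (subsetIr (traces X setT) (traces X D)).
by move: IH cD; rewrite mulnDr; lia.
Qed.
End Traces.

(** * The merge forest and its signed tree model *)

Definition above (par : nat -> nat) (x p : nat) : Prop := exists i, iter i par x = p.

(** The sign [s] is [true] for [B]. Pairs are stored ordered but read as unordered. *)
Definition signed (PA PB : seq (nat * nat)) (s : bool) (p q : nat) : Prop :=
  (p, q) \in (if s then PB else PA) \/ (q, p) \in (if s then PB else PA).

(** The ancestors of a leaf are linearly ordered by number, so a pair that is componentwise least is
    the one covering [x], [y] in the signed tree model. *)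
Definition covered (g : rel nat) par PA PB x y : Prop :=
  exists p q, [/\ signed PA PB (g x y) p q, above par x p, above par y q &
    forall s p' q', signed PA PB s p' q' -> above par x p' -> above par y q' ->
      p <= p' /\ q <= q'].

(** [rep x] is the alive vertex whose tree contains the leaf [x]; pairs recorded later treat [x] as
    [rep x]. *)
Definition uncovered (g : rel nat) par PA PB (rep : nat -> nat) x y : Prop :=
  [/\ rep x != rep y, g x y = g (rep x) (rep y) &
    forall s p q, signed PA PB s p q -> above par x p -> above par y q -> False].

(* The forest built after [k - n] merges: its nodes are [0 .. k-1], the leaves
   [0 .. n-1], a root is its own parent, and [node x] is the root of the tree
   represented by the alive vertex [x].  A pair [(p, q)] was recorded when [p]
   was about to get a parent; [q] was then a root, hence [q < par p]. *)
Record forest_inv (n : nat) (g : rel nat) (k : nat) (par node rep : nat -> nat)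
    (alive : pred nat) (PA PB : seq (nat * nat)) : Prop := ForestInv {
  fi_k : n <= k;
  fi_par : forall v, v < k -> v <= par v < k;
  fi_leaf : forall v, v < k -> par v != v -> n <= par v;
  fi_bin : forall j, n <= j < k -> exists a b,
    [/\ a < j, b < j, a != b, par a = j /\ par b = j &
        forall c, c < j -> par c = j -> c = a \/ c = b];
  fi_node : forall x, x < n -> alive x -> node x < k /\ par (node x) = node x;
  fi_inj : forall x y, x < n -> y < n -> alive x -> alive y -> node x = node y -> x = y;
  fi_root : forall v, v < k -> par v = v -> exists x, [/\ x < n, alive x & node x = v];
  fi_rep : forall x, x < n -> [/\ rep x < n, alive (rep x) & above par x (node (rep x))];
  fi_pair : forall p q, (p, q) \in PA ++ PB ->
    [/\ p < k, q < k, p != q & [/\ par p != p, q < par p & par q = q \/ p < par q]];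
  fi_asym : forall p q, (p, q) \in PA ++ PB -> (q, p) \notin PA ++ PB;
  fi_uniq : uniq (PA ++ PB);
  fi_cov : forall x y, x < n -> y < n -> x != y ->
    covered g par PA PB x y \/ uncovered g par PA PB rep x y
}.

Lemma signed_mem PA PB s p q :
  signed PA PB s p q -> (p, q) \in PA ++ PB \/ (q, p) \in PA ++ PB.
Proof. by case: s => -[h|h]; rewrite !mem_cat h ?orbT; auto. Qed.

Lemma signed_sym PA PB s p q : signed PA PB s p q -> signed PA PB s q p.
Proof. by case; [right|left]. Qed.

Lemma covered_sym (g : rel nat) par PA PB x y : symmetric g ->
  covered g par PA PB x y -> covered g par PA PB y x.
Proof.
move=> gs [p [q [h1 h2 h3 h4]]]; exists q, p; split=> //.
  by rewrite gs; apply: signed_sym.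
by move=> s p' q' /signed_sym h5 h6 h7; have [] := h4 _ _ _ h5 h7 h6.
Qed.

Lemma uncovered_sym (g : rel nat) par PA PB rep x y : symmetric g ->
  uncovered g par PA PB rep x y -> uncovered g par PA PB rep y x.
Proof.
move=> gs [h1 h2 h3]; split; rewrite 1?eq_sym //.
  by rewrite gs h2 gs.
by move=> s p q /signed_sym h4 h5 h6; apply: (h3 _ _ _ h4 h6 h5).
Qed.

(** * One merge preserves the invariant *)

Section Forest.
Variables (n : nat) (g : rel nat).
Hypothesis gsym : symmetric g.

Section Inv.
Variables (k : nat) (par node rep : nat -> nat) (alive : pred nat) (PA PB : seq (nat * nat)).
Hypothesis inv : forest_inv n g k par node rep alive PA PB.

Lemma above_lt x p : x < k -> above par x p -> x <= p < k.
Proof.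
move=> xk [i <-]; elim: i => [|i /andP[h1 h2]] /=; first by rewrite leqnn.
by have := fi_par inv h2; lia.
Qed.

Lemma above_par x p : above par x p -> above par x (par p).
Proof. by move=> [i <-]; exists i.+1. Qed.

(** Numbers do not decrease along the parent orbit of [x], which stops at its root. *)
Lemma above_fix x p q : x < k -> par q = q -> above par x p -> above par x q -> p <= q.
Proof.
move=> xk rq [i <-] [j ej]; have [ij|ji] := leqP i j.
  have := above_lt (p := iter i par x) xk (ex_intro _ i erefl) => /andP[_ ik].
  have : above par (iter i par x) q by exists (j - i); rewrite -iterD subnK.
  by move/(above_lt ik) => /andP[].
by rewrite -(subnK (ltnW ji)) iterD ej iter_fix.
Qed.

Lemma above_root x p : x < n -> above par x p -> p <= node (rep x).
Proof.
move=> xn ap; have [rn ra ax] := fi_rep inv xn.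
have [_ e] := fi_node inv rn ra; apply: above_fix e ap ax.
exact: leq_trans xn (fi_k inv).
Qed.

Lemma above_rootE x p : x < n -> par p = p -> above par x p -> p = node (rep x).
Proof.
move=> xn e ap; apply/eqP; rewrite eqn_leq above_root //=.
have [rn ra ax] := fi_rep inv xn; apply: above_fix e ax ap.
exact: leq_trans xn (fi_k inv).
Qed.

Lemma signed_lt s p q : signed PA PB s p q -> p < k /\ q < k.
Proof. by case/signed_mem => /(fi_pair inv)[]. Qed.

Section Merge.
Variables (u v : nat).
Hypotheses (un : u < n) (vn : v < n) (au : alive u) (av : alive v) (uv : u != v).
Variables (XA XB : seq nat).
Hypotheses (XAu : uniq XA) (XBu : uniq XB).
Hypothesis XAP : forall x, (x \in XA) =
  [&& x < n, alive x, x != u, x != v, ~~ g u x & g v x].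
Hypothesis XBP : forall x, (x \in XB) =
  [&& x < n, alive x, x != u, x != v, g u x & ~~ g v x].
Variables (par' node' : nat -> nat) (alive' : pred nat).
Hypothesis parE : forall x, par' x = if [|| x == node u, x == node v | x == k] then k else par x.
Hypothesis nodeE : forall x, node' x = if x == v then k else node x.
Hypothesis aliveE : forall x, alive' x = (x != u) && alive x.
(** The pair of [u] with [v] is always recorded: it serves the uncovered leaf pairs with one leaf in
    each of the two merged trees. *)
Let PA' := PA ++ [seq (node u, node x) | x <- XA] ++ (if g u v then [::] else [:: (node u, node v)]).
Let PB' := PB ++ [seq (node u, node x) | x <- XB] ++ (if g u v then [:: (node u, node v)] else [::]).
Let rep' x := if rep x == u then v else rep x.

Let uk : node u < k. Proof. by case: (fi_node inv un au). Qed.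
Let vk : node v < k. Proof. by case: (fi_node inv vn av). Qed.
Let pu : par (node u) = node u. Proof. by case: (fi_node inv un au). Qed.
Let pv : par (node v) = node v. Proof. by case: (fi_node inv vn av). Qed.
Let uvn : node u != node v.
Proof. by apply/eqP => /(fi_inj inv un vn au av)/eqP; rewrite (negbTE uv). Qed.
Let nk : n <= k. Proof. exact: fi_k inv. Qed.

Let parE' x : x < k -> x != node u -> x != node v -> par' x = par x.
Proof. by move=> xk /negbTE xu /negbTE xv; rewrite parE xu xv ltn_eqF. Qed.

Let par'k : par' k = k. Proof. by rewrite parE eqxx !orbT. Qed.
Let par'u : par' (node u) = k. Proof. by rewrite parE eqxx. Qed.
Let par'v : par' (node v) = k. Proof. by rewrite parE eqxx orbT. Qed.

Let par_cases x : x < k -> par' x = par x /\ x != node u /\ x != node v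
  \/ par' x = k /\ par x = x /\ (x = node u \/ x = node v).
Proof.
move=> xk; have [->|xu] := eqVneq x (node u); first by auto.
by have [->|xv] := eqVneq x (node v); [auto|left; rewrite parE'].
Qed.

Lemma above_merge x p : x < n -> above par' x p <->
  above par x p \/ p = k /\ (above par x (node u) \/ above par x (node v)).
Proof.
move=> xn; have xk := leq_trans xn nk; split.
  move=> [i <-]; elim: i => [|i IH] /=; first by left; exists 0.
  set c := iter i par' x in IH *; case: IH => [ac|[-> h]]; last by right; rewrite par'k.
  have ck := above_lt xk ac; have [|[-> _]|[-> [_ [e|e]]]] := par_cases (x := c).
  - by lia.
  - by left; apply: above_par.
  - by right; split=> //; left; rewrite -e.
  - by right; split=> //; right; rewrite -e.
have old p' : above par x p' -> above par' x p'.
  move=> [i <-]; elim: i => [|i [j ej]] /=; first by exists 0.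
  set c := iter i par x in ej *.
  have /andP[_ ck] : x <= c < k by apply: above_lt; last exists i.
  case: (par_cases ck) => [[e _]|[_ [e _]]]; last by exists j; rewrite e.
  by exists j.+1; rewrite /= ej e.
by case=> [/old//|[-> [] /old[j ej]]]; exists j.+1; rewrite /= ej.
Qed.

Let newpair p q : (p, q) \in PA' ++ PB' ->
  (p, q) \in PA ++ PB \/ exists z, [/\ p = node u, q = node z, z < n, alive z & z != u].
Proof.
rewrite !mem_cat.
have hX X : (forall x, x \in X -> [&& x < n, alive x & x != u]) ->
    (p, q) \in [seq (node u, node x) | x <- X] ->
    exists z, [/\ p = node u, q = node z, z < n, alive z & z != u].
  by move=> h /mapP[z /h/and3P[h1 h2 h3] [-> ->]]; exists z.
have hv (b : bool) (l : seq (nat * nat)) : l = [:: (node u, node v)] \/ l = [::] -> (p, q) \in l ->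
    exists z, [/\ p = node u, q = node z, z < n, alive z & z != u].
  by case=> -> //; rewrite inE => /eqP[-> ->]; exists v; rewrite eq_sym.
case/orP => [/or3P[-> | /hX h | /(hv true) h]|/or3P[-> | /hX h | /(hv true) h]]; rewrite ?orbT; auto; right; apply: h.
- by move=> x; rewrite XAP => /and5P[-> -> -> _ _].
- by case: (g u v); auto.
- by move=> x; rewrite XBP => /and5P[-> -> -> _ _].
- by case: (g u v); auto.
Qed.

Let newsigned s p q : signed PA' PB' s p q -> signed PA PB s p q \/
  exists z, [/\ z < n, alive z, z != u,
     (p, q) = (node u, node z) \/ (p, q) = (node z, node u) & z = v \/ g u z != g v z].
Proof.
have hX X : (forall x, x \in X -> [&& x < n, alive x, x != u & g u x != g v x]) ->
    (p, q) \in [seq (node u, node x) | x <- X] \/ (q, p) \in [seq (node u, node x) | x <- X] ->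
  exists z, [/\ z < n, alive z, z != u,
     (p, q) = (node u, node z) \/ (p, q) = (node z, node u) & z = v \/ g u z != g v z].
  by move=> h [] /mapP[z /h/and4P[h1 h2 h3 h4] [-> ->]]; exists z; split; auto.
have hv (l : seq (nat * nat)) : l = [:: (node u, node v)] \/ l = [::] -> (p, q) \in l \/ (q, p) \in l ->
  exists z, [/\ z < n, alive z, z != u,
     (p, q) = (node u, node z) \/ (p, q) = (node z, node u) & z = v \/ g u z != g v z].
  by case=> -> []//; rewrite inE => /eqP[-> ->]; exists v; rewrite eq_sym; split; auto.
have hA x : x \in XA -> [&& x < n, alive x, x != u & g u x != g v x].
  by rewrite XAP => /and5P[-> -> -> _ /andP[/negbTE-> ->]].
have hB x : x \in XB -> [&& x < n, alive x, x != u & g u x != g v x].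
  by rewrite XBP => /and5P[-> -> -> _ /andP[-> /negbTE->]].
have hl1 : (if g u v then [:: (node u, node v)] else [::]) = [:: (node u, node v)] \/
  (if g u v then [:: (node u, node v)] else [::]) = [::] by case: (g u v); auto.
have hl2 : (if g u v then [::] else [:: (node u, node v)]) = [:: (node u, node v)] \/
  (if g u v then [::] else [:: (node u, node v)]) = [::] by case: (g u v); auto.
rewrite /signed /PA' /PB'; case: s; rewrite !mem_cat => -[] /or3P[h|h|h]; auto; right.
- by apply: hX hB _; left.
- by apply: hv hl1 _; left.
- by apply: hX hB _; right.
- by apply: hv hl1 _; right.
- by apply: hX hA _; left.
- by apply: hv hl2 _; left.
- by apply: hX hA _; right.
- by apply: hv hl2 _; right.
Qed.

Let signed_old s p q : signed PA PB s p q -> signed PA' PB' s p q.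
Proof. by rewrite /signed /PA' /PB'; case: s; rewrite !mem_cat => -[->|->]; auto. Qed.

Let signed_new z : z < n -> alive z -> z != u -> z = v \/ g u z != g v z ->
  signed PA' PB' (g u z) (node u) (node z).
Proof.
move=> zn az zu h; left; rewrite /PA' /PB'.
have [e|zv] := eqVneq z v.
  by subst z; case: (g u v); rewrite !mem_cat inE eqxx !orbT.
case: h => [/eqP|]; first by rewrite (negbTE zv).
case E : (g u z) => e; rewrite !mem_cat (map_f (fun x => (node u, node x))) ?orbT //.
  by rewrite XBP zn az zu zv E; case: (g v z) e.
by rewrite XAP zn az zu zv E; case: (g v z) e.
Qed.

Let anc_old x p : x < n -> p < k -> above par' x p -> above par x p.
Proof. by move=> xn pk /above_merge[//|//|[e _]]; rewrite e ltnn in pk. Qed.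

(** The case [rep x != u] follows by symmetry. An old cover stays least because new pairs consist of
    roots. An uncovered pair with [rep x = u] either gets its pair now, with sign [g u (rep y)], or
    [u] and [v] agree on [rep y] and [v] takes over as representative. *)
Let cov_step x y : x < n -> y < n -> x != y -> rep y != u ->
  covered g par' PA' PB' x y \/ uncovered g par' PA' PB' rep' x y.
Proof.
move=> xn yn xy ryu; have xk := leq_trans xn nk; have yk := leq_trans yn nk.
have [rxn rxa rx] := fi_rep inv xn; have [ryn rya ry] := fi_rep inv yn.
case: (fi_cov inv xn yn xy) => [[p [q [h1 h2 h3 h4]]]|[h1 h2 h3]].
  left; exists p, q; split; [exact: signed_old|by apply/above_merge => //; left|by apply/above_merge => //; left|].
  move=> s p' q' /newsigned[h5|[z [zn za zu h5 _]]] h6 h7.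
    have [pk qk] := signed_lt h5.
    by apply: (h4 s) => //; apply: anc_old.
  have {}h6 : above par x p'.
    by apply: anc_old h6 => //; case: h5 => -[-> _] //; case: (fi_node inv zn za).
  have {}h7 : above par y q'.
    by apply: anc_old h7 => //; case: h5 => -[_ ->] //; case: (fi_node inv zn za).
  have [_ pz] := fi_node inv zn za.
  have -> : p' = node (rep x) by apply: above_rootE => //; case: h5 => -[-> _].
  have -> : q' = node (rep y) by apply: above_rootE => //; case: h5 => -[_ ->].
  by split; apply: above_root.
(* A new pair consists of [node u] and the root of another alive vertex; as [rep y != u], it is [x]
   that lies below [node u]. *)
have new s p q : signed PA' PB' s p q -> above par' x p -> above par' y q ->
    p = node (rep x) /\ q = node (rep y) /\
      (rep x = u /\ (rep y = v \/ g u (rep y) != g v (rep y))).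
  case/newsigned => [h5|[z [zn za zu h5 h6]]] ax ay.
    have [pk qk] := signed_lt h5.
    by case: (h3 _ _ _ h5); apply: anc_old.
  have [zk pz] := fi_node inv zn za.
  have epx : p = node (rep x).
    apply: above_rootE => //; first by case: h5 => -[-> _].
    by apply: anc_old ax => //; case: h5 => -[-> _].
  have eqy : q = node (rep y).
    apply: above_rootE => //; first by case: h5 => -[_ ->].
    by apply: anc_old ay => //; case: h5 => -[_ ->].
  split=> //; split=> //; case: h5 => -[e1 e2].
    have -> : rep x = u by apply: (fi_inj inv) => //; rewrite -epx.
    by have -> : rep y = z by [apply: (fi_inj inv) => //; rewrite -eqy]; split.
  by case/eqP: ryu; apply: (fi_inj inv) => //; rewrite -eqy.
have [ru|ru] := eqVneq (rep x) u; last first.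
  right; split; rewrite /rep' ?(negbTE ru) ?(negbTE ryu) // => s p q h5 h6 h7.
  by have [_ [_ [e _]]] := new _ _ _ h5 h6 h7; case/eqP: ru.
have [h|h] := boolP ((rep y == v) || (g u (rep y) != g v (rep y))).
  left; exists (node (rep x)), (node (rep y)); split.
  - by rewrite h2 ru; apply: signed_new => //; case/orP: h => [/eqP|]; auto.
  - by apply/above_merge => //; left.
  - by apply/above_merge => //; left.
  - by move=> s p q h5 h6 h7; have [-> [-> _]] := new _ _ _ h5 h6 h7.
move: h; rewrite negb_or negbK => /andP[ryv /eqP e].
right; split; rewrite /rep' ?ru ?eqxx ?(negbTE ryu).
- by rewrite eq_sym.
- by rewrite h2 ru e.
- move=> s p q h5 h6 h7; have [_ [_ [_]]] := new _ _ _ h5 h6 h7.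
  by rewrite e eqxx; case=> // /eqP; rewrite (negbTE ryv).
Qed.

Lemma forest_merge : forest_inv n g k.+1 par' node' rep' alive' PA' PB'.
Proof.
split.
- by lia.
- move=> x; rewrite ltnS leq_eqVlt => /orP[/eqP->|xk]; first by rewrite par'k leqnn ltnS leqnn.
  by have := fi_par inv xk; have [[-> _]|[-> _]] := par_cases xk; lia.
- move=> x; rewrite ltnS leq_eqVlt => /orP[/eqP->|xk]; first by rewrite par'k eqxx.
  by have [[-> _]|[-> _]] := par_cases xk; [apply: (fi_leaf inv)|].
- move=> j /andP[nj]; rewrite ltnS leq_eqVlt => /orP[/eqP->|jk].
    exists (node u), (node v); split=> // c ck.
    have [[-> _]|[_ [_ //]]] := par_cases ck.
    by have := fi_par inv ck; lia.
  have [|a [b [h1 h2 h3 [h4 h5] h6]]] := fi_bin inv (j := j); first by rewrite nj.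
  have pj c : c < j -> par c = j -> par' c = j.
    move=> cj e; have ck := ltn_trans cj jk.
    by have [[-> _]|[_ [e' _]]] := par_cases ck; lia.
  exists a, b; split=> //; first by split; apply: pj.
  move=> c cj e; apply: h6 => //.
  by move: e; have [[-> //]|[-> _]] := par_cases (ltn_trans cj jk); lia.
- move=> x xn; rewrite aliveE nodeE => /andP[xu xa].
  have [_|xv] := eqVneq x v; first by rewrite par'k.
  have [h1 h2] := fi_node inv xn xa.
  rewrite parE' //; first by split=> //; apply: ltnW.
    by apply: contra xu => /eqP/(fi_inj inv xn un xa au)->.
  by apply: contra xv => /eqP/(fi_inj inv xn vn xa av)->.
- move=> x y xn yn; rewrite !aliveE !nodeE => /andP[xu xa] /andP[yu ya].
  have [h1 _] := fi_node inv xn xa; have [h2 _] := fi_node inv yn ya.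
  have [->|xv] := eqVneq x v; have [->|yv] := eqVneq y v => //; [by lia|by lia|].
  exact: (fi_inj inv).
- move=> x; rewrite ltnS leq_eqVlt => /orP[/eqP->|xk].
    by exists v; rewrite vn aliveE eq_sym uv av nodeE eqxx.
  have [[-> [xu xv]]|[-> _]] := par_cases xk; last by lia.
  move=> /(fi_root inv xk)[y [yn ya e]]; exists y; rewrite yn aliveE ya nodeE.
  by have [eu|_] := eqVneq y u; [move: xu|have [ev|_] := eqVneq y v; [move: xv|]];
     rewrite -?e ?eu ?ev ?eqxx.
- move=> x xn; have [h1 h2 h3] := fi_rep inv xn.
  rewrite /rep' aliveE nodeE; have [e|ru] := eqVneq (rep x) u.
    rewrite eq_sym uv eqxx; split=> //; apply/above_merge => //; right; split=> //.
    by left; rewrite -e.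
  rewrite ru h1 h2; split=> //; have [e|rv] := eqVneq (rep x) v; apply/above_merge => //.
    by right; split=> //; right; rewrite -e.
  by left.
- move=> p q /newpair[pq|[z [-> -> zn za zu]]].
    have [h1 h2 h3 [h4 h5 h6]] := fi_pair inv pq.
    have [[e [pnu pnv]]|[_ [e _]]] := par_cases h1; last by rewrite e eqxx in h4.
    rewrite e h4 h5 !ltnS (ltnW h1) (ltnW h2) h3; split=> //; split=> //.
    have [[-> _]|[-> _]] := par_cases h2; auto.
  have [h1 h2] := fi_node inv zn za.
  rewrite !ltnS (ltnW uk) (ltnW h1) par'u; split=> //.
    by apply: contra zu => /eqP/(fi_inj inv un zn au za) ->.
  split=> //; first by lia.
  have [[-> _]|[-> _]] := par_cases h1; auto.
- move=> p q /newpair[pq|[z [-> -> zn za zu]]]; apply/negP => /newpair[qp|[z' [e1 e2 zn' za' zu']]].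
  + by move: qp; apply/negP; apply: (fi_asym inv).
  + by have [_ _ _ [_ _ []]] := fi_pair inv pq; rewrite e1; have [] := fi_pair inv pq; rewrite e1 e2;
      have [_ ->] := fi_node inv zn' za'; rewrite eqxx => _ _ _ [].
  + by have [_ _ _ [+ _ _]] := fi_pair inv qp; have [_ ->] := fi_node inv zn za; rewrite eqxx.
  + by move: zu' zu => _ /eqP; case; apply: (fi_inj inv).
- have hnew : uniq ([seq (node u, node x) | x <- XA ++ XB ++ [:: v]]).
    rewrite map_inj_in_uniq.
      rewrite !cat_uniq XAu XBu /= !andbT; apply/andP; split.
      - apply/hasPn => x; rewrite mem_cat inE => /orP[|/eqP->].
          by rewrite XBP XAP => /and5P[_ _ _ _ /andP[->]]; rewrite !andbF.
        by rewrite XAP eqxx !andbF.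
      - by rewrite orbF XBP eqxx !andbF.
    have hin x : x \in XA ++ XB ++ [:: v] -> x < n /\ alive x.
      rewrite !mem_cat inE XAP XBP => /or3P[/and5P[-> ->]|/and5P[-> ->]|/eqP->] //.
    by move=> x y /hin[xn xa] /hin[yn ya] [/(fi_inj inv xn yn xa ya)].
  have : perm_eq (PA' ++ PB') ((PA ++ PB) ++ [seq (node u, node x) | x <- XA ++ XB ++ [:: v]]).
    rewrite /PA' /PB' !map_cat /=; apply/permP => a; rewrite !count_cat /=.
    by case: (g u v) => /=; lia.
  move/perm_uniq ->; rewrite cat_uniq (fi_uniq inv) hnew andbT /=.
  (* Old pairs start at nodes that already have a parent, new ones at the root [node u]. *)
  apply/hasPn => _ /mapP[x _ ->]; apply/negP => /(fi_pair inv)[_ _ _ [+ _ _]].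
  by rewrite pu eqxx.
- move=> x y xn yn xy; have [ryu|ryu] := eqVneq (rep y) u; last exact: cov_step.
  have [rxu|rxu] := eqVneq (rep x) u.
    (* Both leaves lie in the tree of [u]; having the same representative, they cannot be
       uncovered. *)
    have [[p [q [h1 h2 h3 h4]]]|[]] := fi_cov inv xn yn xy; last by rewrite rxu ryu eqxx.
    left; exists p, q; split; [exact: signed_old|by apply/above_merge => //; left|by apply/above_merge => //; left|].
    move=> s p' q' /newsigned[h5|[z [zn za zu h5 _]]] h6 h7.
      have [pk qk] := signed_lt h5.
      by apply: (h4 s) => //; apply: anc_old.
    have [zk pz] := fi_node inv zn za.
    have -> : p' = node (rep x).
      apply: above_rootE => //; first by case: h5 => -[-> _].
      by apply: anc_old h6 => //; case: h5 => -[-> _].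
    have -> : q' = node (rep y).
      apply: above_rootE => //; first by case: h5 => -[_ ->].
      by apply: anc_old h7 => //; case: h5 => -[_ ->].
    by split; apply: above_root.
  have [] := @cov_step y x yn xn _ rxu; first by rewrite eq_sym.
    by left; apply: covered_sym.
  by right; apply: uncovered_sym.
Qed.

End Merge.
End Inv.
End Forest.

Definition pairs_nat (P : seq (nat * nat)) : seq nat := size P :: flatten [seq [:: e.1; e.2] | e <- P].

Lemma forest_init n (g : rel nat) (par node : nat -> nat) :
  (forall x, x < n -> par x = x) -> (forall x, x < n -> node x = x) ->
  forest_inv n g n par node id (fun x => x < n) [::] [::].
Proof.
move=> hp hn; split=> //.
- by move=> v vn; rewrite hp // vn leqnn.
- by move=> v vn; rewrite hp // eqxx.
- by move=> j; lia.
- by move=> x xn _; rewrite hn // hp.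
- by move=> x y xn yn _ _; rewrite !hn.
- by move=> v vn _; exists v; rewrite hn.
- by move=> x xn; split=> //; exists 0; rewrite hn.
- by move=> x y _ _ xy; right; split=> // -[] p q [].
Qed.

(** * The signed tree model of a forest with a single root *)

Section Final.
Variables (n : nat) (G : sgraph n) (g : rel nat).
Hypothesis gE : forall x y : 'I_n, g x y = G x y.
Variables (N : nat) (par node rep : nat -> nat) (alive : pred nat) (PA PB : seq (nat * nat)).
Hypothesis inv : forest_inv n g N.+1 par node rep alive PA PB.
Hypothesis alive1 : forall x y, x < n -> y < n -> alive x -> alive y -> x = y.

Let parN : par N = N.
Proof. by have := fi_par inv (ltnSn N); lia. Qed.

Let fpar (i : 'I_N.+1) : 'I_N.+1 := inord (par i).

Let val_fpar i : val (fpar i) = par i.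
Proof. by rewrite /= inordK //; have /andP[] := fi_par inv (ltn_ord i). Qed.

Let val_iter m (i : 'I_N.+1) : val (iter m fpar i) = iter m par i.
Proof. by elim: m => //= m IH; rewrite -IH val_fpar. Qed.

Let root_uniq v : v <= N -> par v = v -> v = N.
Proof.
move=> vN pv; have [x [xn xa <-]] := fi_root inv (vN : is_true (v < N.+1)) pv.
have [y [yn ya <-]] := fi_root inv (ltnSn N) parN.
by rewrite (alive1 xn yn xa ya).
Qed.

Let reach_max v : fconnect fpar v ord_max.
Proof.
have [m] := ubnP (N - v); elim: m v => // m IH v vm.
have [e|ne] := eqVneq (par v) v.
  have -> : v = ord_max by apply: val_inj; apply: root_uniq => //; rewrite -ltnS ltn_ord.
  exact: connect0.
apply: connect_trans (fconnect1 _ _) (IH _ _).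
have := fi_par inv (ltn_ord v); rewrite val_fpar; move: vm ne (ltn_ord v); lia.
Qed.

Let fpar_root : fpar ord_max = ord_max.
Proof. by apply: val_inj; rewrite val_fpar /= parN. Qed.

Definition forest_tree : rooted_tree 'I_N.+1 := RootedTree fpar_root reach_max.

Let ancP (u v : 'I_N.+1) : reflect (above par v u) (anc forest_tree u v).
Proof.
apply: (iffP idP) => [/iter_findex <-|[i e]].
  by exists (findex fpar v u); rewrite -val_iter.
have -> : u = iter i fpar v by apply: val_inj; rewrite val_iter.
exact: fconnect_iter.
Qed.

Let anc_le (u v : 'I_N.+1) : anc forest_tree u v -> v <= u.
Proof. by move/ancP/(above_lt inv (ltn_ord v))/andP => []. Qed.

Let sanc_par (u v : 'I_N.+1) : sanc forest_tree u v -> par v <= u.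
Proof.
rewrite /sanc => /andP[uv /ancP[[|i] e]].
  by case/eqP: uv; apply: val_inj.
rewrite iterSr in e; have /andP[_ pk] := fi_par inv (ltn_ord v).
by have /andP[] := above_lt inv pk (ex_intro _ i e).
Qed.

Let anc_comparable (u1 u2 x : 'I_N.+1) : anc forest_tree u1 x -> anc forest_tree u2 x ->
  u1 <= u2 -> anc forest_tree u1 x /\ anc forest_tree u2 u1.
Proof.
move=> a1 a2 le; split=> //; case/ancP: a1 => i ei; case/ancP: (a2) => j ej.
have [ij|ji] := leqP i j.
  by apply/ancP; exists (j - i); rewrite -ei -iterD subnK.
have : u1 = u2.
  apply: val_inj; apply/eqP; rewrite eqn_leq le /= -ei -(subnK (ltnW ji)) iterD ej.
  by have /andP[] := above_lt inv (ltn_ord u2) (ex_intro _ (i - j) erefl).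
by move=> ->; apply: connect0.
Qed.

Let fb : full_binary forest_tree.
Proof.
apply/forallP => u; rewrite /is_leaf.
have [un|nu] := ltnP u n.
  apply/orP; left; apply/eqP/setP => c; rewrite !inE; apply/negbTE/negP => /andP[cr /eqP e].
  have ec : par c = u by rewrite -e val_fpar.
  have [e'|ne] := eqVneq (par c) c; last by have := fi_leaf inv (ltn_ord c) ne; lia.
  by case/eqP: cr; apply: val_inj; apply: root_uniq; rewrite // -ltnS ltn_ord.
apply/orP; right.
have [|a [b [aj bj ab [ea eb] h]]] := fi_bin inv (j := u); first by rewrite nu ltn_ord.
have uN := ltn_ord u.
suff -> : children forest_tree u = [set inord a; inord b].
  by rewrite cards2 -(inj_eq val_inj) /= !inordK ?ab //; lia.
apply/setP => c; rewrite !inE -!(inj_eq val_inj) /= !inordK //; try lia; last first.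
  by have := fi_par inv (ltn_ord c); lia.
apply/idP/idP => [/andP[cN /eqP e]|].
  have cu : c < u.
    have := fi_par inv (ltn_ord c); rewrite e leq_eqVlt => /andP[/orP[/eqP cu|//] _].
    by case/eqP: cN; apply: root_uniq; rewrite ?e // -ltnS ltn_ord.
  by case: (h _ cu e) => ->; rewrite eqxx ?orbT.
by case/orP => /eqP->; rewrite ?ea ?eb eqxx andbT; lia.
Qed.

Let setp (e : nat * nat) : {set 'I_N.+1} := [set inord e.1; inord e.2].

Let setp_eq p q p' q' : (p, q) \in PA ++ PB -> p' < N.+1 -> q' < N.+1 ->
  setp (p, q) = [set inord p'; inord q'] -> (p, q) = (p', q') \/ (p, q) = (q', p').
Proof.
move=> /(fi_pair inv)[pk qk pq _] pk' qk' /setP e.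
move: (e (inord p)) (e (inord q)); rewrite !inE !eqxx orbT /=.
rewrite -!(inj_eq val_inj) /= !inordK // => /esym/orP[]/eqP ep /esym/orP[]/eqP eq; subst.
- by rewrite eqxx in pq.
- by left.
- by right.
- by rewrite eqxx in pq.
Qed.

Let setp_inj : {in PA ++ PB &, injective setp}.
Proof.
move=> [p q] [p' q'] h h' e; have [pk' qk' _ _] := fi_pair inv h'.
case: (setp_eq h pk' qk' e) => // -[e1 e2]; subst.
by have := fi_asym inv h; rewrite h'.
Qed.

Let sets (P : seq (nat * nat)) : {set {set 'I_N.+1}} := [set:: map setp P].

Let setsU P : (P \in sets PA :|: sets PB) = (P \in map setp (PA ++ PB)).
Proof. by rewrite !inE map_cat mem_cat. Qed.

Let disj : [disjoint sets PA & sets PB].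
Proof.
rewrite disjoint_subset; apply/subsetP => P; rewrite !inE => /mapP[e eA ->].
apply/negP => /mapP[e' eB] /setp_inj; rewrite !mem_cat eA eB orbT => /(_ isT isT) ee.
move: (fi_uniq inv); rewrite cat_uniq => /and3P[_ /hasPn/(_ _ eB) + _].
by rewrite /= -ee eA.
Qed.

Let transv P : P \in sets PA :|: sets PB -> Defs.transversal forest_tree P.
Proof.
rewrite setsU => /mapP[[p q] /(fi_pair inv)[pk qk pq [pp qp h]] ->].
(* The only root is [N], the largest node. Since [q < par p <= N], [q] has a parent and the second
   alternative of [fi_pair] applies. *)
have h2 : p < par q.
  case: h => // eq; have qN := root_uniq qk eq.
  by have := fi_par inv pk; lia.
apply/existsP; exists (inord p); apply/existsP; exists (inord q).
have neq : (inord p : 'I_N.+1) != inord q by rewrite -(inj_eq val_inj) /= !inordK.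
rewrite eqxx /=; apply/andP; split; apply/negP => a.
  have /sanc_par : sanc forest_tree (inord p) (inord q) by rewrite /sanc neq.
  by rewrite !inordK //; lia.
have /sanc_par : sanc forest_tree (inord q) (inord p) by rewrite /sanc eq_sym neq.
by rewrite !inordK //; lia.
Qed.

Let pair_facts (p q : nat) : (p, q) \in PA ++ PB -> [/\ p < par p, q < par q, q < par p & p < par q].
Proof.
move=> /(fi_pair inv)[pk qk pq [pp qp h]].
have h1 := fi_par inv pk; have h2 := fi_par inv qk.
have h5 : par q != q by apply: contraL qp => /eqP/(root_uniq qk) ->; lia.
by split=> //; [lia|lia|case: h => //; lia].
Qed.

(* An ancestor has a larger number, so this excludes crossings. *)
Let pair_lt P (x y : 'I_N.+1) : P \in sets PA :|: sets PB -> x \in P -> y \in P ->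
  x < par y.
Proof.
rewrite setsU => /mapP[[p q] pq ->]; have [pk qk _ _] := fi_pair inv pq.
by have [h1 h2 h3 h4] := pair_facts pq; rewrite !inE => /orP[]/eqP-> /orP[]/eqP->; rewrite !inordK.
Qed.

Let noncr P Q : P \in sets PA :|: sets PB -> Q \in sets PA :|: sets PB ->
  ~~ cross forest_tree P Q.
Proof.
move=> hP hQ; apply/negP => /andP[].
move=> /exists_inP[x xP /exists_inP[y yQ /sanc_par pyx]].
move=> /exists_inP[y' yQ' /exists_inP[x' xP' /sanc_par pxy]].
(* A crossing would give [par y <= x < par x' <= y' < par y]. *)
have := pair_lt hQ yQ' yQ; have := pair_lt hP xP xP'; lia.
Qed.

Definition forest_model : signed_tree_model 'I_N.+1 :=
  SignedTreeModel fb disj transv noncr.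

Hypothesis nN : n <= N.+1.

Definition leaf_of (x : 'I_n) : 'I_N.+1 := widen_ord nN x.

Let mem_signed s p q : signed PA PB s p q ->
  [set inord p; inord q] \in (if s then sets PB else sets PA).
Proof.
by case: s => -[] h; rewrite inE; [|rewrite setUC| |rewrite setUC];
  apply/mapP; [exists (p, q)|exists (q, p)|exists (p, q)|exists (q, p)].
Qed.

Let signed_mem' s (u v : 'I_N.+1) : [set u; v] \in (if s then sets PB else sets PA) ->
  signed PA PB s u v.
Proof.
move=> h; have : exists2 e, e \in (if s then PB else PA) & [set u; v] = setp e.
  by case: s h; rewrite inE => /mapP.
move=> [[p q] hs /esym e].
have hpq : (p, q) \in PA ++ PB by rewrite mem_cat; case: s hs {h} => ->; rewrite ?orbT.
have [|||[eu ev]|[eu ev]] := setp_eq hpq (p' := u) (q' := v) => //.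
- by rewrite e !inord_val.
- by left; rewrite -eu -ev.
- by right; rewrite -eu -ev.
Qed.

(** With one alive vertex all leaves have the same representative, so distinct leaves are covered.
    The least pair lies between any other pair above the two leaves and the leaves themselves, so it
    is the only one that covers them, and its sign decides. *)
Lemma forest_modelP : model_of G forest_model leaf_of.
Proof.
split.
- by move=> x y /(congr1 val) /= /val_inj.
- move=> v; split=> [|[x <-]].
    have [vn _|nv] := ltnP v n; first by exists (Ordinal vn); apply: val_inj.
    have [|a [b [av bv _ [ea _] _]]] := fi_bin inv (j := v); first by rewrite nv ltn_ord.
    have vN := ltn_ord v; have aN : a < N.+1 by lia.
    rewrite /is_leaf => /eqP/setP/(_ (inord a)).
    rewrite !inE -!(inj_eq val_inj) /= !inordK ?ea ?eqxx ?andbT //.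
    by move/negbFE/eqP; lia.
  rewrite /is_leaf; apply/eqP/setP => c; rewrite !inE; apply/negbTE/negP => /andP[cr /eqP e].
  have ec : par c = x by rewrite -val_fpar [fpar c]e.
  have [e'|ne] := eqVneq (par c) c; last by have := fi_leaf inv (ltn_ord c) ne; have := ltn_ord x; lia.
  by case/eqP: cr; apply: val_inj; apply: root_uniq; rewrite // -ltnS ltn_ord.
move=> x y.
have cov u' v' : [set u'; v'] \in sets PA :|: sets PB -> exists s, signed PA PB s u' v'.
  rewrite inE => /orP[] h; first by exists false; apply: signed_mem'.
  by exists true; apply: signed_mem'.
have le_signed s p q : signed PA PB s p q -> p < N.+1 /\ q < N.+1.
  exact: signed_lt inv _ _ _.
have [exy|xy] := eqVneq x y.
  (* No leaf is covered with itself: its ancestors form a chain, so they contain no transversal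
     pair. *)
  subst y; rewrite adj_irrefl; split=> // -[u' [v' [_ [/transv + a1 a2 _]]]].
  move=> /existsP[u /existsP[v /and3P[/eqP e nuv nvu]]].
  have hu : anc forest_tree u (leaf_of x).
    have : u \in [set u'; v'] by rewrite e !inE eqxx.
    by rewrite !inE => /orP[]/eqP->.
  have hv : anc forest_tree v (leaf_of x).
    have : v \in [set u'; v'] by rewrite e !inE eqxx orbT.
    by rewrite !inE => /orP[]/eqP->.
  case: (leqP u v) => [/(anc_comparable hu hv)[_]|/ltnW/(anc_comparable hv hu)[_]];
    by rewrite ?(negbTE nuv) ?(negbTE nvu).
have [[p [q [h1 h2 h3 h4]]]|[h _ _]] := fi_cov inv (ltn_ord x) (ltn_ord y) xy; last first.
  have [rx ax _] := fi_rep inv (ltn_ord x); have [ry ay _] := fi_rep inv (ltn_ord y).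
  by rewrite (alive1 rx ry ax ay) eqxx in h.
rewrite gE in h1; have [pN qN] := le_signed _ _ _ h1.
have ap : anc forest_tree (inord p) (leaf_of x) by apply/ancP; rewrite inordK.
have aq : anc forest_tree (inord q) (leaf_of y) by apply/ancP; rewrite inordK.
have mint u' v' : [set u'; v'] \in sets PA :|: sets PB -> anc forest_tree u' (leaf_of x) ->
    anc forest_tree v' (leaf_of y) -> p <= u' /\ q <= v'.
  by move=> /cov[s hs] /ancP a1 /ancP a2; apply: (h4 s).
split=> [gxy|[u' [v' [hB [hu a1 a2 mn]]]]].
  exists (inord p), (inord q); split; first by have := mem_signed h1; rewrite gxy.
  split=> //.
    by rewrite inE; have := mem_signed h1; rewrite gxy => ->; rewrite orbT.
  move=> u'' v'' h b1 b2 b3 b4; have [pu qv] := mint _ _ h b2 b4.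
  have := anc_le b1; have := anc_le b3; rewrite !inordK // => l1 l2.
  by congr [set _; _]; apply: val_inj; apply/eqP; rewrite /= inordK // eqn_leq ?l1 ?l2 ?pu ?qv.
have [pu qv] := mint _ _ hu a1 a2.
have e : [set inord p; inord q] = [set u'; v'].
  apply: mn => //.
  - by have := mem_signed h1; rewrite inE; case: (G x y) => ->; rewrite ?orbT.
  - by have [] := anc_comparable ap a1; rewrite ?inordK.
  - by have [] := anc_comparable aq a2; rewrite ?inordK.
have := mem_signed h1; rewrite e; case: (G x y) => // hA.
by have /pred0P/(_ [set u'; v']) := disj; rewrite /= hA hB.
Qed.

Definition ordpairs (P : seq (nat * nat)) : seq ('I_N.+1 * 'I_N.+1) :=
  [seq (inord e.1, inord e.2) | e <- P].

Let lists_sub P : {subset P <= PA ++ PB} -> uniq P -> lists_pairs (ordpairs P) (sets P).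
Proof.
move=> sP uP; rewrite /lists_pairs -map_comp; apply: uniq_perm.
- by rewrite map_inj_in_uniq // => e e' /sP h /sP h'; apply: setp_inj.
- exact: enum_uniq.
- by move=> S; rewrite mem_enum inE.
Qed.

Lemma forest_lists : lists_pairs (ordpairs PA) (pairsA forest_model) /\
  lists_pairs (ordpairs PB) (pairsB forest_model).
Proof.
have := fi_uniq inv; rewrite cat_uniq => /and3P[uA _ uB].
by split; apply: lists_sub => // e h; rewrite mem_cat h ?orbT.
Qed.

Lemma forest_num_pairs : num_pairs forest_model = size PA + size PB.
Proof.
have [/perm_size hA /perm_size hB] := forest_lists.
by move: hA hB; rewrite !size_map -!cardE => -> ->.
Qed.

Let pairs_codeE P : {subset P <= PA ++ PB} -> pairs_code (ordpairs P) = pairs_nat P.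
Proof.
move=> sP; rewrite /pairs_code /pairs_nat size_map -map_comp; congr (_ :: flatten _).
apply/eq_in_map => -[p q] /sP/(fi_pair inv)[pk qk _ _] /=.
by rewrite !inordK.
Qed.

Lemma forest_code : model_code forest_tree leaf_of (ordpairs PA) (ordpairs PB) =
  N.+1 :: map par (iota 0 N.+1) ++ iota 0 n ++ pairs_nat PA ++ pairs_nat PB.
Proof.
rewrite /model_code !pairs_codeE => [|e h|e h]; rewrite ?mem_cat ?h ?orbT //.
congr (_ :: _ ++ _ ++ _).
  rewrite -val_enum_ord -map_comp; apply: eq_map => v /=; exact: val_fpar.
by rewrite -val_enum_ord.
Qed.

End Final.

(** * Sampling *)

(** If [q] divides the number of words, a random word is a multiple of [q] with probability exactly
    [1 / q]. *)
Lemma card_multiples q M W : 0 < q -> W = q * M -> #|[pred i : 'I_W | q %| i]| = M.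
Proof.
move=> q0 ->.
have lt (j : 'I_M) : q * j < q * M by rewrite ltn_pmul2l.
have inj : injective (fun j => Ordinal (lt j)).
  by move=> i j [] /eqP; rewrite eqn_pmul2l // => /eqP/val_inj.
rewrite -[RHS]card_ord -(card_codom inj); apply: eq_card => i; rewrite inE.
apply/idP/codomP => [/dvdnP[j e]|[j ->]]; last by rewrite /= dvdn_mulr.
have jM : j < M by move: (ltn_ord i); rewrite [X in X < _]e [j * q]mulnC ltn_pmul2l.
by exists (Ordinal jM); apply: val_inj; rewrite /= e; exact: mulnC.
Qed.

(** This is [(1 - 1 / q) ^ q <= 1 / 2] raised to the power [t]: the first two binomial terms of
    [((q - 1) + 1) ^ q] already add up to at least [2 * (q - 1) ^ q]. *)
Lemma pred_pow_le q t s : 0 < q -> q * t <= s -> 2 ^ t * q.-1 ^ s <= q ^ s.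
Proof.
move=> q0 /subnK <-; rewrite !expnD mulnCA.
apply: leq_mul; first by case: (s - _) => // m; rewrite leq_exp2r // leq_pred.
rewrite !expnM -expnMn; case: t => // t; rewrite leq_exp2r //.
case: q q0 => // q _; rewrite -[q.+1.-1]/q [X in _ <= X ^ _](_ : _ = q + 1) ?addn1 // -[X in _ <= X ^ _]addn1 expnDn.
rewrite big_ord_recl big_ord_recl /= subn0 !exp1n bin0 bin1 !muln1 /bump /= subSS subn0 mul1n.
rewrite addnA; apply: leq_trans (leq_addr _ _).
by rewrite mulSn mul1n leq_add2l expnS leq_mul.
Qed.

(** * The expected number of survivors of a round *)

Section Drift.
Variables (n : nat) (G : sgraph n) (d : nat).
Hypothesis tw : twin_width_le d G.
Variables (q M W t : nat).
Hypotheses (q0 : 0 < q) (WE : W = q * M) (qc : 16 * trace_const d <= q).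
Hypothesis tn : 4 * n ^ 2 <= 2 ^ t.
Variable A : {set 'I_n}.
Local Notation F := {ffun 'I_n -> 'I_W}.

Definition sampled (f : F) : {set 'I_n} := [set x in A | q %| f x].

(** [u] and [v] are left out because their mutual pair is recorded in any case. *)
Definition sdiff (u v : 'I_n) : {set 'I_n} :=
  [set x in A | [&& x != u, x != v & G u x != G v x]].

(** The labels are independent, and each vertex of [D] has [q.-1 * M] admissible labels out of
    [q * M]. *)
Lemma card_avoid (D : {set 'I_n}) :
  q * t <= #|D| -> 2 ^ t * #|[pred f : F | [forall x in D, ~~ (q %| f x)]]| <= W ^ n.
Proof.
move=> lD.
pose P (x : 'I_n) := if x \in D then [pred i : 'I_W | ~~ (q %| i)] else predT.
have -> : #|[pred f : F | [forall x in D, ~~ (q %| f x)]]| = #|family P|.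
  apply: eq_card => f; rewrite !inE; apply/forall_inP/familyP => [h x|h x xD].
    by rewrite /P; case: ifP => [/h|].
  by have := h x; rewrite /P xD.
rewrite card_family foldrE big_map big_enum /=.
rewrite (bigID (mem D)) /=.
rewrite (eq_bigr (fun=> q.-1 * M)) => [|x xD]; last first.
  transitivity #|[predC [pred i : 'I_W | q %| i]]|.
    by apply: eq_card => i; rewrite /P xD.
  have := cardC [pred i : 'I_W | q %| i].
  rewrite (card_multiples q0 WE) card_ord => /eqP; rewrite [X in _ == X]WE => /eqP.
  by set a := #|_|; rewrite -{1}(prednK q0) mulSn => /addnI.
rewrite (eq_bigr (fun=> W) (P := fun i => i \notin D)) => [|x xD]; last first.
  by rewrite /P (negbTE xD) -[RHS]card_ord; apply: eq_card.
rewrite !prod_nat_const expnMn.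
have Dn : #|D| <= n by have := max_card (mem D); rewrite card_ord.
have -> : #|[pred i | i \notin D]| = n - #|D|.
  apply: (@addnI #|D|); rewrite subnKC // -[RHS]card_ord -(cardC (mem D)).
  by congr (_ + _); apply: eq_card.
have -> : W ^ n = q ^ #|D| * M ^ #|D| * W ^ (n - #|D|).
  by rewrite -expnMn -WE -expnD subnKC.
by rewrite !mulnA !leq_mul // pred_pow_le.
Qed.

Lemma card_hit x : q * #|[pred f : F | q %| f x]| = W ^ n.
Proof.
pose P (y : 'I_n) := if y == x then [pred i : 'I_W | q %| i] else predT.
have -> : #|[pred f : F | q %| f x]| = #|family P|.
  apply: eq_card => f; rewrite !inE; apply/idP/familyP => [h y|h].
    by rewrite /P; case: eqP => [->|].
  by have := h x; rewrite /P eqxx.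
rewrite card_family foldrE big_map big_enum /= (bigD1 x) //= {1}/P eqxx.
rewrite (card_multiples q0 WE) mulnA -WE.
rewrite (eq_bigr (fun=> W)) => [|y /negbTE yx]; last first.
  by rewrite /P yx -[RHS]card_ord; apply: eq_card.
rewrite prod_nat_const -expnS; congr (_ ^ _).
transitivity (#|predC1 x|.+1); first by congr _.+1; apply: eq_card.
by rewrite cardC1 card_ord prednK // (leq_ltn_trans _ (ltn_ord x)).
Qed.

(** In [bad1] the sample misses all vertices telling some far pair apart; in [bad2] it exceeds
    [#|A| / (4 * trace_const d)]. Each has probability at most 1/4. Outside both, [h f] is at most
    [#|A| / 4 + 1], hence at most [3 * #|A| / 4] because [#|A| > 1]. *)
Lemma drift (h : F -> nat) : 1 < #|A| ->
  (forall f, h f <= #|A|) ->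
  (forall f, (forall u v, u \in A -> v \in A ->
      trace G (sampled f) u = trace G (sampled f) v -> #|sdiff u v| <= q * t) ->
     h f <= #|traces G (sampled f) A|) ->
  8 * \sum_f h f <= 7 * (#|A| * W ^ n).
Proof.
move=> A1 hA hT.
pose bad1 := [pred f : F | [exists u, exists v, (q * t < #|sdiff u v|) &&
   [forall x in sdiff u v, ~~ (q %| f x)]]].
pose bad2 := [pred f : F | #|A| < 4 * trace_const d * #|sampled f|].
have b1 : 4 * #|bad1| <= W ^ n.
  pose bad (p : 'I_n * 'I_n) := [pred f : F | (q * t < #|sdiff p.1 p.2|) &&
     [forall x in sdiff p.1 p.2, ~~ (q %| f x)]].
  have h1 : #|bad1| <= \sum_p #|bad p|.
    rewrite -sum1_card big_mkcond /=.
    under [X in _ <= X]eq_bigr do rewrite -sum1_card big_mkcond.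
    rewrite exchange_big /=; apply: leq_sum => f _.
    case: ifP => // /existsP[u /existsP[v uv]].
    by rewrite (bigD1 (u, v)) //= [(_ \in bad _)]uv.
  have h2 p : 2 ^ t * #|bad p| <= W ^ n.
    have [le|/negbTE lt] := boolP (q * t < #|sdiff p.1 p.2|).
      apply: leq_trans (card_avoid (ltnW le)); rewrite leq_mul2l; apply/orP; right.
      by apply: subset_leq_card; apply/subsetP => f; rewrite !inE => /andP[].
    by rewrite (eq_card0 (A := bad p)) ?muln0 // => f; rewrite inE lt.
  have h3 : 2 ^ t * #|bad1| <= n ^ 2 * W ^ n.
    apply: leq_trans (_ : 2 ^ t * \sum_p #|bad p| <= _); first by rewrite leq_mul2l h1 orbT.
    rewrite big_distrr /=; apply: (@leq_trans (\sum_(p : 'I_n * 'I_n) W ^ n)); first by apply: leq_sum => p _; apply: h2.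
    by rewrite sum_nat_const card_prod card_ord mulnn.
  have An : #|A| <= n by have := max_card (mem A); rewrite card_ord.
  have n0 : 0 < n ^ 2 by rewrite expn_gt0 (leq_trans _ An) // ltnW.
  rewrite -(leq_pmul2l n0) mulnA [n ^ 2 * 4]mulnC.
  by apply: leq_trans h3; rewrite leq_mul2r tn orbT.
(* Markov's inequality: the mean sample size is [#|A| / q], and [q >= 16 * trace_const d]. *)
have b2 : 4 * #|bad2| <= W ^ n.
  have h1 : #|A| * #|bad2| <= \sum_f 4 * trace_const d * #|sampled f|.
    rewrite mulnC -sum_nat_const big_mkcond /=; apply: leq_sum => f _.
    by case: ifP => // /ltnW.
  have h2 : q * \sum_f #|sampled f| = #|A| * W ^ n.
    under eq_bigr do rewrite -sum1_card big_mkcond.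
    rewrite exchange_big /= big_distrr /= -sum_nat_const [RHS]big_mkcond /=.
    apply: eq_bigr => x _; have [xA|/negbTE xA] := boolP (x \in A).
      rewrite -(card_hit x) -sum1_card; congr (_ * _); rewrite [RHS]big_mkcond /=.
      by apply: eq_bigr => f _; rewrite !inE xA.
    by rewrite big1 ?muln0 // => f _; rewrite inE xA.
  rewrite -big_distrr /= in h1.
  have A0 : 0 < #|A| by lia.
  rewrite -(leq_pmul2l A0) -h2; move: h1 qc; set s := \sum_f _; set b := #|bad2|; set a := #|A|.
  by nia.
(* The average of the right side, divided by 4, is at most [3/4 + 1/16 + 1/16 = 7/8] of [#|A|]. *)
have h1 f : 4 * h f <= 3 * #|A| + #|A| * (f \in bad1) + #|A| * (f \in bad2).
  have [|nb1] := boolP (f \in bad1); first by have := hA f; lia.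
  have [|nb2] := boolP (f \in bad2); first by have := hA f; lia.
  have h2 : h f <= #|traces G (sampled f) A|.
    apply: hT => u v uA vA /setP e; rewrite leqNgt; apply: contra nb1 => lt.
    rewrite inE; apply/existsP; exists u; apply/existsP; exists v; rewrite lt /=.
    apply/forall_inP => x; rewrite !inE => /and4P[xA _ _ ne]; apply: contra ne => qx.
    by move: (e x); rewrite !inE xA qx /= => ->.
  have h3 : #|traces G (sampled f) A| <= trace_const d * #|sampled f| + 1.
    apply: leq_trans (card_traces_le _ tw); apply: subset_leq_card.
    exact: imsetS (subsetT _).
  by move: nb2; rewrite inE -leqNgt; lia.
have : 4 * \sum_f h f <= 3 * #|A| * W ^ n + #|A| * #|bad1| + #|A| * #|bad2|.
  rewrite big_distrr /=; apply: (leq_trans (leq_sum _ (fun f _ => h1 f))).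
  have sE (b : pred F) : \sum_f #|A| * (f \in b) = #|A| * #|b|.
    rewrite -big_distrr /=; congr (_ * _); rewrite -sum1_card [RHS]big_mkcond /=.
    by apply: eq_bigr => f _; case: ifP.
  by rewrite 2!big_split /= sum_nat_const card_ffun !card_ord !sE mulnC.
have := leq_mul (leqnn #|A|) b1; have := leq_mul (leqnn #|A|) b2.
by rewrite ![#|A| * (4 * _)]mulnCA mulnA -!mulnA; lia.
Qed.
End Drift.

(** * A while language for the word RAM *)

(** Comparison by [eqn] lets [/=] resolve updates at numeral indices. *)
Definition upd (f : nat -> nat) (k v : nat) : nat -> nat :=
  fun x => if eqn x k then v else f x.
Arguments upd f k v x /.

Definition updA (f : nat -> nat -> nat) (a i v : nat) : nat -> nat -> nat :=
  fun b => if eqn b a then upd (f b) i v else f b.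
Arguments updA f a i v b /.

Record store := Store { rg : nat -> nat; ar : nat -> nat -> nat; tm : nat }.

(** There is no random command: words are drawn only in the hand-written sampling loop of [prog]. *)
Inductive cmd :=
| Skip
| Set_ (r k : nat)
| Bin (o : binop) (r a b : nat)
| Ld (r a i : nat)
| St (a i r : nat)
| Seq (c1 c2 : cmd)
| If (r : nat) (c1 c2 : cmd)
| While (r : nat) (c : cmd).

Fixpoint mods (c : cmd) : seq nat :=
  match c with
  | Skip | St _ _ _ => [::]
  | Set_ r _ | Bin _ r _ _ | Ld r _ _ => [:: r]
  | Seq c1 c2 | If _ c1 c2 => mods c1 ++ mods c2
  | While _ c => mods c
  end.

Fixpoint amods (c : cmd) : seq nat :=
  match c with
  | St a _ _ => [:: a]
  | Seq c1 c2 | If _ c1 c2 => amods c1 ++ amods c2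
  | While _ c => amods c
  | _ => [::]
  end.

Definition op_val (o : binop) (x y : nat) : nat :=
  match o with
  | Add => x + y
  | Defs.Sub => x - y
  | Mul => x * y
  | Div => x %/ y
  | Mod => x %% y
  | Lt => x < y
  | Eq => x == y
  | And => Nat.land x y
  | Or => Nat.lor x y
  | Xor => Nat.lxor x y
  end.

(* Where the machine word agrees with the ideal result. *)
Definition op_ok (W : nat) (o : binop) (x y : nat) : bool :=
  match o with
  | Add => x + y < W
  | Defs.Sub => y <= x < W
  | Mul => x * y < W
  | _ => 1 < W
  end.

Lemma eval_opE w o x y : op_ok (2 ^ w) o x y -> eval_op w o x y = op_val o x y.
Proof.
case: o => //=; try by move=> ?; rewrite modn_small.
- by move=> /andP[yx xW]; rewrite addnBA ?(leq_trans yx (ltnW xW)) // addnC -addnBA // modnDl modn_small //; lia.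
- by move=> W1; rewrite modn_small //; case: (x < y) => //; lia.
- by move=> W1; rewrite modn_small //; case: (x == y) => //; lia.
Qed.

Fixpoint csize (c : cmd) : nat :=
  match c with
  | Skip => 0
  | Set_ _ _ | Bin _ _ _ _ => 1
  | Ld _ _ _ | St _ _ _ => 4
  | Seq c1 c2 => csize c1 + csize c2
  | If _ c1 c2 => (csize c1 + csize c2).+2
  | While _ c => (csize c).+2
  end.

(* Register 0 holds addresses and register 1 the common length [Z] of the
   arrays; cell [i] of array [a] is at address [a * Z + i]. *)
Fixpoint compile (pos : nat) (c : cmd) : program :=
  match c with
  | Skip => [::]
  | Set_ r k => [:: Const r.+2 k]
  | Bin o r a b => [:: Op o r.+2 a.+2 b.+2]
  | Ld r a i => [:: Const 0 a; Op Mul 0 0 1; Op Add 0 0 i.+2; Read r.+2 0]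
  | St a i r => [:: Const 0 a; Op Mul 0 0 1; Op Add 0 0 i.+2; Write 0 r.+2]
  | Seq c1 c2 => compile pos c1 ++ compile (pos + csize c1) c2
  | If r c1 c2 =>
      JumpZero r.+2 (pos + (csize c1).+2) ::
      compile pos.+1 c1 ++
      Jump (pos + (csize c1 + csize c2).+2) :: compile (pos + (csize c1).+2) c2
  | While r c =>
      JumpZero r.+2 (pos + (csize c).+2) :: compile pos.+1 c ++ [:: Jump pos]
  end.

Lemma size_compile pos c : size (compile pos c) = csize c.
Proof.
by elim: c pos => //= [c1 h1 c2 h2 pos|r c1 h1 c2 h2 pos|r c h pos];
  rewrite size_cat /= ?h1 ?h2 ?h; lia.
Qed.

(** * Runs with the same result for all random words *)

Section Reach.
Variables (p : program) (w : nat).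
Local Notation W := (2 ^ w).

Definition reach (k : nat) (s s' : state) : Prop :=
  forall l : seq 'I_W, size l = k -> run p s l = s'.

Lemma reach0 s : reach 0 s s. Proof. by move=> [|]. Qed.

Lemma run_cat s (l1 l2 : seq 'I_W) : run p s (l1 ++ l2) = run p (run p s l1) l2.
Proof. exact: foldl_cat. Qed.

Lemma reach_trans k1 k2 s1 s2 s3 : reach k1 s1 s2 -> reach k2 s2 s3 -> reach (k1 + k2) s1 s3.
Proof.
move=> h1 h2 l ls; rewrite -(cat_take_drop k1 l) run_cat (h1 (take _ _)) ?h2 //.
  by rewrite size_drop ls addKn.
by rewrite size_take ls; case: ltnP => //; lia.
Qed.

Lemma reach1 s s' : (forall x, step p w s x = s') -> reach 1 s s'.
Proof. by move=> h [|x [|//]] //= _; apply: h. Qed.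

Lemma reach_step k s s1 s2 : (forall x, step p w s x = s1) -> reach k s1 s2 -> reach k.+1 s s2.
Proof. by move=> /reach1 h1; apply: (reach_trans h1). Qed.

Definition code_at (pos : nat) (code : program) : Prop :=
  forall i, i < size code -> nth Halt p (pos + i) = nth Halt code i.

Lemma code_at_cat pos l1 l2 :
  code_at pos (l1 ++ l2) <-> code_at pos l1 /\ code_at (pos + size l1) l2.
Proof.
split=> [h|[h1 h2] i]; [split=> i hi|].
- by rewrite h ?nth_cat ?hi // size_cat; lia.
- rewrite -addnA h ?nth_cat ?size_cat ?ltn_add2l // ltnNge leq_addr /=.
  by rewrite addKn.
- rewrite size_cat nth_cat => hi; case: ltnP => [/h1//|hl].
  by rewrite -h2 ?ltn_subLR // -addnA subnKC.
Qed.

Lemma code_at_cons pos x l : code_at pos (x :: l) <-> nth Halt p pos = x /\ code_at pos.+1 l.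
Proof.
rewrite -cat1s code_at_cat addn1; split=> -[h1 h2]; split=> //.
  by rewrite -[pos]addn0 h1.
by move=> [|//] _; rewrite addn0.
Qed.

End Reach.

(** * Semantics of commands and correctness of the compiler *)

Section Ram.
Variables (p : program) (w K Z : nat).
Hypothesis KZ : K * Z <= 2 ^ w.
Hypothesis K1 : 1 < K.
Hypothesis Z0 : 0 < Z.
Local Notation W := (2 ^ w).

Definition setr (s : store) r v := Store (upd (rg s) r v) (ar s) (tm s).+1.

(** [tm] counts machine steps exactly: the [then] branch pays for the jump over [else], a loop
    iteration for its test and the jump back. The side conditions exclude overflow, so values are
    plain natural numbers. *)
Inductive exec : cmd -> store -> store -> Prop :=
| ex_skip s : exec Skip s s
| ex_set s r k : k < W -> exec (Set_ r k) s (setr s r k)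
| ex_bin s o r a b : op_ok W o (rg s a) (rg s b) ->
    exec (Bin o r a b) s (setr s r (op_val o (rg s a) (rg s b)))
| ex_ld s r a i : a < K -> rg s i < Z ->
    exec (Ld r a i) s (Store (upd (rg s) r (ar s a (rg s i))) (ar s) (4 + tm s))
| ex_st s r a i : a < K -> rg s i < Z ->
    exec (St a i r) s (Store (rg s) (updA (ar s) a (rg s i) (rg s r)) (4 + tm s))
| ex_seq s s1 s2 c1 c2 : exec c1 s s1 -> exec c2 s1 s2 -> exec (Seq c1 c2) s s2
| ex_if1 s s1 r c1 c2 : rg s r != 0 ->
    exec c1 (Store (rg s) (ar s) (tm s).+1) s1 ->
    exec (If r c1 c2) s (Store (rg s1) (ar s1) (tm s1).+1)
| ex_if0 s s1 r c1 c2 : rg s r = 0 ->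
    exec c2 (Store (rg s) (ar s) (tm s).+1) s1 -> exec (If r c1 c2) s s1
| ex_while0 s r c : rg s r = 0 ->
    exec (While r c) s (Store (rg s) (ar s) (tm s).+1)
| ex_whileS s s1 s2 r c : rg s r != 0 ->
    exec c (Store (rg s) (ar s) (tm s).+1) s1 ->
    exec (While r c) (Store (rg s1) (ar s1) (tm s1).+1) s2 ->
    exec (While r c) s s2.

Definition same_off (rs as_ : seq nat) (s s' : store) : Prop :=
  (forall r, r \notin rs -> rg s' r = rg s r) /\
  (forall a, a \notin as_ -> forall i, ar s' a i = ar s a i).

Lemma same_off_trans rs as_ s1 s2 s3 :
  same_off rs as_ s1 s2 -> same_off rs as_ s2 s3 -> same_off rs as_ s1 s3.
Proof.
by move=> [h1 h2] [h3 h4]; split=> [r h|a h i]; [rewrite h3 ?h1 | rewrite h4 ?h2].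
Qed.

Lemma same_off_sub rs rs' as_ as' s1 s2 : {subset rs <= rs'} -> {subset as_ <= as'} ->
  same_off rs as_ s1 s2 -> same_off rs' as' s1 s2.
Proof.
by move=> h1 h2 [h3 h4]; split=> [r h|a h i]; [apply: h3; apply: contra h => /h1|
  apply: h4; apply: contra h => /h2].
Qed.

Lemma exec_same_off c s s' : exec c s s' -> same_off (mods c) (amods c) s s'.
Proof.
elim=> {c s s'} /=.
- by [].
- by move=> s r k _; split=> //= x; rewrite inE => /negbTE; rewrite eqE /= => ->.
- by move=> s o r a b _; split=> //= x; rewrite inE => /negbTE; rewrite eqE /= => ->.
- by move=> s r a i _ _; split=> //= x; rewrite inE => /negbTE; rewrite eqE /= => ->.
- by move=> s r a i _ _; split=> //= x; rewrite inE => /negbTE; rewrite eqE /= => ->.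
- move=> s s1 s2 c1 c2 _ h1 _ h2; apply: (same_off_trans (s2 := s1));
  [move: h1 | move: h2]; apply: same_off_sub => x; rewrite mem_cat => ->; rewrite ?orbT //.
- move=> s s1 r c1 c2 _ _ [h1 h2]; split=> /= x; rewrite mem_cat negb_or => /andP[a b].
    by rewrite h1. by move=> i; rewrite h2.
- move=> s s1 r c1 c2 _ _ [h1 h2]; split=> /= x; rewrite mem_cat negb_or => /andP[a b].
    by rewrite h1. by move=> i; rewrite h2.
- by [].
- move=> s s1 s2 r c _ _ [h1 h2] _ [h3 h4]; split=> /= x h.
    by rewrite h3 //= h1. by move=> i; rewrite h4 //= h2.
Qed.

(** Register 0 is scratch space for addresses, hence unconstrained. *)
Definition represents (s : store) (t : state) : Prop :=
  [/\ forall r, reg t r.+2 = rg s r, reg t 1 = Z &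
      forall a i, a < K -> i < Z -> Defs.mem t (a * Z + i) = ar s a i].

Lemma addr_lt a i : a < K -> i < Z -> a * Z + i < W.
Proof. move=> aK iZ; apply: leq_trans KZ; nia. Qed.

Lemma addr_inj a i b j : i < Z -> j < Z -> a * Z + i = b * Z + j -> a = b /\ i = j.
Proof.
move=> iZ jZ e; have ab : a = b.
  by rewrite -[a]addn0 -(divn_small iZ) -divnMDl // e divnMDl // divn_small ?addn0.
by split=> //; move: e; rewrite ab; lia.
Qed.

Lemma compile_addr pos a i t s : pc t = pos -> represents s t -> a < K -> rg s i < Z ->
  code_at p pos [:: Const 0 a; Op Mul 0 0 1; Op Add 0 0 i.+2] ->
  exists t', [/\ reach p w 3 t t', pc t' = pos.+3, represents s t', reg t' 0 = a * Z + rg s i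
   & Defs.mem t' = Defs.mem t].
Proof.
move=> pt [h1 h2 h3] aK iZ; rewrite !code_at_cons => -[f1 [f2 [f3 _]]].
have aW : a < W by apply: leq_trans KZ; nia.
have aZ : a * Z < W by have := addr_lt aK Z0; lia.
have := addr_lt aK iZ.
have fx s0 q : pc s0 = q -> fetch p s0 = nth Halt p q by move=> <-.
eexists; split.
- apply: reach_step; first by move=> x; rewrite /step (fx _ _ pt) f1; exact: erefl.
  apply: reach_step; first by move=> x; rewrite /step (fx _ pos.+1) ?f2 /= ?pt //; exact: erefl.
  apply: reach1 => x; rewrite /step (fx _ pos.+2) ?f3 /= ?pt //; exact: erefl.
- by rewrite /= pt.
- by split=> // r; rewrite /= h1.
- by rewrite /= h1 h2 !modn_small ?addnK.
- by [].
Qed.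

(** The number of machine steps equals the increase of [tm], so bounds proved on [tm] are bounds on
    the running time. *)
Lemma compile_ok c s s' : exec c s s' -> forall pos t,
  code_at p pos (compile pos c) -> pc t = pos -> represents s t ->
  exists k t', [/\ tm s' = k + tm s, reach p w k t t', pc t' = pos + csize c & represents s' t'].
Proof.
have fx s0 q : pc s0 = q -> fetch p s0 = nth Halt p q by move=> <-.
elim=> {c s s'}.
- by move=> s pos t _ pt st; exists 0, t; split=> //; rewrite ?addn0 //; apply: reach0.
- move=> s r k kW pos t /code_at_cons[f1 _] pt [h1 h2 h3].
  exists 1; eexists; split=> //=.
  + apply: reach1 => x; rewrite /step (fx _ _ pt) f1 modn_small //; exact: erefl.
  + by rewrite /= pt addn1.
  + by split=> //= x; rewrite eqnE !h1 ?eqSS.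
- move=> s o r a b ok pos t /code_at_cons[f1 _] pt [h1 h2 h3].
  exists 1; eexists; split=> //=.
  + apply: reach1 => x; rewrite /step (fx _ _ pt) f1 !h1 eval_opE //; exact: erefl.
  + by rewrite /= pt addn1.
  + by split=> //= x; rewrite eqnE !h1 ?eqSS.
- move=> s r a i aK iZ pos t /= cd pt st.
  move: (cd); rewrite -[_ :: _]/([:: _; _; _] ++ [:: _]) => /code_at_cat[cd1 /code_at_cons[f4 _]].
  have [t1 [r1 p1 [h1 h2 h3] e0 em]] := compile_addr pt st aK iZ cd1.
  exists (3 + 1); eexists; split=> //.
  + apply: (reach_trans r1).
    apply: reach1 => x; rewrite /step (fx _ _ p1) -addn3 f4 e0 h3 //; exact: erefl.
  + by rewrite /= p1 addnC.
  + by split=> //= x; rewrite eqnE !h1 ?eqSS.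
- move=> s r a i aK iZ pos t /= cd pt st.
  move: (cd); rewrite -[_ :: _]/([:: _; _; _] ++ [:: _]) => /code_at_cat[cd1 /code_at_cons[f4 _]].
  have [t1 [r1 p1 [h1 h2 h3] e0 em]] := compile_addr pt st aK iZ cd1.
  exists (3 + 1); eexists; split=> //.
  + apply: (reach_trans r1).
    apply: reach1 => x; rewrite /step (fx _ _ p1) -addn3 f4 e0 h1 //; exact: erefl.
  + by rewrite /= p1 addnC.
  + split=> //= b j bK jZ; rewrite h3 //. idtac.
    have [e|/eqP ne] := eqVneq (b * Z + j) (a * Z + rg s i).
      by have [-> ->] := addr_inj jZ iZ e; rewrite eqnE eqxx /= eqnE eqxx.
    rewrite eqnE; case: (eqVneq b a) => [ba|//] /=; rewrite eqnE.
    by case: (eqVneq j (rg s i)) => [ji|//]; case: ne; rewrite ba ji.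
- move=> s s1 s2 c1 c2 _ IH1 _ IH2 pos t /= /code_at_cat[cd1 cd2] pt st.
  have [k1 [t1 [e1 r1 p1 st1]]] := IH1 _ _ cd1 pt st.
  rewrite size_compile in cd2.
  have [k2 [t2 [e2 r2 p2 st2]]] := IH2 _ _ cd2 p1 st1.
  exists (k1 + k2), t2; split; [by rewrite e2 e1; lia|exact: reach_trans r1 r2|by rewrite p2; lia|by []].
- move=> s s1 r c1 c2 r0 _ IH pos t /= /code_at_cons[f0 /code_at_cat[cd1]].
  rewrite size_compile => /code_at_cons[f1 cd2] pt st; case: (st) => h1 h2 h3.
  have [||k1 [t1 [e1 r1 p1 st1]]] := IH _ (State pos.+1 (reg t) (Defs.mem t)) cd1 => //.
  exists (1 + (k1 + 1)), (State (pos + (csize c1 + csize c2).+2) (reg t1) (Defs.mem t1)); split=> //.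
  + by rewrite /= e1 /=; lia.
  + apply: reach_step => [x|]; last apply: (reach_trans r1); last first.
      by apply: reach1 => x; rewrite /step (fx _ _ p1) f1.
    by rewrite /step (fx _ _ pt) f0 h1 (negbTE r0) pt.
- move=> s s1 r c1 c2 r0 _ IH pos t /= /code_at_cons[f0 /code_at_cat[cd1]].
  rewrite size_compile => /code_at_cons[f1 cd2] pt st; case: (st) => h1 h2 h3.
  have e : pos + (csize c1).+2 = (pos.+1 + csize c1).+1 by lia.
  rewrite -e in cd2.
  have [||k1 [t1 [e1 r1 p1 st1]]] := IH _ (State (pos + (csize c1).+2) (reg t) (Defs.mem t)) cd2 => //.
  exists (1 + k1), t1; split=> //.
  + by rewrite e1 /=; lia.
  + by apply: reach_step r1 => x; rewrite /step (fx _ _ pt) f0 h1 r0.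
  + by rewrite p1; lia.
- move=> s r c r0 pos t /= /code_at_cons[f0 _] pt [h1 h2 h3].
  exists 1, (State (pos + (csize c).+2) (reg t) (Defs.mem t)); split=> //.
  by apply: reach1 => x; rewrite /step (fx _ _ pt) f0 h1 r0.
- move=> s s1 s2 r c r0 _ IH1 _ IH2 pos t /= cd pt st; case: (st) => h1 h2 h3.
  move/code_at_cons: (cd) => [f0 /code_at_cat[cd1]].
  rewrite size_compile => /code_at_cons[f1 _].
  have [||k1 [t1 [e1 r1 p1 st1]]] := IH1 _ (State pos.+1 (reg t) (Defs.mem t)) cd1 => //.
  have [//|//||k2 [t2 [e2 r2 p2 st2]]] := IH2 pos (State pos (reg t1) (Defs.mem t1)).
    by case: st1.
  exists (1 + (k1 + (1 + k2))), t2; split=> //.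
  + by rewrite e2 /= e1 /=; lia.
  + apply: reach_step => [x|]; last apply: (reach_trans r1); last first.
      by apply: reach_step r2 => x; rewrite /step (fx _ _ p1) f1.
    by rewrite /step (fx _ _ pt) f0 h1 (negbTE r0) pt.
Qed.
End Ram.

(** * Rules for total correctness *)

Section Wp.
Variables (w K Z : nat).
Local Notation W := (2 ^ w).
Local Notation exec := (exec w K Z).

Definition tick (s : store) : store := Store (rg s) (ar s) (tm s).+1.
Arguments tick s /.

(** An execution must exist, so a proof of [wp] includes termination and the absence of overflow. *)
Definition wp (c : cmd) (Q : store -> Prop) (s : store) : Prop :=
  exists s', exec c s s' /\ Q s'.

Lemma wp_conseq c (Q Q' : store -> Prop) s :
  wp c Q s -> (forall s', same_off (mods c) (amods c) s s' -> Q s' -> Q' s') -> wp c Q' s.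
Proof. by move=> [s' [e q]] h; exists s'; split=> //; apply: h q; apply: exec_same_off e. Qed.

Lemma wp_skip (Q : store -> Prop) s : Q s -> wp Skip Q s.
Proof. by exists s; split=> //; constructor. Qed.

Lemma wp_set r k (Q : store -> Prop) s : k < W ->
  Q (Store (upd (rg s) r k) (ar s) (tm s).+1) -> wp (Set_ r k) Q s.
Proof. by move=> h q; eexists; split; [constructor|apply: q]. Qed.

Lemma wp_bin o r a b (Q : store -> Prop) s : op_ok W o (rg s a) (rg s b) ->
  Q (Store (upd (rg s) r (op_val o (rg s a) (rg s b))) (ar s) (tm s).+1) ->
  wp (Bin o r a b) Q s.
Proof. by move=> h q; eexists; split; [constructor|apply: q]. Qed.

Lemma wp_binE v o r a b (Q : store -> Prop) s :
  op_ok W o (rg s a) (rg s b) /\ op_val o (rg s a) (rg s b) = v ->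
  Q (Store (upd (rg s) r v) (ar s) (tm s).+1) -> wp (Bin o r a b) Q s.
Proof. by move=> [h <-] q; apply: wp_bin. Qed.

Lemma wp_ldE v r a i (Q : store -> Prop) s : a < K -> rg s i < Z -> ar s a (rg s i) = v ->
  Q (Store (upd (rg s) r v) (ar s) (4 + tm s)) -> wp (Ld r a i) Q s.
Proof. by move=> h1 h2 <- q; eexists; split; [constructor|apply: q]. Qed.

Lemma wp_ld r a i (Q : store -> Prop) s : a < K -> rg s i < Z ->
  Q (Store (upd (rg s) r (ar s a (rg s i))) (ar s) (4 + tm s)) -> wp (Ld r a i) Q s.
Proof. by move=> h1 h2 q; eexists; split; [constructor|apply: q]. Qed.

Lemma wp_st r a i (Q : store -> Prop) s : a < K -> rg s i < Z ->
  Q (Store (rg s) (updA (ar s) a (rg s i) (rg s r)) (4 + tm s)) -> wp (St a i r) Q s.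
Proof. by move=> h1 h2 q; eexists; split; [constructor|apply: q]. Qed.

Lemma wp_seq c1 c2 (Q : store -> Prop) s : wp c1 (wp c2 Q) s -> wp (Seq c1 c2) Q s.
Proof.
by move=> [s1 [e1 [s2 [e2 q]]]]; exists s2; split=> //; apply: ex_seq e1 e2.
Qed.

Lemma wp_if r c1 c2 (Q : store -> Prop) s :
  (rg s r != 0 -> wp c1 (fun s' => Q (tick s')) (tick s)) ->
  (rg s r = 0 -> wp c2 Q (tick s)) ->
  wp (If r c1 c2) Q s.
Proof.
move=> h1 h2; have [e|e] := eqVneq (rg s r) 0.
  by case: (h2 e) => s1 [e1 q]; exists s1; split=> //; apply: ex_if0.
by case: (h1 e) => s1 [e1 q]; eexists; split; [apply: ex_if1 e1|].
Qed.

(** The index of [I] is the exact number of iterations still to come. *)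
Lemma wp_while (I : nat -> store -> Prop) r c (Q : store -> Prop) m s :
  I m s ->
  (forall s1, I 0 s1 -> rg s1 r = 0 /\ Q (tick s1)) ->
  (forall m s1, I m.+1 s1 ->
     rg s1 r != 0 /\ wp c (fun s2 => I m (tick s2)) (tick s1)) ->
  wp (While r c) Q s.
Proof.
move=> + h0 hS; elim: m s => [|m IH] s.
  by move=> /h0[e q]; eexists; split; [apply: ex_while0|].
move=> /hS[e [s1 [e1 /IH[s2 [e2 q]]]]]; exists s2; split=> //.
exact: ex_whileS e e1 e2.
Qed.

Definition For (i b t : nat) (c : cmd) : cmd :=
  Seq (Set_ i 0) (Seq (Bin Lt t i b)
    (While t (Seq c (Seq (Set_ t 1) (Seq (Bin Add i i t) (Bin Lt t i b)))))).

(** [t] is scratch, holding the loop test and the increment 1, so the invariant is required for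
    every value of it. An iteration costs 5 steps beyond those of [c]. *)
Lemma wp_for i b t c (Inv : nat -> store -> Prop) (Q : store -> Prop) s :
  [&& i != t, i != b, t != b, i \notin mods c & b \notin mods c] ->
  1 < W -> rg s b < W ->
  (forall v, Inv 0 (Store (upd (upd (rg s) i 0) t v) (ar s) (2 + tm s))) ->
  (forall k s1, k < rg s b -> rg s1 i = k -> same_off (i :: t :: mods c) (amods c) s s1 ->
     Inv k s1 ->
     wp c (fun s2 => forall v,
       Inv k.+1 (Store (upd (upd (upd (rg s2) t 1) i k.+1) t v) (ar s2) (4 + tm s2)))
       (tick s1)) ->
  (forall s1, rg s1 i = rg s b -> same_off (mods (For i b t c)) (amods (For i b t c)) s s1 ->
     Inv (rg s b) s1 -> Q (tick s1)) ->
  wp (For i b t c) Q s.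
Proof.
case/and5P => it ib tb ic bc W1 bW I0 IS IQ.
have eqn_t : eqn t i = false by apply/eqP/eqP; rewrite eq_sym.
have eqn_i : eqn i t = false by apply/eqP/eqP.
have eqn_bt : eqn b t = false by apply/eqP/eqP; rewrite eq_sym.
have eqn_bi : eqn b i = false by apply/eqP/eqP; rewrite eq_sym.
have rfl (j : nat) : eqn j j by apply/eqP.
apply: wp_seq; apply: wp_set; first by lia.
apply: wp_seq; apply: wp_bin; first by [].
pose J m s1 := exists k, [/\ m + k = rg s b, rg s1 i = k, rg s1 t = (k < rg s b),
  same_off (i :: t :: mods c) (amods c) s s1 & Inv k s1].
apply: (@wp_while J _ _ _ (rg s b)).
- exists 0; split; rewrite ?addn0 //=; first by rewrite eqn_i rfl.
    by rewrite rfl rfl eqn_bi.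
  split=> //= x; rewrite !inE !negb_or => /and3P[/negbTE xi /negbTE xt _].
  by rewrite !eqnE xi xt.
- move=> s1 [k [kb ki kt so Ik]]; rewrite add0n in kb; subst k; split; first by rewrite kt kb ltnn.
  apply: IQ => //; last by rewrite -kb.
  apply: same_off_sub so => x /=; last by rewrite cats0.
  by rewrite !inE mem_cat => /or3P[]->; rewrite ?orbT.
- move=> m s1 [k [kb ki kt so Ik]]; have kb' : k < rg s b by lia.
  split; first by rewrite kt kb'.
  apply: wp_seq; apply: (wp_conseq (IS k s1 kb' ki so Ik)) => s2 so2 Is2; have so3 := same_off_trans so _; rewrite /= in so2.
  have e2i : rg s2 i = k by case: so2 => + _ => ->.
  have e2b : rg s2 b = rg s b.
    case: so2 => + _ => -> //=; case: so => + _ => ->; rewrite // !inE !negb_or.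
    by rewrite eq_sym ib eq_sym tb.
  apply: wp_seq; apply: wp_set => //.
  apply: wp_seq; apply: wp_bin => /=; rewrite eqn_i rfl e2i; first by lia.
  apply: wp_bin => //=; rewrite rfl eqn_bi eqn_bt e2b.
  exists k.+1; split=> /=.
  + by lia.
  + by rewrite eqn_i rfl addn1.
  + by rewrite rfl addn1.
  + case: so2 => [h1 h2]; case: so => [h3 h4]; split=> /= x.
      rewrite !inE !negb_or => /and3P[xi xt xc].
      rewrite !eqnE (negbTE xi) (negbTE xt) h1 //= h3 // !inE !negb_or.
      by rewrite xi xt.
    by move=> xc y; rewrite h2 //= h4.
  + have -> : k + 1 = k.+1 by lia.
    exact: Is2.
Qed.

(* Address 0 is the null pointer. *)
Fixpoint chain (nb nx : nat -> nat) (p : nat) (l : seq nat) : Prop :=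
  if l is x :: l' then [/\ p != 0, p < Z, nb p = x & chain nb nx (nx p) l'] else p = 0.

Definition ForList (hd nb nx v p x : nat) (c : cmd) : cmd :=
  Seq (Ld p hd v) (While p (Seq (Ld x nb p) (Seq c (Ld p nx p)))).

Lemma chain_ext nb nx nb' nx' p l : nb =1 nb' -> nx =1 nx' ->
  chain nb nx p l -> chain nb' nx' p l.
Proof. by move=> e1 e2; elim: l p => //= x l IH p [? ? <- /IH]; rewrite e1 e2. Qed.

(** [Inv] speaks of the entries already visited. As [c] writes neither links nor entries, the rest
    of the chain persists. *)
Lemma wp_forlist hd nb nx v p x c (l : seq nat) (Inv : seq nat -> store -> Prop)
    (Q : store -> Prop) s :
  [&& p != x, p \notin mods c, nb \notin amods c & nx \notin amods c] ->
  [&& hd < K, nb < K & nx < K] -> rg s v < Z ->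
  chain (ar s nb) (ar s nx) (ar s hd (rg s v)) l ->
  (forall y, Inv [::] (Store (upd (rg s) p y) (ar s) (4 + tm s))) ->
  (forall l1 y l2 s1, l = l1 ++ y :: l2 -> same_off (p :: x :: mods c) (amods c) s s1 ->
     Inv l1 s1 -> rg s1 p < Z ->
     wp c (fun s2 => forall z,
       Inv (rcons l1 y) (Store (upd (rg s2) p z) (ar s2) (5 + tm s2)))
       (Store (upd (rg s1) x y) (ar s1) (5 + tm s1))) ->
  (forall s1, same_off (mods (ForList hd nb nx v p x c)) (amods (ForList hd nb nx v p x c)) s s1 ->
     Inv l s1 -> Q (tick s1)) ->
  wp (ForList hd nb nx v p x c) Q s.
Proof.
case/and4P => px pc nbc nxc /and3P[hK nbK nxK] vZ ch I0 IS IQ.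
have rfl (j : nat) : eqn j j by apply/eqP.
have eqn_px : eqn p x = false by apply/eqP/eqP.
apply: wp_seq; apply: wp_ld => //.
pose J m s1 := exists l1 l2, [/\ l = l1 ++ l2, size l2 = m,
  chain (ar s nb) (ar s nx) (rg s1 p) l2,
  same_off (p :: x :: mods c) (amods c) s s1 & Inv l1 s1].
apply: (@wp_while J _ _ _ (size l)).
- exists [::], l; split=> //=; first by rewrite rfl.
  by split=> //= y; rewrite !inE !negb_or => /and3P[/negbTE yp _ _]; rewrite !eqnE yp.
- move=> s1 [l1 [l2 [e /size0nil e2 /= ch1 so I1]]]; subst l2; rewrite cats0 in e; subst l1.
  split=> //; apply: IQ => //; apply: same_off_sub so => z /=; last by rewrite cats0.
  by rewrite !inE mem_cat => /or3P[]->; rewrite ?orbT.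
- move=> m s1 [l1 [l2 []]]; case: l2 => [|y l2] e //= [sz] [p0 pZ ey ch1] so I1.
  split=> //; apply: wp_seq; apply: wp_ld => //=; rewrite so.2 // ey.
  apply: wp_seq; apply: (wp_conseq (IS l1 y l2 s1 e so I1 pZ)) => s2 [so1 so2] I2 /=.
  have e2 : rg s2 p = rg s1 p by rewrite so1 //= eqn_px.
  apply: wp_ld; rewrite ?e2 //.
  exists (rcons l1 y), l2; split=> //=.
  + by rewrite cat_rcons.
  + by rewrite rfl so2 // so.2.
  + case: so => [h3 h4]; split=> /= z; last by move=> zc i; rewrite so2 //= h4.
    rewrite !inE !negb_or => /and3P[zp zx zc].
    rewrite !eqnE (negbTE zp) so1 //= eqnE (negbTE zx) h3 // !inE !negb_or.
    by rewrite zp zx.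
Qed.

End Wp.
Arguments tick s /.

(** * The program *)

Definition block : seq cmd -> cmd := foldr Seq Skip.

(* [Rk] counts the nodes of the forest, [Rcnt] the alive vertices and [Rfresh]
   the classes; [RL] holds [2 * L].  [Rla] and [Rlb] are the next free cells of
   the arrays [LA] and [LB] of recorded pairs, whose cell 0 is kept for the
   number of pairs. *)
Notation Rn := 0 (only parsing).
Notation Rm := 1 (only parsing).
Notation RL := 2 (only parsing).
Notation Rcnt := 3 (only parsing).
Notation Rk := 4 (only parsing).
Notation Rla := 5 (only parsing).
Notation Rlb := 6 (only parsing).
Notation Rfresh := 7 (only parsing).
Notation Ri := 8 (only parsing).
Notation Rt := 9 (only parsing).
Notation Rp := 10 (only parsing).
Notation Rx := 11 (only parsing).
Notation Rc := 12 (only parsing).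
Notation Ra := 13 (only parsing).
Notation Rb := 14 (only parsing).
Notation Re := 15 (only parsing).
Notation Ru := 16 (only parsing).
Notation Rnu := 17 (only parsing).
Notation Rnx := 18 (only parsing).
Notation Rla0 := 19 (only parsing).
Notation Rlb0 := 20 (only parsing).
(* [HEAD], [NEXT], [NB] store linked adjacency lists.  [FL] adds 1 for a
   neighbour of [u] and 2 for a neighbour of [v].  When the neighbours of the
   [k]-th vertex split the classes, [STAMP c = k + 1] says that class [c] was
   split already, and [NEWID c] is the class split from it. *)
Notation IN := 0 (only parsing).
Notation HEAD := 1 (only parsing).
Notation NEXT := 2 (only parsing).
Notation NB := 3 (only parsing).
Notation ALIVE := 4 (only parsing).
Notation NODE := 5 (only parsing).
Notation PAR := 6 (only parsing).
Notation LF := 7 (only parsing).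
Notation MARK := 8 (only parsing).
Notation CLS := 9 (only parsing).
Notation STAMP := 10 (only parsing).
Notation NEWID := 11 (only parsing).
Notation LAST := 12 (only parsing).
Notation FL := 13 (only parsing).
Notation LA := 14 (only parsing).
Notation LB := 15 (only parsing).
Notation OUT := 16 (only parsing).

Definition adjloop (v : nat) (c : cmd) : cmd := ForList HEAD NB NEXT v Rp Rx c.

Definition addflag (k : nat) : cmd :=
  block [:: Ld Ra FL Rx; Set_ Re k; Bin Add Ra Ra Re; St FL Rx Ra].

Definition clearflag : cmd := block [:: Set_ Re 0; St FL Rx Re].

Definition push2 (arr ptr v1 v2 : nat) : cmd :=
  block [:: Set_ Re 1; St arr ptr v1; Bin Add ptr ptr Re; St arr ptr v2; Bin Add ptr ptr Re].

(** Tests yield 0 or 1, so a product is a conjunction and [1 - b] a negation. *)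
Definition pushif (arr ptr k other : nat) : cmd :=
  block [:: Ld Ra FL Rx; Set_ Re k; Bin Eq Ra Ra Re; Ld Rb ALIVE Rx; Bin Mul Ra Ra Rb;
    Bin Eq Rb Rx other; Set_ Re 1; Bin Defs.Sub Rb Re Rb; Bin Mul Ra Ra Rb;
    If Ra (block [:: Ld Rnx NODE Rx; push2 arr ptr Rnu Rnx]) Skip].

(** [v] is not its own neighbour, so its flag is nonzero exactly if it is adjacent to [u]. *)
Definition merge_cmd : cmd :=
  block [:: Ld Rnx NODE Ri; Ld Ra FL Ri;
    If Ra (push2 LB Rlb Rnu Rnx) (push2 LA Rla Rnu Rnx);
    St PAR Rnu Rk; St PAR Rnx Rk; St PAR Rk Rk; St NODE Ri Rk;
    Set_ Re 0; St ALIVE Ru Re; Set_ Re 1; Bin Add Rk Rk Re; Bin Defs.Sub Rcnt Rcnt Re].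

(** Pairs are pushed before it is known whether they are too many; resetting the pointers discards
    them. *)
Definition undo_cmd : cmd := block [:: Set_ Re 0; Bin Add Rla Rla0 Re; Bin Add Rlb Rlb0 Re].

(** Flag 1 marks neighbours of [u] only and flag 2 neighbours of [v] only. A pair takes two cells,
    hence the comparison with [2 * L]. *)
Definition try_cmd : cmd :=
  block [:: adjloop Ru (addflag 1); adjloop Ri (addflag 2);
    Set_ Re 0; Bin Add Rla0 Rla Re; Bin Add Rlb0 Rlb Re; Ld Rnu NODE Ru;
    adjloop Ru (pushif LB Rlb 1 Ri); adjloop Ri (pushif LA Rla 2 Ru);
    Bin Defs.Sub Ra Rla Rla0; Bin Defs.Sub Rb Rlb Rlb0; Bin Add Ra Ra Rb; Bin Lt Rb RL Ra;
    If Rb undo_cmd merge_cmd;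
    adjloop Ru clearflag; adjloop Ri clearflag].

Ltac wside := rewrite /=; try by []; try lia.
Ltac wstep :=
  lazymatch goal with
  | |- wp _ _ _ (adjloop _ _) _ _ => fail
  | |- wp _ _ _ (For _ _ _ _) _ _ => fail
  | |- _ => idtac
  end;
  first [ apply: wp_skip
        | apply: wp_set; [by wside|]
        | apply: wp_bin; [by wside|]
        | apply: wp_ld; [by []|by wside|]
        | apply: wp_st; [by []|by wside|]
        | apply: wp_seq ].
Ltac wgo := repeat (wstep; rewrite /=).

Definition content (a : nat -> nat) (ptr : nat) (l : seq nat) : Prop :=
  ptr = 1 + size l /\ forall i, i < size l -> a (1 + i) = nth 0 l i.

Lemma content_push2 (a a' : nat -> nat) ptr l v1 v2 :
  content a ptr l ->
  (forall i, a' i = if i == ptr.+1 then v2 else if i == ptr then v1 else a i) ->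
  content a' ptr.+2 (l ++ [:: v1; v2]).
Proof.
move=> [-> h] aE; split=> [|i]; rewrite size_cat /=; first by lia.
move=> il; rewrite aE nth_cat; have [lt|ge] := ltnP i (size l).
  by rewrite !ifF ?h //; lia.
have [->|->] : i = size l \/ i = (size l).+1 by lia.
  by rewrite subnn ifF ?eqxx //; lia.
by rewrite subSnn eqxx.
Qed.

Lemma content_cat a ptr l l' : content a ptr (l ++ l') -> content a (1 + size l) l.
Proof.
move=> [_ h]; split=> // i il; rewrite h ?nth_cat ?il // size_cat; lia.
Qed.

Lemma content_ext a a' ptr l : a =1 a' -> content a ptr l -> content a' ptr l.
Proof. by move=> e [h1 h2]; split=> // i il; rewrite -e h2. Qed.

Definition pushed (f0 : nat -> nat) (alive : pred nat) (k other : nat) : pred nat :=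
  fun x => [&& f0 x == k, alive x & x != other].

Definition flat (P : seq (nat * nat)) : seq nat := flatten [seq [:: e.1; e.2] | e <- P].

Lemma size_flat P : size (flat P) = 2 * size P.
Proof. by elim: P => //= e P IH; rewrite /flat /= -/(flat P) IH; lia. Qed.

Lemma flat_cat P Q : flat (P ++ Q) = flat P ++ flat Q.
Proof. by rewrite /flat map_cat flatten_cat. Qed.

Lemma flat_map (f : nat -> nat) a l :
  flat [seq (a, f x) | x <- l] = flatten [seq [:: a; f x] | x <- l].
Proof. by rewrite /flat -map_comp. Qed.

(** [Z] is chosen to dominate every index and counter of the program, and 32 arrays of length [Z]
    fit into the address space. *)
Record params (n m q L : nat) (g : rel nat) (adj : nat -> seq nat) (w Z : nat) : Prop := Params {
  p_ZW : 32 * Z <= 2 ^ w;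
  p_Zn : 40 * n + 4 * ((L + 1) * n) + 100 < Z;
  p_Zm : 4 * m + 4 < Z;
  p_ZL : 4 * L + 4 * q < Z;
  p_gsym : symmetric g;
  p_girr : irreflexive g;
  p_gn : forall x y, g x y -> x < n;
  p_adjP : forall x y, x < n -> (y \in adj x) = g x y;
  p_adju : forall x, uniq (adj x);
  p_adjm : forall x, x < n -> size (adj x) <= n;
  p_sum : \sum_(0 <= x < n) size (adj x) = 2 * m
}.

Section Program.
Variables (n m q L : nat) (g : rel nat) (adj : nat -> seq nat) (w Z : nat).
Hypothesis par_ok : params n m q L g adj w Z.
Let ZW := p_ZW par_ok.
Let Zn := p_Zn par_ok.
Let Zm := p_Zm par_ok.
Let ZL := p_ZL par_ok.
Let gsym := p_gsym par_ok.
Let gn := p_gn par_ok.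
Let adjP := p_adjP par_ok.
Let adj_uniq := p_adju par_ok.
Let adjm := p_adjm par_ok.
Let sum_deg := p_sum par_ok.

Local Notation wp := (wp w 32 Z).

Definition chains (s : store) : Prop :=
  forall x, x < n -> chain Z (ar s NB) (ar s NEXT) (ar s HEAD x) (adj x).

Lemma adj_lt x y : x < n -> y \in adj x -> y < n.
Proof. by move=> xn; rewrite adjP // gsym; apply: gn. Qed.

Lemma chains_ext (s s' : store) : (forall x, ar s' NB x = ar s NB x) ->
  (forall x, ar s' NEXT x = ar s NEXT x) -> (forall x, ar s' HEAD x = ar s HEAD x) ->
  chains s -> chains s'.
Proof.
by move=> h1 h2 h3 ch x xn; rewrite h3; apply: chain_ext (ch x xn) => y; rewrite ?h1 ?h2.
Qed.

Lemma wp_addflag v k (f0 : nat -> nat) (Q : store -> Prop) s :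
  v != Rp -> v != Rx -> v != Ra -> v != Re ->
  rg s v < n -> k <= 2 -> chains s -> (forall x, f0 x <= 1) ->
  (forall x, x < n -> ar s FL x = f0 x) ->
  (forall s', same_off (mods (adjloop v (addflag k))) [:: FL] s s' ->
     (forall x, x < n -> ar s' FL x = f0 x + k * (x \in adj (rg s v))) ->
     tm s' <= tm s + 20 * (size (adj (rg s v)) + 1) -> Q s') ->
  wp (adjloop v (addflag k)) Q s.
Proof.
move=> v1 v2 v3 v4 vn k2 ch f01 f0E IQ.
apply: (@wp_forlist _ _ _ _ _ _ _ _ _ _ (adj (rg s v))
  (fun l s1 => (forall x, x < n -> ar s1 FL x = f0 x + k * (x \in l)) /\
     tm s1 <= tm s + 20 * size l + 4)) => //.
- by lia.
- exact: ch.
- by move=> y; split=> [x xn|] /=; rewrite ?f0E ?muln0 ?addn0 //; lia.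
- move=> l1 y l2 s1 el so [IF It] pZ.
  have yn : y < n by apply: (adj_lt vn); rewrite el mem_cat mem_head orbT.
  have yl1 : y \notin l1.
    by have := adj_uniq (rg s v); rewrite el cat_uniq => /and3P[_ /norP[]].
  have f1 := f01 y; have e := IF y yn; rewrite (negbTE yl1) muln0 addn0 in e.
  wgo => z; split=> [x xn|]; last by rewrite size_rcons; lia.
  rewrite e eqnE mem_rcons inE; case: (eqVneq x y) => [->|_] /=; first by rewrite muln1.
  exact: IF.
- move=> s1 so [IF It]; by apply: IQ => //=; lia.
Qed.

Lemma wp_clearflag v (f0 : nat -> nat) (Q : store -> Prop) s :
  v != Rp -> v != Rx -> v != Re ->
  rg s v < n -> chains s ->
  (forall x, x < n -> ar s FL x = f0 x) ->
  (forall s', same_off (mods (adjloop v clearflag)) [:: FL] s s' ->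
     (forall x, x < n -> ar s' FL x = if x \in adj (rg s v) then 0 else f0 x) ->
     tm s' <= tm s + 20 * (size (adj (rg s v)) + 1) -> Q s') ->
  wp (adjloop v clearflag) Q s.
Proof.
move=> v1 v2 v4 vn ch f0E IQ.
apply: (@wp_forlist _ _ _ _ _ _ _ _ _ _ (adj (rg s v))
  (fun l s1 => (forall x, x < n -> ar s1 FL x = if x \in l then 0 else f0 x) /\
     tm s1 <= tm s + 16 * size l + 4)) => //.
- by lia.
- exact: ch.
- by move=> y; split=> [x xn|] /=; rewrite ?f0E //; lia.
- move=> l1 y l2 s1 el so [IF It] pZ.
  have yn : y < n by apply: (adj_lt vn); rewrite el mem_cat mem_head orbT.
  wgo => z; split=> [x xn|]; last by rewrite size_rcons; lia.
  by rewrite mem_rcons inE eqnE; case: (eqVneq x y) => //= _; apply: IF.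
- move=> s1 so [IF It]; by apply: IQ => //=; lia.
Qed.

(** [b] treats both signs at once: it selects the array, the pointer, the flag and the roles of [u]
    and [v]. *)
Lemma wp_pushif (b : bool) (f0 node : nat -> nat) (alive : pred nat) lst (Q : store -> Prop) s :
  let arr := if b then LB else LA in let ptr := if b then Rlb else Rla in
  let k := if b then 1 else 2 in let v := if b then Ru else Ri in
  let other := if b then Ri else Ru in
  rg s v < n -> chains s ->
  (forall x, x < n -> ar s FL x = f0 x) ->
  (forall x, x < n -> ar s ALIVE x = alive x) ->
  (forall x, x < n -> ar s NODE x = node x) ->
  content (ar s arr) (rg s ptr) lst -> size lst + 2 * n + 4 < Z ->
  (forall s', same_off (mods (adjloop v (pushif arr ptr k other))) [:: arr; arr] s s' ->
     content (ar s' arr) (rg s' ptr)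
       (lst ++ flatten [seq [:: rg s Rnu; node x] | x <- adj (rg s v) & pushed f0 alive k (rg s other) x]) ->
     tm s' <= tm s + 60 * (size (adj (rg s v)) + 1) -> Q s') ->
  wp (adjloop v (pushif arr ptr k other)) Q s.
Proof.
move=> arr ptr k v other vn ch f0E aliveE nodeE ct lZ IQ.
have pZ : rg s v < Z by lia.
pose fl l1 := flatten [seq [:: rg s Rnu; node x] | x <- l1 & pushed f0 alive k (rg s other) x].
have szfl l1 : size (fl l1) <= 2 * size l1.
  by rewrite /fl; elim: l1 => //= x l1 IH; case: ifP => _ /=; lia.
apply: (@wp_forlist _ _ _ _ _ _ _ _ _ _ (adj (rg s v))
  (fun l1 s1 => content (ar s1 arr) (rg s1 ptr) (lst ++ fl l1) /\
     tm s1 <= tm s + 60 * size l1 + 4)) => //.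
- by rewrite /arr /ptr /k /other; case: (b).
- exact: ch.
- by move=> y; rewrite /fl /= cats0; split; last lia; move: ct; rewrite /arr /ptr; case: (b).
- move=> l1 y l2 s1 el so [Ict It] pZ'.
  have yn : y < n by apply: (adj_lt vn); rewrite el mem_cat mem_head orbT.
  have sz1 : size l1 < n.
    by apply: leq_trans (adjm vn); rewrite el size_cat /=; lia.
  have szl := szfl l1.
  have so2 a : a != arr -> forall i, ar s1 a i = ar s a i.
    by move=> ne; apply: so.2; rewrite !inE orbb.
  have so1 r : r \notin [:: Rp; Rx; Ra; Re; Rb; Rnx; ptr] -> rg s1 r = rg s r.
    move=> ne; apply: so.1; apply: contra ne; rewrite !inE.
    by do ![case/orP => [->|]; rewrite ?orbT //]; move=> ->; rewrite ?orbT.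
  have e1 : ar s1 FL y = f0 y by rewrite so2 ?f0E // /arr; case: (b).
  have e2 : ar s1 ALIVE y = alive y by rewrite so2 ?aliveE // /arr; case: (b).
  have e3 : ar s1 NODE y = node y by rewrite so2 ?nodeE // /arr; case: (b).
  have e4 : rg s1 Rnu = rg s Rnu by rewrite so1 // /ptr; case: (b).
  have e5 : rg s1 other = rg s other by rewrite so1 // /other /ptr; case: (b).
  have e6 : fl (rcons l1 y) = fl l1 ++ (if pushed f0 alive k (rg s other) y then [:: rg s Rnu; node y] else [::]).
    by rewrite -cats1 /fl filter_cat map_cat flatten_cat /=; case: ifP.
  have := Ict.1; rewrite size_cat => e7.
  apply: wp_seq; apply: (@wp_ldE _ _ _ (f0 y)); [by []|by wside|by rewrite /= e1|].
  apply: wp_seq; apply: wp_set; first by rewrite /k; case: (b); lia.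
  apply: wp_seq; apply: (@wp_binE _ _ _ (f0 y == k)); first by split=> //=; lia.
  apply: wp_seq; apply: (@wp_ldE _ _ _ (alive y)); [by []|by wside|by rewrite /= e2|].
  apply: wp_seq; apply: (@wp_binE _ _ _ ((f0 y == k) && alive y)).
    by rewrite /= mulnb; split=> //; case: (_ && _); lia.
  apply: wp_seq; apply: (@wp_binE _ _ _ (y == rg s other)).
    by split=> /=; [lia|rewrite -e5 /other; case: (b)].
  apply: wp_seq; apply: wp_set; first by lia.
  apply: wp_seq; apply: (@wp_binE _ _ _ (y != rg s other)).
    by rewrite /=; case: (_ == _) => /=; split=> //; lia.
  apply: wp_seq; apply: (@wp_binE _ _ _ (pushed f0 alive k (rg s other) y)).
    by rewrite /= mulnb -andbA; split=> //; case: [&& _, _ & _]; lia.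
  apply: wp_seq; apply: wp_if => /=.
    rewrite eqb0 negbK => pd; rewrite pd in e6.
    apply: wp_seq; apply: (@wp_ldE _ _ _ (node y)); [by []|by wside|by rewrite /= e3|].
    rewrite /= in e7; move: Ict; rewrite e6 catA => /content_push2 push.
    clear so so1 so2 e1 e2 e3 e5 szfl ct vn e6 pd IQ el.
    rewrite /arr /ptr in e7 push *; case: (b) e7 push => e7 push.
      wgo => z; split; last by rewrite size_rcons; lia.
      by rewrite !addn1; apply: push => i /=; rewrite !eqnE e4.
    wgo => z; split; last by rewrite size_rcons; lia.
    by rewrite !addn1; apply: push => i /=; rewrite !eqnE e4.
  move/eqP; rewrite eqb0 => /negbTE pd; rewrite pd cats0 in e6.
  apply: wp_skip; apply: wp_skip => z; split => /=; last by rewrite size_rcons; lia.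
  by rewrite e6; move: Ict; rewrite /arr /ptr; case: (b).
- by move=> s1 so [Ict It]; apply: IQ => //=; lia.
Qed.

End Program.

Section Program.
Variables (n m q L : nat) (g : rel nat) (adj : nat -> seq nat) (w Z : nat).
Hypothesis par_ok : params n m q L g adj w Z.
Let ZW := p_ZW par_ok.
Let Zn := p_Zn par_ok.
Let Zm := p_Zm par_ok.
Let ZL := p_ZL par_ok.
Let gsym := p_gsym par_ok.
Let girr := p_girr par_ok.
Let gn := p_gn par_ok.
Let adjP := p_adjP par_ok.
Let adj_uniq := p_adju par_ok.
Let adjm := p_adjm par_ok.
Let sum_deg := p_sum par_ok.

Local Notation wp := (wp w 32 Z).

Local Notation chains := (chains n adj Z).

Definition base_ok (s : store) : Prop :=
  [/\ rg s Rn = n, rg s Rm = m, rg s RL = 2 * L, chains s & forall x, x < n -> ar s LF x = x].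

Definition flags_ok (s : store) : Prop := forall x, x < n -> ar s FL x = 0.

(** A merge adds one node and at most [L + 1] pairs and removes one alive vertex, which keeps the
    last two clauses. *)
Definition tree_ok (s : store) (alive : pred nat) : Prop :=
  exists rep PA PB,
  [/\ forest_inv n g (rg s Rk) (ar s PAR) (ar s NODE) rep alive PA PB,
      forall x, x < n -> ar s ALIVE x = alive x,
      content (ar s LA) (rg s Rla) (flat PA) /\ content (ar s LB) (rg s Rlb) (flat PB),
      size PA + size PB <= (L + 1) * (rg s Rk - n) &
      rg s Rcnt = count alive (iota 0 n) /\ rg s Rcnt + rg s Rk = 2 * n].

Definition close_pair (alive : pred nat) u v : bool :=
  count (fun x => [&& alive x, x != u, x != v & g u x != g v x]) (iota 0 n) <= L.

Lemma base_ok_off (s s' : store) rs as_ : same_off rs as_ s s' ->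
  ~~ has (mem [:: Rn; Rm; RL]) rs -> ~~ has (mem [:: NB; NEXT; HEAD; LF]) as_ ->
  base_ok s -> base_ok s'.
Proof.
move=> [h1 h2] /hasPn hr /hasPn ha [e1 e2 e3 ch lf]; split.
- by rewrite h1 //; apply/negP => /hr.
- by rewrite h1 //; apply/negP => /hr.
- by rewrite h1 //; apply/negP => /hr.
- by apply: chains_ext ch => x; rewrite h2 //; apply/negP => /ha.
- by move=> x xn; rewrite h2 ?lf //; apply/negP => /ha.
Qed.

Lemma tree_ok_off (s s' : store) rs as_ alive : same_off rs as_ s s' ->
  ~~ has (mem [:: Rk; Rla; Rlb; Rcnt]) rs -> ~~ has (mem [:: ALIVE; NODE; PAR; LA; LB]) as_ ->
  tree_ok s alive -> tree_ok s' alive.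
Proof.
move=> [h1 h2] /hasPn hr /hasPn ha [rep [PA [PB [i1 i2 i3 i4 i5]]]].
have {}h1 r : r \in [:: Rk; Rla; Rlb; Rcnt] -> rg s' r = rg s r.
  by move=> h; apply: h1; apply: contraL h => /hr.
have {}h2 a : a \in [:: ALIVE; NODE; PAR; LA; LB] -> ar s' a = ar s a.
  by move=> h; apply: functional_extensionality => i; apply: h2; apply: contraL h => /ha.
exists rep, PA, PB; rewrite !h1 // !h2 //; split=> // x xn; exact: i2.
Qed.

(** The number of cells pushed decides [close_pair] exactly, by [szX], so the new alive set is a
    function of the old one. *)
Lemma wp_try alive u v (Q : store -> Prop) s :
  base_ok s -> flags_ok s -> tree_ok s alive -> rg s Ru = u -> rg s Ri = v ->
  u < n -> v < n -> u != v -> alive u -> alive v ->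
  (forall s', same_off (mods try_cmd) (amods try_cmd) s s' -> flags_ok s' ->
     tree_ok s' (if close_pair alive u v then fun x => (x != u) && alive x else alive) ->
     tm s' <= tm s + 200 * (size (adj u) + size (adj v) + 2) -> Q s') ->
  wp try_cmd Q s.
Proof.
move=> [en em eL ch elf] fl0 [rep [PA [PB [inv aliveE [ctA ctB] szP [cntE cntk]]]]] eu ev.
move=> un vn uv au av IQ.
set alive' := if _ then _ else _ in IQ.
apply: (@wp_conseq _ _ _ _ (fun s' => [/\ flags_ok s', tree_ok s' alive' &
  tm s' <= tm s + 200 * (size (adj u) + size (adj v) + 2)])); last first.
  by move=> s' so' [h1 h2 h3]; apply: IQ.
(* [u] is alive, so fewer than [n] merges have been made; this bounds the nodes and pairs stored. *)
have k2 : rg s Rk < 2 * n.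
  suff : 0 < rg s Rcnt by lia.
  by rewrite cntE -has_count; apply/hasP; exists u; rewrite // mem_iota.
have szP' : size PA + size PB <= (L + 1) * n.
  by apply: leq_trans szP _; rewrite leq_mul2l; apply/orP; right; lia.
apply: wp_seq; apply: (wp_addflag par_ok (f0 := fun=> 0)); rewrite ?eu // => s1 so1 f1 t1.
have ch1 : chains s1 by apply: chains_ext ch => x; apply: so1.2.
apply: wp_seq; apply: (wp_addflag par_ok (f0 := fun x => (x \in adj u) : nat)); rewrite ?so1.1 ?ev //.
- by move=> x; case: (_ \in _).
- by move=> x xn; rewrite f1 // mul1n.
move=> s2 so2 f2 t2.
pose f0 x := (x \in adj u) + 2 * (x \in adj v).
have [so12 so12a] := same_off_trans so1 so2.
have f0E x : x < n -> ar s2 FL x = f0 x by move=> xn; rewrite f2 // /f0 so1.1 ?ev.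
have [Ela Ala] := ctA; have [Elb Alb] := ctB; rewrite !size_flat in Ela Elb.
have e2 r : r \in [:: Rn; RL; Rcnt; Rk; Rla; Rlb; Ru; Ri] -> rg s2 r = rg s r.
  by move=> h; apply: so12; apply: contraL h; rewrite !inE; do ![case/orP=> [/eqP->//|]]; move/eqP->.
have E5 := e2 5 isT; have E6 := e2 6 isT; have E16 := e2 16 isT; have E8 := e2 8 isT.
rewrite eu in E16; rewrite ev in E8.
do 4 (apply: wp_seq; wstep); rewrite /= E16 so12a //.
set s3 := Store _ _ _.
have t3 : tm s3 = tm s2 + 7 by rewrite /s3 /=; lia.
have e3 r : r \in [:: Rn; RL; Rcnt; Rk; Rla; Rlb; Ru; Ri] -> rg s3 r = rg s r.
  by move=> h; rewrite -e2 //; move: h; rewrite !inE; do ![case/orP=> [/eqP->//|]]; move/eqP->.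
have a3 a : a != FL -> forall i, ar s3 a i = ar s a i by move=> ne; apply: so12a; rewrite !inE.
have E17 : rg s3 Rnu = ar s NODE u by [].
have ch3 : chains s3 by apply: chains_ext ch => x; apply: a3.
apply: wp_seq; apply: (wp_pushif par_ok (b := true) (f0 := f0) (node := ar s NODE) (alive := alive) (lst := flat PB)) => //.
- by rewrite e3 // eu.
- by move=> x xn; rewrite a3 //; apply: aliveE.
- by move=> x xn; rewrite a3.
- by rewrite e3 //; apply: content_ext ctB => i; rewrite a3.
- by rewrite size_flat; lia.
move=> s4 so4 ct4 t4; rewrite E17 (e3 Ru) // (e3 Ri) // eu ev in ct4.
rewrite [rg s3 _](e3 Ru) // eu in t4.
have e4 r : r \in [:: Rn; RL; Rcnt; Rk; Rla; Ru; Ri] -> rg s4 r = rg s r.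
  move=> h; rewrite so4.1 ?e3 //; first by move: h; rewrite !inE; do ![case/orP=> [/eqP->//|]]; move/eqP->.
  by apply: contraL h; rewrite !inE; do ![case/orP=> [/eqP->//|]]; move/eqP->.
have a4 a : a \notin [:: FL; LB] -> forall i, ar s4 a i = ar s a i.
  by rewrite !inE negb_or => /andP[n1 n2] i; rewrite so4.2 ?a3 // !inE negb_or n2.
have ch4 : chains s4 by apply: chains_ext ch => x; apply: a4.
have E17' : rg s4 Rnu = ar s NODE u by rewrite so4.1.
apply: wp_seq; apply: (wp_pushif par_ok (b := false) (f0 := f0) (node := ar s NODE) (alive := alive) (lst := flat PA)) => //.
- by rewrite e4 ?ev.
- by move=> x xn; rewrite so4.2 //=; apply: f0E.
- by move=> x xn; rewrite a4 //=; apply: aliveE.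
- by move=> x xn; rewrite a4.
- by rewrite e4 //; apply: content_ext ctA => i; rewrite a4.
- by rewrite size_flat; lia.
move=> s5 so5 ct5 t5; rewrite E17' (e4 Ru) // (e4 Ri) // eu ev in ct5.
rewrite [rg s4 _](e4 Ri) // ev in t5.
have e5 r : r \in [:: Rn; RL; Rcnt; Rk; Ru; Ri] -> rg s5 r = rg s r.
  move=> h; rewrite so5.1 ?e4 //; first by move: h; rewrite !inE; do ![case/orP=> [/eqP->//|]]; move/eqP->.
  by apply: contraL h; rewrite !inE; do ![case/orP=> [/eqP->//|]]; move/eqP->.
have a5 a : a \notin [:: FL; LB; LA] -> forall i, ar s5 a i = ar s a i.
  by rewrite !inE !negb_or => /and3P[n1 n2 n3] i; rewrite so5.2 ?a4 // !inE ?negb_or ?n1 ?n2 // n3.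
have E17'' : rg s5 Rnu = ar s NODE u by rewrite so5.1.
have ctB5 : content (ar s5 LB) (rg s5 Rlb) (flat PB ++ flatten
    [seq [:: ar s NODE u; ar s NODE x] | x <- adj u & pushed f0 alive 1 v x]).
  by rewrite so5.1 //; apply: content_ext ct4 => i; rewrite so5.2.
have E19 : rg s5 Rla0 = rg s Rla by rewrite so5.1 // so4.1 //= -e2 // addn0.
have E20 : rg s5 Rlb0 = rg s Rlb by rewrite so5.1 // so4.1 //= -e2 // addn0.
pose XA := [seq x <- adj v | pushed f0 alive 2 u x].
pose XB := [seq x <- adj u | pushed f0 alive 1 v x].
have XBP x : (x \in XB) = [&& x < n, alive x, x != u, x != v, g u x & ~~ g v x].
  rewrite mem_filter /pushed /f0 !adjP //.
  have [guv|] := boolP (g u x); last by rewrite !andbF.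
  have -> : x < n by apply: (gn (y := u)); rewrite gsym.
  have -> : x != u by apply: contraL guv => /eqP->; rewrite girr.
  by case: (g v x); case: (alive x); case: (x != v).
have XAP x : (x \in XA) = [&& x < n, alive x, x != u, x != v, ~~ g u x & g v x].
  rewrite mem_filter /pushed /f0 !adjP //.
  have [gvx|] := boolP (g v x); last by rewrite !andbF.
  have -> : x < n by apply: (gn (y := v)); rewrite gsym.
  have -> : x != v by apply: contraL gvx => /eqP->; rewrite girr.
  by case: (g u x); case: (alive x); case: (x != u).
have XAu : uniq XA by apply: filter_uniq.
have XBu : uniq XB by apply: filter_uniq.
have szX : size XA + size XB = count (fun x => [&& alive x, x != u, x != v & g u x != g v x]) (iota 0 n).
  rewrite -size_cat -size_filter; apply/perm_size/uniq_perm.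
  - rewrite cat_uniq XAu XBu andbT /=; apply/hasPn => x.
    by rewrite /= XBP XAP => /and5P[_ _ _ _ /andP[-> _]]; rewrite !andbF.
  - by rewrite filter_uniq // iota_uniq.
  - move=> x; rewrite mem_cat XAP XBP mem_filter mem_iota /= add0n.
    by case: (g u x); case: (g v x); case: (x < n); case: (alive x); case: (x == u); case: (x == v).
have szAl : size XA <= n.
  by apply: leq_trans (adjm vn); rewrite size_filter count_size.
have szBl : size XB <= n.
  by apply: leq_trans (adjm un); rewrite size_filter count_size.
rewrite -!flat_map -!flat_cat -/XA -/XB in ct5 ctB5.
have := ct5.1; have := ctB5.1; rewrite !size_flat !size_cat !size_map => E6' E5'.
do 2 (apply: wp_seq; wstep); rewrite /= ?E19 ?E20 ?E5' ?E6'.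
apply: wp_seq; apply: (@wp_binE _ _ _ (2 * size XA + 2 * size XB)) => /=.
  by split; lia.
apply: wp_seq; apply: (@wp_binE _ _ _ (L < size XA + size XB)) => /=.
  rewrite e5 // eL; split; first by lia.
  by congr nat_of_bool; lia.
have FL5 x : x < n -> ar s5 FL x = f0 x.
  by move=> xn; rewrite so5.2 // so4.2 //=; apply: f0E.
(* Both outcomes end by clearing the flags along the two lists. *)
have tail s6 : chains s6 -> rg s6 Ru = u -> rg s6 Ri = v ->
    (forall x, x < n -> ar s6 FL x = f0 x) -> tree_ok s6 alive' ->
    tm s6 <= tm s + 160 * (size (adj u) + size (adj v) + 2) ->
    wp (adjloop Ru clearflag) (wp (block [:: adjloop Ri clearflag])
      (fun s' => [/\ flags_ok s', tree_ok s' alive' &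
        tm s' <= tm s + 200 * (size (adj u) + size (adj v) + 2)])) s6.
  move=> ch6 eu6 ev6 fl6 tr6 t6.
  apply: (wp_clearflag par_ok (f0 := f0)); rewrite ?eu6 // => s7 so7 f7 t7.
  have ch7 : chains s7 by apply: chains_ext ch6 => x; apply: so7.2.
  apply: wp_seq; apply: (wp_clearflag par_ok (f0 := fun x => if x \in adj u then 0 else f0 x)); rewrite ?so7.1 ?ev6 //.
  move=> s8 so8 f8 t8; apply: wp_skip; have [h1 h2] := same_off_trans so7 so8.
  split; last by lia.
    by move=> x xn; rewrite f8 // /f0; case: (x \in adj u); case: (x \in adj v).
  by apply: tree_ok_off (conj h1 h2) _ _ tr6.
have alE : alive' = if size XA + size XB <= L then fun x => (x != u) && alive x else alive.
  by rewrite szX.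
have E4 : rg s5 4 = rg s 4 by apply: e5.
have E3 : rg s5 3 = rg s 3 by apply: e5.
have E16' : rg s5 16 = u by rewrite -eu; apply: e5.
have E8' : rg s5 8 = v by rewrite -ev; apply: e5.
have ch5 : chains s5 by apply: chains_ext ch => x; apply: a5.
apply: wp_seq; apply: wp_if => /=.
  rewrite eqb0 negbK => many; wgo; apply: tail => //=; last by lia.
  have -> : alive' = alive by rewrite alE; case: leqP many.
  have fun5 a : a \notin [:: FL; LB; LA] -> ar s5 a = ar s a.
    by move=> h; apply: functional_extensionality; apply: a5.
  exists rep, PA, PB; rewrite /= E4 E3 E19 E20 !addn0 (fun5 6) // (fun5 5) // (fun5 4) //; split.
  - exact: inv.
  - exact: aliveE.
  (* The old lists are prefixes of what has been written. *)
  - rewrite ctA.1 ctB.1; split.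
      by move: ct5; rewrite flat_cat => /content_cat.
    by move: ctB5; rewrite flat_cat => /content_cat.
  - exact: szP.
  - by [].
move/eqP; rewrite eqb0 -leqNgt => few; rewrite few in alE.
have guv : ar s5 FL v = g u v.
  rewrite FL5 // /f0 !adjP // girr muln0 addn0 //.
have n2 : 0 < n by lia.
have [NvK _] := fi_node inv vn av; have [NuK _] := fi_node inv un au.
have ENv : ar s5 5 v = ar s 5 v by apply: a5.
have EP a : a \notin [:: FL; LB; LA] -> ar s5 a = ar s a.
  by move=> h; apply: functional_extensionality; apply: a5.
apply: wp_seq; apply: (@wp_ldE _ _ _ (ar s 5 v)) => /=; [by []|by lia|by rewrite E8'|].
apply: wp_seq; apply: (@wp_ldE _ _ _ (g u v)) => /=; [by []|by lia|by rewrite E8'|].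
have k4 : 4 * ((L + 1) * n) >= 2 * size PA + 2 * size PB by lia.
set par' := upd (upd (upd (ar s 6) (ar s 5 u) (rg s 4)) (ar s 5 v) (rg s 4)) (rg s 4) (rg s 4).
set node' := upd (ar s 5) v (rg s 4).
have := @forest_merge n g gsym _ _ _ _ _ _ _ inv u v un vn au av uv XA XB XAu XBu XAP XBP par' node' alive'.
set rep' := fun x => if rep x == u then v else rep x.
set PA' := PA ++ _; set PB' := PB ++ _ => mrg.
have {}mrg : forest_inv n g (rg s 4).+1 par' node' rep' alive' PA' PB'.
  apply: mrg => x.
  - rewrite /par' /= !eqnE; case: (x == ar s 5 u); case: (x == ar s 5 v); case: (x == rg s 4) => //.
  - by rewrite /node' /= eqnE.
  - by rewrite alE.
have tr6 s6 : rg s6 4 = (rg s 4).+1 -> ar s6 6 = par' -> ar s6 5 = node' ->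
    ar s6 4 = upd (ar s 4) u 0 -> rg s6 3 = (rg s 3).-1 ->
    content (ar s6 LA) (rg s6 Rla) (flat PA') -> content (ar s6 LB) (rg s6 Rlb) (flat PB') ->
    tree_ok s6 alive'.
  move=> h4 h6 h5 hal h3 hA hB; exists rep', PA', PB'; rewrite h4 h6 h5 hal h3; split=> //.
  - by move=> x xn; rewrite /= eqnE alE; case: (eqVneq x u) => //= _; apply: aliveE.
  - have -> : size PA' + size PB' = size PA + size PB + (size XA + size XB) + 1.
      by rewrite /PA' /PB' !size_cat !size_map; case: (g u v) => /=; lia.
    have nk := fi_k inv.
    by rewrite subSn // mulnS; lia.
  - split; last by have := fi_k inv; move: cntk k2; case: (rg s 3) => /=; lia.
    have -> : count alive' (iota 0 n) = count alive (iota 0 n) - 1; last by rewrite -cntE subn1.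
    have /(count_uniq_mem u) : uniq (iota 0 n) by apply: iota_uniq.
    rewrite mem_iota /= add0n un /= => <-.
    have := count_predUI alive' (pred1 u) (iota 0 n).
    rewrite (@eq_count _ (predI alive' (pred1 u)) pred0) ?count_pred0; last first.
      by move=> x; rewrite /= alE; case: (eqVneq x u) => //= _; rewrite andbF.
    rewrite (@eq_count _ (predU alive' (pred1 u)) alive); last first.
      by move=> x; rewrite /= alE; case: (eqVneq x u) => [->|] //=; rewrite ?orbT ?orbF // au.
    by rewrite addn0 => ->; rewrite addnK.
have ENP a : a \notin [:: FL; LB; LA] -> ar s5 a = ar s a by exact: EP.
have EP6 := EP 6 isT; have EP5 := EP 5 isT; have EP4 := EP 4 isT.
apply: wp_seq; apply: wp_if => /= [|/eqP]; rewrite eqb0 ?negbK => guv1.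
  rewrite /PA' /PB' guv1 in tr6.
  wgo; apply: tail => /=; [by apply: chains_ext ch5|exact: E16'|exact: E8'|exact: FL5| |by lia].
  apply: tr6 => /=.
  - by rewrite E4 addn1.
  - by rewrite /par' E17'' E4 EP6.
  - by rewrite /node' E8' E4 EP5.
  - by rewrite E16' EP4.
  - by rewrite E3 subn1.
  - by rewrite cats0.
  - rewrite catA flat_cat !addn1; apply: (content_push2 ctB5) => i /=.
    by rewrite !eqnE E17''.
rewrite /PA' /PB' (negbTE guv1) in tr6.
wgo; apply: tail => /=; [by apply: chains_ext ch5|exact: E16'|exact: E8'|exact: FL5| |by lia].
apply: tr6 => /=.
- by rewrite E4 addn1.
- by rewrite /par' E17'' E4 EP6.
- by rewrite /node' E8' E4 EP5.
- by rewrite E16' EP4.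
- by rewrite E3 subn1.
- rewrite catA flat_cat !addn1; apply: (content_push2 ct5) => i /=.
  by rewrite !eqnE E17''.
- by rewrite cats0.
Qed.
End Program.

(** * Partition refinement by the sampled neighbourhoods *)

Definition refine_step : cmd :=
  block [:: Ld Rc CLS Rx; Ld Ra STAMP Rc; Set_ Re 1; Bin Add Rb Ri Re; Bin Eq Ra Ra Rb;
    If Ra Skip (block [:: St STAMP Rc Rb; St NEWID Rc Rfresh; Set_ Ra 0; St STAMP Rfresh Ra;
      St LAST Rfresh Ra; Bin Add Rfresh Rfresh Re]);
    Ld Rc NEWID Rc; St CLS Rx Rc].

Definition refine_cmd : cmd :=
  block [:: Set_ Rfresh 1; Set_ Re 0; St STAMP Re Re; St LAST Re Re;
    For Ri Rn Rt (block [:: Set_ Re 0; St CLS Ri Re]);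
    For Ri Rn Rt (block [:: Ld Ra MARK Ri; Ld Rb ALIVE Ri; Bin Mul Ra Ra Rb;
      If Ra (adjloop Ri refine_step) Skip])].

Section Program.
Variables (n m q L : nat) (g : rel nat) (adj : nat -> seq nat) (w Z : nat).
Hypothesis par_ok : params n m q L g adj w Z.
Let ZW := p_ZW par_ok.
Let Zn := p_Zn par_ok.
Let Zm := p_Zm par_ok.
Let ZL := p_ZL par_ok.
Let adjP := p_adjP par_ok.
Let adj_uniq := p_adju par_ok.
Let sum_deg := p_sum par_ok.

Local Notation wp := (wp w 32 Z).

Local Notation base_ok := (base_ok n m L adj Z).

Definition deg_sum k := \sum_(0 <= x < k) size (adj x).

Lemma deg_sumS k : deg_sum k.+1 = deg_sum k + size (adj k).
Proof. exact: big_nat_recr. Qed.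

Lemma deg_sum_le k : k <= n -> deg_sum k <= 2 * m.
Proof. by move=> kn; rewrite -sum_deg /deg_sum [X in _ <= X](big_cat_nat (n := k)) //= leq_addr. Qed.

(** A new class number is spent only on reading a list entry, which bounds [Rfresh] by
    [1 + deg_sum k]. Stamps are at most [k], so no class looks split by vertex [k] yet. [LAST] is
    zero in preparation for the pass. *)
Definition cls_ok (mk : pred nat) (k : nat) (s : store) : Prop :=
  [/\ forall x y, x < n -> y < n ->
        (ar s CLS x == ar s CLS y) = all (fun z => mk z ==> (g z x == g z y)) (iota 0 k),
      forall x, x < n -> ar s CLS x < rg s Rfresh,
      forall c, c < rg s Rfresh -> ar s LAST c = 0 /\ ar s STAMP c <= k &
      0 < rg s Rfresh <= 1 + deg_sum k].

Lemma cls_ok_skip mk k s s' : ar s' CLS =1 ar s CLS -> ar s' LAST =1 ar s LAST ->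
  ar s' STAMP =1 ar s STAMP -> rg s' Rfresh = rg s Rfresh -> ~~ mk k ->
  cls_ok mk k s -> cls_ok mk k.+1 s'.
Proof.
move=> h1 h2 h3 h4 /negbTE mkk [i1 i2 i3 i4]; split; rewrite ?h4 ?deg_sumS.
- by move=> x y xn yn; rewrite !h1 i1 // -[k.+1]addn1 iotaD all_cat add0n /= mkk !andbT.
- by move=> x xn; rewrite h1; apply: i2.
- by move=> c /i3[h5 h6]; rewrite h2 h3; split=> //; apply: leqW.
- by lia.
Qed.

Lemma wp_refine1 mk k (Q : store -> Prop) s :
  base_ok s -> cls_ok mk k s -> rg s Ri = k -> k < n -> mk k ->
  (forall s', same_off (mods (adjloop Ri refine_step)) (amods (adjloop Ri refine_step)) s s' ->
     cls_ok mk k.+1 s' -> tm s' <= tm s + 60 * (size (adj k) + 1) -> Q s') ->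
  wp (adjloop Ri refine_step) Q s.
Proof.
move=> [en em eL ch elf] [i1 i2 i3 i4] ek kn mkk IQ.
have dk := deg_sum_le kn; rewrite deg_sumS in dk.
pose c0 := ar s CLS; pose f0 := rg s Rfresh.
(* The vertices of [l] have been moved to classes numbered from [f0] on, separated as before; all
   others keep their class. A stamp [k.+1] certifies that some moved vertex came from that class. *)
pose I (l : seq nat) s1 := [/\
  forall x y, x \in l -> y \in l -> (ar s1 CLS x == ar s1 CLS y) = (c0 x == c0 y),
  forall x, x < n -> ar s1 CLS x < rg s1 Rfresh /\
     if x \in l then [/\ f0 <= ar s1 CLS x, ar s1 STAMP (c0 x) = k.+1 & ar s1 NEWID (c0 x) = ar s1 CLS x]
     else ar s1 CLS x = c0 x,
  forall c, c < rg s1 Rfresh -> [/\ ar s1 LAST c = 0, ar s1 STAMP c <= k.+1 &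
     ar s1 STAMP c = k.+1 -> exists2 x, x \in l & c0 x = c],
  f0 <= rg s1 Rfresh <= f0 + size l &
  tm s1 <= tm s + 60 * size l + 4].
apply: (@wp_forlist _ _ _ _ _ _ _ _ _ _ (adj k) I); rewrite ?ek //.
- by lia.
- exact: ch.
- move=> y; split=> //=.
  + by move=> x xn; split=> //; apply: i2.
  + by move=> c /i3[h1 h2]; split=> //; [apply: leqW|lia].
  + by rewrite addn0 leqnn.
  + by lia.
- move=> l1 y l2 s1 el so [J1 J2 J3 J4 J5] pZ.
  have yn : y < n by apply: (adj_lt par_ok kn); rewrite el mem_cat mem_head orbT.
  have yl1 : y \notin l1.
    by have := adj_uniq k; rewrite el cat_uniq => /and3P[_ /norP[]].
  have l1n x : x \in l1 -> x < n.
    by move=> xl; apply: (adj_lt par_ok kn); rewrite el mem_cat xl.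
  have [] := J2 y yn; rewrite (negbTE yl1) => cy ecy.
  have ek1 : rg s1 Ri = k by rewrite so.1.
  have sz : size l1 < size (adj k) by rewrite el size_cat /=; lia.
  have c0y : c0 y < f0 by apply: i2.
  have eCy : ar s1 CLS y = c0 y by [].
  apply: wp_seq; apply: (@wp_ldE _ _ _ (c0 y)); [by []|by wside|by []|].
  do 3 (wstep; wstep; rewrite /=); rewrite ek1 addn1.
  apply: wp_seq; apply: (@wp_binE _ _ _ (ar s1 STAMP (c0 y) == k.+1)) => /=.
    by split=> //; lia.
  apply: wp_seq; apply: wp_if => /= [|/eqP]; rewrite eqb0 ?negbK => st.
    have [_ _ /(_ (eqP st))[x0 x0l e0]] := J3 _ (leq_trans c0y (proj1 (andP J4))).
    have x0n := l1n _ x0l.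
    have [cx0] := J2 _ x0n; rewrite x0l e0 => -[fx0 sx0 nx0].
    wgo => z; rewrite nx0.
    have inE' x : (x \in rcons l1 y) = (x == y) || (x \in l1) by rewrite mem_rcons inE.
    split; rewrite ?size_rcons /=.
    + move=> x x'; rewrite !inE' !eqnE; case: (eqVneq x y) => [->|_]; case: (eqVneq x' y) => [->|_] //=.
      * by rewrite !eqxx.
      * by move=> _ x'l; rewrite J1 // e0.
      * by move=> xl _; rewrite J1 // e0.
      * exact: J1.
    + move=> x xn; rewrite inE' eqnE; case: (eqVneq x y) => [->|_] //=; last exact: J2.
    + move=> c lc. have [h1 h2 h3] := J3 c lc. split=> //; move=> /h3[x xl ex].
      by exists x => //; rewrite inE' xl orbT.
    + by lia.
    + by lia.
  (* The old class of [y] is unstamped, so no earlier neighbour came from it and a fresh number is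
     right. *)
  have nst x : x \in l1 -> c0 x != c0 y.
    move=> xl; apply: contra st => /eqP e; have [_] := J2 _ (l1n _ xl).
    by rewrite xl => -[_ <- _]; rewrite e.
  do 6 (wstep; wstep; rewrite /=); wstep; wstep; wgo => z.
  have inE' x : (x \in rcons l1 y) = (x == y) || (x \in l1) by rewrite mem_rcons inE.
  have FL0 : f0 <= rg s1 7 by case/andP: J4.
  have c0n x : x < n -> c0 x == rg s1 7 = false.
    by move=> xn; rewrite ltn_eqF // (leq_trans _ FL0) //; apply: i2.
  split; rewrite ?size_rcons /= ?eqnE ?eqxx.
  + move=> x x'; rewrite !inE' ?eqnE; case: (eqVneq x y) => [->|_]; case: (eqVneq x' y) => [->|_] //=.
    * by rewrite !eqxx.
    * move=> _ x'l; rewrite [c0 y == _]eq_sym (negbTE (nst _ x'l)) gtn_eqF //.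
      by have [] := J2 _ (l1n _ x'l).
    * move=> xl _; rewrite (negbTE (nst _ xl)) ltn_eqF //.
      by have [] := J2 _ (l1n _ xl).
    * exact: J1.
  + move=> x xn; rewrite inE' ?eqnE; case: (eqVneq x y) => [->|_] /=.
      by rewrite c0n // eqxx addn1 ltnS leqnn.
    rewrite c0n //; have [h1 h2] := J2 x xn; split; first by rewrite addn1 ltnS ltnW.
    by case: ifP h2 => // xl; rewrite (negbTE (nst _ xl)).
  + move=> c; rewrite addn1 ltnS leq_eqVlt => /orP[/eqP->|lc].
      by rewrite ?eqnE eqxx.
    have [h1 h2 h3] := J3 c lc; rewrite ?eqnE ltn_eqF //.
    case: (eqVneq c (c0 y)) => [ec|_]; split=> //.
      by move=> _; exists y; rewrite ?inE' ?eqxx.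
    by move=> /h3[x xl ex]; exists x => //; rewrite inE' xl orbT.
  + by lia.
  + by lia.
- move=> s1 so [J1 J2 J3 J4 J5]; apply: IQ => //=; last by lia.
  have adjk x : x < n -> (x \in adj k) = g k x by move=> xn; rewrite adjP.
  split.
  + move=> x y xn yn; rewrite -[k.+1]addn1 iotaD all_cat add0n -i1 // /= mkk !andbT /=.
    have [_ hx] := J2 x xn; have [_ hy] := J2 y yn; rewrite !adjk // in hx hy.
    case: (boolP (g k x)) hx => gx; case: (boolP (g k y)) hy => gy; rewrite /= ?andbT ?andbF.
    * by move=> _ _; apply: J1; rewrite adjk.
    * by move=> -> [h _ _]; rewrite gtn_eqF // (leq_trans (i2 _ yn)).
    * by move=> [h _ _] ->; rewrite ltn_eqF // (leq_trans (i2 _ xn)).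
    * by move=> -> ->.
  + by move=> x xn; have [] := J2 x xn.
  + by move=> c /J3[h1 h2 _].
  + by rewrite deg_sumS /=; case/andP: i4 => i4 i5; rewrite -/f0 in i4 i5; lia.
Qed.

Lemma wp_refine (alive mark : pred nat) (Q : store -> Prop) s :
  base_ok s -> (forall x, x < n -> ar s ALIVE x = alive x) ->
  (forall x, x < n -> ar s MARK x = mark x) ->
  (forall s', same_off (mods refine_cmd) (amods refine_cmd) s s' ->
     cls_ok (predI mark alive) n s' -> tm s' <= tm s + 200 * (n + m + 1) -> Q s') ->
  wp refine_cmd Q s.
Proof.
move=> bs aliveE markE IQ; have [en em eL ch elf] := bs.
apply: (@wp_conseq _ _ _ _ (fun s' => cls_ok (predI mark alive) n s' /\
  tm s' <= tm s + 200 * (n + m + 1))); last first.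
  by move=> s' so [h1 h2]; apply: IQ.
do 4 (wstep; wstep; rewrite /=); set s0 := Store _ _ _.
have bs0 : base_ok s0 by split.
apply: wp_seq; apply: (@wp_for _ _ _ _ _ _ _ (fun k s1 => (forall x, x < k -> ar s1 CLS x = 0) /\
  tm s1 <= tm s + 20 + 20 * k)) => //=; rewrite ?en.
- by lia.
- by lia.
- by move=> y; split=> //; lia.
- move=> k s1 kn ek so [i1 i2]; wgo => z; split; last by lia.
  by move=> x xk; rewrite eqnE ek; case: eqP => // ?; apply: i1; lia.
move=> s1 ei so1 [i1 t1].
have bs1 : base_ok (tick s1) by apply: base_ok_off so1 _ _ bs0.
have E7 : rg s1 7 = 1 by rewrite so1.1.
have E12 x : ar s1 12 x = if eqn x 0 then 0 else ar s 12 x by rewrite so1.2.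
have E10 x : ar s1 10 x = if eqn x 0 then 0 else ar s 10 x by rewrite so1.2.
have c1 : cls_ok (predI mark alive) 0 (tick s1).
  split=> /=.
  - by move=> x y xn yn; rewrite !i1 ?ei ?eqxx //= en.
  - by move=> x xn; rewrite i1 ?ei ?E7 //= en.
  - by rewrite E7 => -[|//] _; rewrite E12 E10.
  - by rewrite E7 /deg_sum big_geq.
apply: wp_seq; apply: (@wp_for _ _ _ _ _ _ _ (fun k s2 => cls_ok (predI mark alive) k s2 /\
  tm s2 <= tm s1 + 20 + 20 * k + 60 * (deg_sum k + k))) => //=; rewrite ?so1.1 //= ?en //.
- by lia.
- by lia.
- by move=> y; split; [exact: c1|lia].
- move=> k s2 kn ek so2 [i2 t2].
  have bs2 : base_ok s2 by apply: base_ok_off so2 _ _ bs1.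
  apply: wp_seq; apply: (@wp_ldE _ _ _ (mark k)); [by []|by wside| |].
    by rewrite /= ek so2.2 //= so1.2 //= markE.
  apply: wp_seq; apply: (@wp_ldE _ _ _ (alive k)) => /=; [by []|by wside| |].
    by rewrite /= ek so2.2 //= so1.2 //= aliveE.
  apply: wp_seq; apply: (@wp_binE _ _ _ (mark k && alive k)).
    by rewrite /= mulnb; split=> //; case: (_ && _); lia.
  apply: wp_seq; apply: wp_if => /= [|/eqP]; rewrite eqb0 ?negbK => mk.
    apply: (@wp_refine1 (predI mark alive) k); rewrite ?ek //.
    move=> s4 so4 c4 t4; apply: wp_skip => z; split; first exact: c4.
    by rewrite /= deg_sumS; move: t4 => /=; lia.
  apply: wp_skip; apply: wp_skip => z /=; split; last by rewrite deg_sumS; lia.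
  by apply: cls_ok_skip i2.
move=> s3 e3 so3 [i3 t3]; apply: wp_skip; split => //=.
by have := deg_sum_le (leqnn n); move: t1 t3; rewrite /s0 /= ?en; lia.
Qed.
End Program.

(** * The walk through the vertices *)

Section Pass.
Variables (n : nat) (cls : nat -> nat) (close : pred nat -> nat -> nat -> bool) (A0 : pred nat).
Hypothesis close_sub : forall (A B : pred nat) u v, (forall x, A x -> B x) -> close B u v -> close A u v.

(* One more than the last vertex below [k] of class [c], or 0 *)
Fixpoint lastc (k c : nat) : nat :=
  if k is k'.+1 then if A0 k' && (cls k' == c) then k else lastc k' c else 0.

(** Testing [A0 k'] is the same as testing whether [k'] is alive now: no vertex is removed before
    its own visit. *)
Fixpoint survivors (k : nat) : pred nat :=
  if k is k'.+1 then
    if A0 k' then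
      if lastc k' (cls k') is u.+1 then
        if close (survivors k') u k' then fun x => (x != u) && survivors k' x else survivors k'
      else survivors k'
    else survivors k'
  else A0.

Lemma lastcP k c y : lastc k c = y.+1 -> [/\ y < k, A0 y & cls y = c].
Proof.
elim: k => //= k IH; case: ifP => [/andP[Ak /eqP ck] [<-]|_ /IH[h1 h2 h3]]; split=> //.
exact: ltnW.
Qed.

Lemma lastc_ge k y : y < k -> A0 y -> y < lastc k (cls y).
Proof.
elim: k => //= k IH; rewrite ltnS leq_eqVlt => /orP[/eqP->|yk] Ay; first by rewrite Ay eqxx leqnn.
by case: ifP => // _; [apply: ltnW|apply: IH].
Qed.

Lemma survivors_sub k x : survivors k x -> A0 x.
Proof.
elim: k => //= k IH; case: (A0 k) => //; case: (lastc k (cls k)) => // u.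
by case: ifP => // _ /andP[].
Qed.

Lemma survivors_ge k x : k <= x -> survivors k x = A0 x.
Proof.
elim: k => //= k IH kx; rewrite -IH 1?ltnW //; case: (A0 k) => //.
case e : (lastc k (cls k)) => [|u] //; case: ifP => // _.
by have [uk _ _] := lastcP e; rewrite gtn_eqF //; lia.
Qed.

(** A vertex is removed only when a later member of its class is visited. Hence [LAST] always points
    to an alive vertex. *)
Lemma survivors_last k y : y < k -> A0 y -> lastc k (cls y) = y.+1 -> survivors k y.
Proof.
elim: k => //= k IH; rewrite ltnS leq_eqVlt => /orP[/eqP->|yk] Ay.
  have sk : survivors k k by rewrite survivors_ge.
  move=> _; rewrite Ay; case e : (lastc k (cls k)) => [|u] //; case: ifP => // _.
  by have [uk _ _] := lastcP e; rewrite gtn_eqF.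
case: (boolP (A0 k)) => [Ak|_] /=; last exact: IH.
case: eqP => [_ [ek]|ne ly]; first by move: yk; rewrite ek ltnn.
have sy := IH yk Ay ly.
case e : (lastc k (cls k)) => [|u] //; case: ifP => // _.
have [_ _ eu] := lastcP e; rewrite sy andbT; apply: contra_not_neq ne => ->.
by rewrite eu.
Qed.

(** Closeness in [A0] is inherited by every later alive set through [close_sub], so each visited
    vertex absorbs its predecessor. *)
Lemma survivors_inj k x : (forall u v, A0 u -> A0 v -> cls u = cls v -> close A0 u v) ->
  x < k -> survivors k x -> lastc k (cls x) = x.+1.
Proof.
move=> cl; elim: k => //= k IH; rewrite ltnS leq_eqVlt => /orP[/eqP->|xk].
  by move=> sk; have -> : A0 k by [apply: (survivors_sub (k := k.+1))]; rewrite eqxx.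
case: (boolP (A0 k)) => [Ak|_] /=; last exact: IH.
case: eqP => [e|ne].
  case el : (lastc k (cls k)) => [|u].
    by move=> /(IH xk); rewrite -e el.
  have [uk Au eu] := lastcP el.
  rewrite (close_sub (B := A0)); last exact: cl.
    by case/andP => xu /(IH xk); rewrite -e el => -[ux]; rewrite ux eqxx in xu.
  by move=> y; apply: survivors_sub.
case el : (lastc k (cls k)) => [|u]; first exact: IH.
by case: ifP => _; [case/andP => _|]; apply: IH.
Qed.

(** Each [u] is the class predecessor of at most one [v]; with degrees for [f], reading the
    predecessors' lists costs no more than reading all lists once. *)
Lemma sum_pred_le (f : nat -> nat) :
  \sum_(0 <= v < n) (if A0 v then if lastc v (cls v) is u.+1 then f u else 0 else 0)
   <= \sum_(0 <= u < n) f u.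
Proof.
rewrite !big_mkord.
pose F (v : 'I_n) := if A0 v then lastc v (cls v) else 0.
apply: (@leq_trans (\sum_(v < n) \sum_(u < n) (if F v == u.+1 then f u else 0))).
  apply: leq_sum => v _; rewrite /F; case: (A0 v) => //.
  case e : (lastc v (cls v)) => [|u] //; have [uv _ _] := lastcP e.
  have un := ltn_trans uv (ltn_ord v).
  by rewrite (bigD1 (Ordinal un)) //= eqxx leq_addr.
rewrite exchange_big /=; apply: leq_sum => u _.
have [/existsP[v /eqP ev]|] := boolP [exists v, F v == u.+1]; last first.
  by move=> /existsPn h; rewrite big1 // => v _; rewrite (negbTE (h v)).
rewrite (bigD1 v) //= ev eqxx big1 ?addn0 // => v' ne; case: eqP => // ev'.
move: ev ev'; rewrite /F; case: (boolP (A0 v)) => // Av ev; case: (boolP (A0 v')) => // Av' ev'.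
have [uv Au cu] := lastcP ev; have [uv' _ cu'] := lastcP ev'.
have [lt|lt|/val_inj e] := ltngtP v v'; last by rewrite e eqxx in ne.
  by have := lastc_ge lt Av; rewrite -cu cu' ev'; lia.
by have := lastc_ge lt Av'; rewrite -cu' cu ev; lia.
Qed.

End Pass.

Definition pass_cmd : cmd :=
  For Ri Rn Rt (block [:: Ld Ra ALIVE Ri;
    If Ra (block [:: Ld Rc CLS Ri; Ld Ru LAST Rc; Set_ Re 1; Bin Add Ra Ri Re; St LAST Rc Ra;
      If Ru (block [:: Bin Defs.Sub Ru Ru Re; try_cmd]) Skip]) Skip]).

Section Program.
Variables (n m q L : nat) (g : rel nat) (adj : nat -> seq nat) (w Z : nat).
Hypothesis par_ok : params n m q L g adj w Z.
Let ZW := p_ZW par_ok.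
Let Zn := p_Zn par_ok.
Let Zm := p_Zm par_ok.
Let ZL := p_ZL par_ok.
Let adj_uniq := p_adju par_ok.
Let sum_deg := p_sum par_ok.

Local Notation wp := (wp w 32 Z).

Local Notation base_ok := (base_ok n m L adj Z).

Local Notation tree_ok := (tree_ok n L g).
Local Notation flags_ok := (flags_ok n).
Local Notation close_pair := (close_pair n L g).
Local Notation cls_ok := (cls_ok n g adj).

Lemma wp_pass mk alive (Q : store -> Prop) s :
  base_ok s -> flags_ok s -> tree_ok s alive -> cls_ok mk n s ->
  (forall s', same_off (mods pass_cmd) (amods pass_cmd) s s' ->
     flags_ok s' -> tree_ok s' (survivors (ar s CLS) close_pair alive n) ->
     tm s' <= tm s + 2000 * (n + m + 1) -> Q s') ->
  wp pass_cmd Q s.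
Proof.
move=> bs fl tr [cl1 cl2 cl3 cl4] IQ; have [en em eL ch elf] := bs.
pose cls := ar s CLS.
pose prv v := if alive v then if lastc cls alive v (cls v) is u.+1 then size (adj u) else 0 else 0.
have cls_sub (A B : pred nat) u v : (forall x, A x -> B x) -> close_pair B u v -> close_pair A u v.
  move=> AB; apply: leq_trans; apply: sub_count => x /and4P[/AB -> -> -> ->] //.
have f0 : rg s Rfresh < Z.
  by have := deg_sum_le par_ok (leqnn n); lia.
pose T k := \sum_(0 <= v < k) (size (adj v) + prv v).
have TS k : T k.+1 = T k + (size (adj k) + prv k) by exact: big_nat_recr.
apply: (@wp_for _ _ _ _ _ _ _ (fun k s1 => [/\ flags_ok s1,
    tree_ok s1 (survivors cls close_pair alive k),
    forall c, c < rg s Rfresh -> ar s1 LAST c = lastc cls alive k c &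
    tm s1 <= tm s + 10 + 500 * k + 200 * T k])) => //=; rewrite ?en.
- by lia.
- by lia.
- move=> y; split=> //.
  + by move=> c /cl3[].
  + by lia.
- move=> k s1 kn ek so [i1 i2 i3 i4].
  have [rep [PA [PB [inv aliveE _ _ _]]]] := i2.
  have ak : survivors cls close_pair alive k k = alive k by apply: survivors_ge.
  have bs1 : base_ok s1 by apply: base_ok_off so _ _ bs.
  have eC : ar s1 CLS k = cls k by rewrite so.2.
  have ck : cls k < rg s Rfresh by apply: cl2.
  apply: wp_seq; apply: (@wp_ldE _ _ _ (alive k)) => /=; [by []|by lia| |].
    by rewrite ek aliveE // ak.
  apply: wp_seq; apply: wp_if => /= [|/eqP]; rewrite eqb0 ?negbK => Ak; last first.
    do 2 apply: wp_skip; move=> z; split => //=.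
    + by rewrite (negbTE Ak).
    + by move=> c lc; rewrite (negbTE Ak) i3.
    + by rewrite TS; lia.
  apply: wp_seq; apply: (@wp_ldE _ _ _ (cls k)) => /=; [by []|by lia|by rewrite ek|].
  apply: wp_seq; apply: (@wp_ldE _ _ _ (lastc cls alive k (cls k))) => /=; [by []|by lia|by rewrite i3|].
  do 3 (wstep; wstep; rewrite /=); rewrite ek addn1.
  have e3 c : c < rg s 7 -> upd (ar s1 12) (cls k) k.+1 c = lastc cls alive k.+1 c.
    by move=> lc; rewrite /= eqnE Ak eq_sym; case: eqP => // _; apply: i3.
  apply: wp_seq; apply: wp_if => /= [|/eqP]; last first.
    move/eqP => l0; do 3 apply: wp_skip; move=> z; split => //=.
    + by rewrite Ak l0; exact: i2.
    + by rewrite TS; lia.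
  case el : (lastc cls alive k (cls k)) => [|u] // _.
  have [uk Au cu] := lastcP el.
  have su : survivors cls close_pair alive k u.
    by apply: survivors_last => //; rewrite cu.
  wstep; wstep; rewrite /= subn1 /=; apply: wp_seq.
  apply: (@wp_try _ _ _ _ _ _ _ _ par_ok (survivors cls close_pair alive k) u k) => //.
  + exact: ltn_trans uk kn.
  + by rewrite ltn_eqF.
  + by rewrite ak.
  move=> s2 so2 h1 h2 t2; do 3 apply: wp_skip; move=> z; split => //=.
  + by rewrite Ak; exact: h2.
  + move=> c lc; rewrite so2.2 //; exact: e3.
  + by move: t2; rewrite TS /prv Ak el /=; lia.
move=> s3 e3 so3 [i1 i2 i3 i4]; apply: IQ => //=.
(* [2 * m] for the lists of the visited vertices and [2 * m] for those of their predecessors. *)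
have : T n <= 4 * m.
  rewrite /T big_split /= sum_deg; have := sum_pred_le n cls alive (fun u => size (adj u)).
  by rewrite sum_deg /prv; lia.
by lia.
Qed.
End Program.

(** * A whole round, and the output *)

Definition round_cmd : cmd := block [:: refine_cmd; pass_cmd].

Definition append (src len : nat) : cmd :=
  For Ri len Rt (block [:: Ld Ra src Ri; St OUT Rc Ra; Set_ Re 1; Bin Add Rc Rc Re]).

(** The pointer is 1 plus twice the number of pairs. *)
Definition set_count (arr ptr : nat) : cmd :=
  block [:: Set_ Re 1; Bin Defs.Sub Ra ptr Re; Set_ Rb 2; Bin Div Ra Ra Rb; Set_ Rb 0; St arr Rb Ra].

Definition final_cmd : cmd :=
  block [:: set_count LA Rla; set_count LB Rlb; Set_ Re 0; St OUT Re Rk; Set_ Rc 1;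
    append PAR Rk; append LF Rn; append LA Rla; append LB Rlb].

Definition same_trace n (g : rel nat) (S : pred nat) u v : bool :=
  all (fun z => S z ==> (g z u == g z v)) (iota 0 n).

Section Program.
Variables (n m q L : nat) (g : rel nat) (adj : nat -> seq nat) (w Z : nat).
Hypothesis par_ok : params n m q L g adj w Z.
Let ZW := p_ZW par_ok.
Let Zn := p_Zn par_ok.
Let Zm := p_Zm par_ok.
Let ZL := p_ZL par_ok.
Let adj_uniq := p_adju par_ok.
Let sum_deg := p_sum par_ok.

Local Notation wp := (wp w 32 Z).

Local Notation base_ok := (base_ok n m L adj Z).

Local Notation tree_ok := (tree_ok n L g).
Local Notation flags_ok := (flags_ok n).
Local Notation close_pair := (close_pair n L g).

(** Whether classes consist of close vertices depends on the sample; the forest and the time bound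
    are right on every sample. *)
Lemma wp_round (alive mark : pred nat) (Q : store -> Prop) s :
  base_ok s -> flags_ok s -> tree_ok s alive -> (forall x, alive x -> x < n) ->
  (forall x, x < n -> ar s MARK x = mark x) ->
  (forall s' alive', base_ok s' -> flags_ok s' -> tree_ok s' alive' ->
     (forall x, alive' x -> alive x) ->
     ((forall u v, alive u -> alive v -> same_trace n g (predI mark alive) u v ->
          close_pair alive u v) ->
      forall u v, alive' u -> alive' v -> same_trace n g (predI mark alive) u v -> u = v) ->
     tm s' <= tm s + 2500 * (n + m + 1) -> Q s') ->
  wp round_cmd Q s.
Proof.
move=> bs fl tr an markE IQ.
have [rep [PA [PB [_ aliveE _ _ _]]]] := tr.
apply: wp_seq; apply: (wp_refine par_ok bs aliveE markE) => s1 so1 c1 t1.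
have bs1 : base_ok s1 by apply: base_ok_off so1 _ _ bs.
have tr1 : tree_ok s1 alive by apply: tree_ok_off so1 _ _ tr.
have fl1 : flags_ok s1 by move=> x xn; rewrite so1.2 // fl.
apply: wp_seq; apply: (wp_pass par_ok bs1 fl1 tr1 c1) => s2 so2 fl2 tr2 t2.
apply: wp_skip; apply: IQ fl2 tr2 _ _ _.
- by apply: base_ok_off so2 _ _ bs1.
- by move=> x; apply: survivors_sub.
- have [cE _ _ _] := c1 => close_all u v su sv.
  have au := survivors_sub su; have av := survivors_sub sv.
  rewrite /same_trace -cE ?an // => /eqP e.
  have cls_sub (A B : pred nat) u' v' : (forall x, A x -> B x) -> close_pair B u' v' -> close_pair A u' v'.
    by move=> AB; apply: leq_trans; apply: sub_count => x /and4P[/AB -> -> -> ->].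
  have cl u' v' : alive u' -> alive v' -> ar s1 CLS u' = ar s1 CLS v' -> close_pair alive u' v'.
    by move=> au' av' e'; apply: close_all; rewrite // /same_trace -cE ?an // e'.
  have := survivors_inj cls_sub cl (an _ au) su; have := survivors_inj cls_sub cl (an _ av) sv.
  by rewrite e => -> [].
- by lia.
Qed.

Definition holds (a : nat -> nat) (ptr : nat) (l : seq nat) : Prop :=
  ptr = size l /\ forall i, i < size l -> a i = nth 0 l i.

Lemma wp_append src len lst l (Q : store -> Prop) s :
  len < 7 -> src < OUT -> rg s len = size l ->
  holds (ar s OUT) (rg s Rc) lst -> (forall i, i < size l -> ar s src i = nth 0 l i) ->
  size lst + size l < Z ->
  (forall s', same_off [:: Ri; Rt; Ra; Rc; Re] [:: OUT] s s' ->
     holds (ar s' OUT) (rg s' Rc) (lst ++ l) -> tm s' <= tm s + 20 * (size l + 1) -> Q s') ->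
  wp (append src len) Q s.
Proof.
move=> len7 srcO el [hp hl] sl lZ IQ.
apply: (@wp_for _ _ _ _ _ _ _ (fun k s1 => holds (ar s1 OUT) (rg s1 Rc) (lst ++ take k l) /\
   tm s1 <= tm s + 3 + 15 * k)) => //=.
- by move: len len7 {el} => [|[|[|[|[|[|[|]]]]]]].
- by lia.
- by rewrite el; lia.
- by move=> v; rewrite take0 cats0; split; [split|lia].
- move=> k s1; rewrite el => kl ek so [[i1 i2] i3].
  have sz : size (lst ++ take k l) = size lst + k by rewrite size_cat size_take kl.
  rewrite sz in i1 i2.
  apply: wp_seq; apply: (@wp_ldE _ _ _ (nth 0 l k)) => /=; [by rewrite (ltn_trans srcO)|by lia| |].
    by rewrite ek so.2 ?sl // !inE neq_ltn srcO.
  wgo => z; split; last by lia.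
  rewrite (take_nth 0) // -rcons_cat; split => [|i]; rewrite size_rcons sz /=; first by lia.
  rewrite ltnS leq_eqVlt nth_rcons sz eqnE i1 => /orP[/eqP->|lt]; first by rewrite eqxx ltnn.
  by rewrite ltn_eqF // lt i2.
move=> s1 ei so [i1 i2]; apply: IQ.
- apply: same_off_sub so => // x; rewrite !inE; do ![case/orP=> [->|]; rewrite ?orbT //]; move=> ->; rewrite ?orbT //.
- by move: i1; rewrite el take_size.
- by move: i2; rewrite el /=; lia.
Qed.

Lemma pairs_nat_flat P : pairs_nat P = size P :: flat P. Proof. by []. Qed.

Lemma content_count (a a' : nat -> nat) ptr P : content a ptr (flat P) ->
  (forall i, a' i = if i == 0 then size P else a i) ->
  forall i, i < size (pairs_nat P) -> a' i = nth 0 (pairs_nat P) i.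
Proof. by move=> [_ h] e [|i] /= ip; rewrite e //=; apply: h. Qed.

(** Some vertex is alive, so at most [n.-1] merges were made. The factor [n.-1] rather than [n]
    matters for [n = 1], where [n * ln n] vanishes. *)
Lemma wp_final alive (Q : store -> Prop) s :
  base_ok s -> tree_ok s alive ->
  (forall s' rep PA PB, forest_inv n g (rg s Rk) (ar s PAR) (ar s NODE) rep alive PA PB ->
     size PA + size PB <= (L + 1) * n.-1 ->
     (forall i, i < Z -> i < size (rg s Rk :: map (ar s PAR) (iota 0 (rg s Rk)) ++ iota 0 n
          ++ pairs_nat PA ++ pairs_nat PB) ->
        ar s' OUT i = nth 0 (rg s Rk :: map (ar s PAR) (iota 0 (rg s Rk)) ++ iota 0 n
          ++ pairs_nat PA ++ pairs_nat PB) i) ->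
     size (rg s Rk :: map (ar s PAR) (iota 0 (rg s Rk)) ++ iota 0 n
          ++ pairs_nat PA ++ pairs_nat PB) <= Z ->
     tm s' <= tm s + 200 * (n + (L + 1) * n + 1) -> Q s') ->
  wp final_cmd Q s.
Proof.
move=> [en em eL ch elf] [rep [PA [PB [inv aliveE [ctA ctB] szP [cntE cntk]]]]] IQ.
have k2 : rg s Rk <= 2 * n by lia.
have szP1 : size PA + size PB <= (L + 1) * n.-1.
  apply: leq_trans szP _; rewrite leq_mul2l; apply/orP; right.
  have [n00|n0] := posnP n; first by lia.
  have [r1 r2 _] := fi_rep inv n0.
  have : 0 < rg s Rcnt by rewrite cntE -has_count; apply/hasP; exists (rep 0); rewrite // mem_iota.
  by lia.
have szP' : size PA + size PB <= (L + 1) * n.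
  by apply: leq_trans szP1 _; rewrite leq_mul2l leq_pred orbT.
have eA := ctA.1; have eB := ctB.1; rewrite !size_flat in eA eB.
have dA : (rg s 5 - 1) %/ 2 = size PA by rewrite eA addKn mulKn.
have dB : (rg s 6 - 1) %/ 2 = size PB by rewrite eB addKn mulKn.
repeat (lazymatch goal with |- wp (append _ _) _ _ => fail | _ => wstep; rewrite /= end).
set s1 := Store _ _ _.
have cA : forall i, i < size (pairs_nat PA) -> ar s1 LA i = nth 0 (pairs_nat PA) i.
  by apply: content_count ctA _ => i; rewrite /= eqnE dA.
have cB : forall i, i < size (pairs_nat PB) -> ar s1 LB i = nth 0 (pairs_nat PB) i.
  by apply: content_count ctB _ => i; rewrite /= eqnE dB.
have sA : size (pairs_nat PA) = rg s 5 by rewrite pairs_nat_flat /= size_flat eA.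
have sB : size (pairs_nat PB) = rg s 6 by rewrite pairs_nat_flat /= size_flat eB.
apply: (@wp_append _ _ [:: rg s Rk] (map (ar s PAR) (iota 0 (rg s Rk)))) => //=;
  rewrite ?size_map ?size_iota //.
- by split=> // -[|//].
- by move=> i ik; rewrite (nth_map 0) ?size_iota // nth_iota.
- by lia.
move=> s2 so2 h2 t2; apply: wp_seq.
apply: (@wp_append _ _ _ (iota 0 n) _ _ _ _ _ h2) => //=.
- by rewrite so2.1 //= en size_iota.
- by move=> i; rewrite size_iota => ik; rewrite so2.2 //= elf // nth_iota.
- by rewrite size_map !size_iota; lia.
move=> s3 so3 h3 t3; apply: wp_seq.
apply: (@wp_append _ _ _ (pairs_nat PA) _ _ _ _ _ h3) => //.
- by rewrite so3.1 // so2.1 // sA.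
- by move=> i ip; rewrite so3.2 // so2.2 //; apply: cA.
- by rewrite sA /= !size_cat size_map !size_iota; lia.
move=> s4 so4 h4 t4; apply: wp_seq.
apply: (@wp_append _ _ _ (pairs_nat PB) _ _ _ _ _ h4) => //.
- by rewrite so4.1 // so3.1 // so2.1 // sB.
- by move=> i ip; rewrite so4.2 // so3.2 // so2.2 //; apply: cB.
- by rewrite size_cat sB sA /= !size_cat size_map !size_iota; lia.
move=> s5 so5 [_ h5] t5; apply: wp_skip.
rewrite -!catA !cat_cons -!catA in h5; apply: (IQ s5 rep PA PB inv szP1).
- by move=> i _ ip; apply: (h5 i).
- by rewrite -[_ :: _]cat1s !size_cat sA sB size_map !size_iota /=; lia.
- by rewrite size_iota in t3; rewrite sA in t4; rewrite sB in t5; lia.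
Qed.
End Program.

(** * Reading the input *)

Fixpoint adjr (l : seq (nat * nat)) (v : nat) : seq nat :=
  if l is e :: l' then
    (if e.2 == v then [:: e.1] else [::]) ++ (if e.1 == v then [:: e.2] else [::]) ++ adjr l' v
  else [::].

(** Entries are pushed at the front of a list, so later edges come first. *)
Definition adj_of (E : seq (nat * nat)) : nat -> seq nat := adjr (rev E).

Lemma mem_adj_of E v y : (y \in adj_of E v) = ((v, y) \in E) || ((y, v) \in E).
Proof.
rewrite /adj_of -![_ \in E]mem_rev; elim: (rev E) => //= -[a b] l IH.
rewrite !mem_cat IH !inE !xpair_eqE /=.
have hs (x z : nat) (c : bool) : (z \in (if c then [:: x] else [::])) = c && (z == x).
  by case: c; rewrite ?inE.
rewrite !hs [v == a]eq_sym [v == b]eq_sym.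
by case: (b == v); case: (y == a); case: (a == v); case: (y == b); case: ((v, y) \in l); case: ((y, v) \in l).
Qed.

(** [B] bounds the list cells in use; filling cells from [B] on does not disturb existing chains. *)
Lemma chain_grow B B' nb nx nb' nx' p l : B <= B' -> (forall i, i < B -> nb' i = nb i) ->
  (forall i, i < B -> nx' i = nx i) -> chain B nb nx p l -> chain B' nb' nx' p l.
Proof.
move=> BB h1 h2; elim: l p => //= x l IH p [p0 pB <- /IH]; rewrite h1 // h2 //.
by split=> //; apply: leq_trans BB.
Qed.

Lemma nth_flat P j : j < size P ->
  nth 0 (flat P) (2 * j) = (nth (0, 0) P j).1 /\ nth 0 (flat P) (2 * j).+1 = (nth (0, 0) P j).2.
Proof.
elim: P j => // -[a b] P IH [|j] // /IH[<- <-].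
by have -> : 2 * j.+1 = (2 * j).+2 by lia.
Qed.

Definition push_edge (v x : nat) : cmd :=
  block [:: Ld Rnx HEAD v; St NEXT Ra Rnx; St NB Ra x; St HEAD v Ra].

(** Halving [n] down to 0 takes [trunc_log 2 n + 1] iterations, each adding [4 * q] to [RL], which
    ends as [2 * L]. Edge [i] uses the list cells [2 * i + 1] and [2 * i + 2], which spares the null
    pointer. *)
Definition init_cmd q : cmd :=
  block [:: Set_ Re 0; Ld Rn IN Re; Set_ Re 1; Ld Rm IN Re; Set_ RL (4 * q); Set_ Re 0;
    Bin Add Ra Rn Re;
    While Ra (block [:: Set_ Rb 2; Bin Div Ra Ra Rb; Set_ Rb (4 * q); Bin Add RL RL Rb]);
    For Ri Rn Rt (block [:: Set_ Re 1; St ALIVE Ri Re; St NODE Ri Ri; St PAR Ri Ri; St LF Ri Ri]);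
    For Ri Rm Rt (block [:: Bin Add Ra Ri Ri; Set_ Re 2; Bin Add Rb Ra Re; Ld Ru IN Rb;
      Set_ Re 1; Bin Add Rb Rb Re; Ld Rnu IN Rb; Bin Add Ra Ra Re; push_edge Ru Rnu;
      Bin Add Ra Ra Re; push_edge Rnu Ru]);
    Set_ Re 0; Bin Add Rcnt Rn Re; Bin Add Rk Rn Re; Set_ Rla 1; Set_ Rlb 1].

Section Program.
Variables (n m q L : nat) (g : rel nat) (adj : nat -> seq nat) (w Z : nat).
Hypothesis par_ok : params n m q L g adj w Z.
Let ZW := p_ZW par_ok.
Let Zn := p_Zn par_ok.
Let Zm := p_Zm par_ok.
Let ZL := p_ZL par_ok.
Let adj_uniq := p_adju par_ok.
Let sum_deg := p_sum par_ok.

Local Notation wp := (wp w 32 Z).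

Local Notation base_ok := (base_ok n m L adj Z).

Local Notation tree_ok := (tree_ok n L g).
Local Notation flags_ok := (flags_ok n).

Variable E : seq (nat * nat).
Hypotheses (EE : adj = adj_of E) (Em : size E = m) (n0 : 0 < n)
  (En : forall a b, (a, b) \in E -> [/\ a < n, b < n & a != b])
  (LE : L = 2 * q + 2 * q * (trunc_log 2 n).+1).

Lemma wp_init (Q : store -> Prop) s :
  (forall i, i < size (n :: m :: flat E) -> ar s IN i = nth 0 (n :: m :: flat E) i) ->
  (forall x, x < n -> ar s HEAD x = 0) -> (forall x, x < n -> ar s FL x = 0) ->
  (forall s', base_ok s' -> flags_ok s' -> tree_ok s' (fun x => x < n) ->
     tm s' <= tm s + 200 * (n + m + 1) -> Q s') ->
  wp (init_cmd q) Q s.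
Proof.
move=> inE0 hd0 fl0 IQ.
have i0 : ar s 0 0 = n by rewrite inE0.
have i1 : ar s 0 1 = m by rewrite inE0.
have tln : trunc_log 2 n < n.
  by apply: leq_trans (ltn_expl _ (isT : 1 < 2)) _; apply: trunc_logP.
do 7 (wstep; wstep; rewrite /= ?i0 ?i1).
rewrite addn0; set s1 := Store _ _ _; apply: wp_seq.
pose I k s2 := exists x, [/\ rg s2 Ra = x, k = (if x == 0 then 0 else (trunc_log 2 x).+1),
  x <= n /\ k <= (trunc_log 2 n).+1, rg s2 RL + 4 * q * k = 4 * q + 4 * q * (trunc_log 2 n).+1 &
  [/\ rg s2 Rn = n, rg s2 Rm = m, ar s2 = ar s & tm s2 + 6 * k <= tm s + 20 + 6 * (trunc_log 2 n).+1]].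
apply: (@wp_while _ _ _ I _ _ _ (trunc_log 2 n).+1).
- exists n; split=> //=; first by rewrite gtn_eqF.
  by split=> //; lia.
- move=> s2 [x [e1 e2 [xn kn] e3 [e4 e5 e6 e7]]].
  have x0 : x = 0 by move: e2; case: eqP.
  split; first by rewrite e1.
  have e3' : rg s2 RL = 2 * L by rewrite LE; lia.
  apply: wp_seq; apply: (@wp_for _ _ _ _ _ _ _ (fun k s3 => tm s3 <= tm s2 + 10 + 30 * k /\
    forall x, x < k -> [/\ ar s3 ALIVE x = 1, ar s3 NODE x = x, ar s3 PAR x = x & ar s3 LF x = x]))
    => //=; rewrite ?e4.
  + by lia.
  + by lia.
  + by move=> v; split=> //; lia.
  + move=> k s3 kn' ek so [i2 i3]; wgo => z; split; first by lia.
    by move=> y; rewrite !eqnE ek ltnS leq_eqVlt; case: eqP => [->|_] //= /i3.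
  move=> s3 e8 so3 [t3 i3].
  have EIN j : j < m -> ar s3 IN (2 * j + 2) = (nth (0, 0) E j).1 /\
      ar s3 IN (2 * j + 2 + 1) = (nth (0, 0) E j).2.
    move=> jm; rewrite !so3.2 //= !e6 !inE0 /= ?size_flat ?Em; try lia.
    have [<- <-] := @nth_flat E j ltac:(by rewrite Em).
    by rewrite addn2 addn1.
  have EH x' : x' < n -> ar s3 HEAD x' = 0 by move=> xn'; rewrite so3.2 //= e6 hd0.
  apply: wp_seq; apply: (@wp_for _ _ _ _ _ _ _ (fun k s4 => tm s4 <= tm s3 + 10 + 100 * k /\
     forall v, v < n -> chain (2 * k + 1) (ar s4 NB) (ar s4 NEXT) (ar s4 HEAD v) (adjr (rev (take k E)) v)))
    => //=; rewrite ?so3.1 //= ?e5.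
  + by lia.
  + by lia.
  + by move=> z; split; [lia|move=> v vn; rewrite take0 /= EH].
  + move=> k s4 km' ek so4 [t4 ch4].
    have [E1 E2] := EIN _ km'; move: E1 E2.
    have kE : k < size E by rewrite Em.
    rewrite (take_nth (0, 0)) // rev_rcons.
    have := mem_nth (0, 0) kE; case: (nth _ E k) => a b /En[an bn ab] /= E1 E2.
    set l := adjr (rev (take k E)) in ch4 *.
    rewrite -ek in E1 E2; rewrite !mul2n -!addnn in E1 E2.
    rewrite -so4.2 // in E1; rewrite -so4.2 // in E2.
    do 3 (wstep; wstep; rewrite /=).
    apply: wp_seq; apply: (@wp_ldE _ _ _ a) => //=; first by lia.
    do 2 (wstep; wstep; rewrite /=).
    apply: wp_seq; apply: (@wp_ldE _ _ _ b) => //=; first by lia.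
    wgo => z; split; first by lia.
    rewrite !ek => v vn; set nb' := upd _ _ a; set nx' := upd _ _ _.
    have old v' : v' < n -> chain (2 * k.+1 + 1) nb' nx' (ar s4 1 v') (l v').
      move=> vn'; apply: chain_grow (ch4 _ vn'); first by lia.
        by move=> i ik; rewrite /nb' /= !eqnE !ltn_eqF //; lia.
      by move=> i ik; rewrite /nx' /= !eqnE !ltn_eqF //; lia.
    have nbP : nb' (k + k + 1 + 1) = a by rewrite /nb' /= eqnE eqxx.
    have nbP1 : nb' (k + k + 1) = b by rewrite /nb' /= !eqnE eqxx ltn_eqF //; lia.
    have nxP : nx' (k + k + 1 + 1) = ar s4 1 b.
      by rewrite /nx' /= !eqnE eqxx eq_sym (negbTE ab).
    have nxP1 : nx' (k + k + 1) = ar s4 1 a.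
      by rewrite /nx' /= !eqnE eqxx ltn_eqF //; lia.
    clearbody nb' nx'; rewrite !eqnE.
    have [->|vb] := eqVneq v b.
      rewrite ?eqxx ?(negbTE ab) /=; split; rewrite ?nxP //; [by lia|by lia|exact: old].
    rewrite ?[b == v]eq_sym ?(negbTE vb) /=.
    have [->|va] := eqVneq v a; last exact: old.
    by split; rewrite ?nxP1 //; [lia|lia|exact: old].
  move=> s4 e9 so4 [t4 ch4].
  have r0 : rg s4 Rn = n by rewrite so4.1 //= so3.1.
  have r1 : rg s4 Rm = m by rewrite so4.1 //= so3.1.
  have r2 : rg s4 RL = 2 * L by rewrite so4.1 //= so3.1.
  wgo; apply: IQ; rewrite ?addn0 ?r0.
  + split=> //=.
      move=> v vn; rewrite EE; have := ch4 v vn; rewrite -Em take_size.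
      by apply: chain_grow => //; lia.
    by move=> x1 xn1; rewrite so4.2 //=; have [] := i3 x1 xn1.
  + by move=> x1 xn1; rewrite so4.2 //= so3.2 //= e6 fl0.
  + exists id, [::], [::]; rewrite /= ?addn0 ?r0; split=> //.
    * by apply: forest_init => x1 xn1; rewrite so4.2 //=; have [] := i3 x1 xn1.
    * by move=> x1 xn1; rewrite so4.2 //= xn1; have [] := i3 x1 xn1.
    * by split; last lia; rewrite -size_filter (eq_in_filter (a2 := predT)) ?filter_predT ?size_iota // => x1; rewrite mem_iota.
  + by move: t3 t4; rewrite /= ?so3.1 //= ?e4 ?e5; lia.
- move=> k s2 [x [e1 e2 [xn kn] e3 [e4 e5 e6 e7]]].
  have x0 : x != 0 by move: e2; case: eqP.
  split; first by rewrite e1.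
  wgo; rewrite divn2; exists x./2; split=> //=.
  + by rewrite e1.
  + move: e2; rewrite (negbTE x0) => -[->].
    case: x x0 {e1 xn} => [|[|x]] // _; rewrite trunc_log2S //.
  + by split; lia.
  + by lia.
  + by split=> //; lia.
Qed.
End Program.

(** * Correctness and number of rounds *)

Lemma big_tupleS (T : finType) k (F : seq T -> nat) :
  \sum_(t : k.+1.-tuple T) F t = \sum_x \sum_(t : k.-tuple T) F (x :: t).
Proof.
rewrite pair_big /= (reindex (fun xt : T * k.-tuple T => [tuple of xt.1 :: xt.2])) //=.
exists (fun t => (thead t, [tuple of behead t])) => [[x t] _|t _] /=.
  by congr (_, _); apply: val_inj.
by rewrite [RHS]tuple_eta.
Qed.

(** * Counting the tapes that do not halt *)

Section Counting.
Variables (p : program) (w : nat).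
Local Notation W := (2 ^ w).

Definition nonhalting (T : nat) (t : state) : nat :=
  \sum_(l : T.-tuple 'I_W) ~~ halted p (run p t l).

Lemma halted_step t x : halted p t -> step p w t x = t.
Proof. by rewrite /halted /step; case: (fetch p t). Qed.

Lemma halted_run t (l : seq 'I_W) : halted p t -> run p t l = t.
Proof. by move=> h; elim: l => //= x l IH; rewrite halted_step. Qed.

Lemma nonhaltingS T t : nonhalting T.+1 t = \sum_(x : 'I_W) nonhalting T (step p w t x).
Proof.
rewrite /nonhalting.
have := @big_tupleS 'I_W T (fun l => nat_of_bool (~~ halted p (run p t l))).
by move=> ->; apply: eq_bigr => x _; apply: eq_bigr.
Qed.

Lemma nonhalting_reach k T t t' : reach p w k t t' -> nonhalting (k + T) t = W ^ k * nonhalting T t'.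
Proof.
elim: k t => [|k IH] t h; first by rewrite mul1n -(h [::]).
rewrite addSn nonhaltingS (eq_bigr (fun=> W ^ k * nonhalting T t')) => [|x _].
  by rewrite sum_nat_const card_ord mulnA expnS.
by apply: IH => l lk; rewrite -(h (x :: l)) //= lk.
Qed.

Lemma nonhalting_halted T t : halted p t -> nonhalting T t = 0.
Proof. by move=> h; rewrite /nonhalting big1 // => l _; rewrite halted_run ?h. Qed.

Lemma nonhalting_le T t : nonhalting T t <= W ^ T.
Proof.
rewrite -[W in W ^ T]card_ord -card_tuple -sum1_card /nonhalting.
by apply: leq_sum => l _; case: (~~ _).
Qed.

Lemma nonhalting_mono1 T t : nonhalting T.+1 t <= W * nonhalting T t.
Proof.
elim: T t => [|T IH] t.
  have [h|h] := boolP (halted p t); first by rewrite !nonhalting_halted.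
  apply: leq_trans (nonhalting_le 1 t) _; rewrite expn1 leq_pmulr //.
  rewrite /nonhalting (bigD1 [tuple]) //=; by rewrite h.
rewrite nonhaltingS [X in _ <= _ * X]nonhaltingS big_distrr /=.
by apply: leq_sum => x _; apply: IH.
Qed.

(** A halted state is final, so the proportion of nonhalting tapes does not grow with their
    length. *)
Lemma nonhalting_mono k T t : nonhalting (k + T) t <= W ^ k * nonhalting T t.
Proof.
elim: k => [|k IH]; first by rewrite mul1n.
by apply: leq_trans (nonhalting_mono1 _ _) _; rewrite expnS -mulnA leq_mul2l IH orbT.
Qed.

End Counting.

(** * The machine program *)

Definition head_cmd : cmd := block [:: Set_ Re 1; Bin Lt Ra Re Rcnt; Set_ Ri 0; Bin Lt Rt Ri Rn].

(** It takes 11 steps; with the loop test, [Rand] and the jump back, a vertex costs 14. *)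
Definition sample_cmd q : cmd :=
  block [:: Set_ Rb q; Bin Mod Ra Ra Rb; Set_ Rb 0; Bin Eq Ra Ra Rb; St MARK Ri Ra;
    Set_ Re 1; Bin Add Ri Ri Re; Bin Lt Rt Ri Rn].

Section Code.
Variable q : nat.

(** Arrays have [array_factor * (n.+1 * n.+1)] cells: the edge list may have about [n ^ 2] entries,
    and the pairs are bounded through [L <= q * (2 * n + 2)]. *)
Definition array_factor := 16 * q + 200.
Definition pos_head := 7 + csize (init_cmd q).
Definition pos_sample := pos_head + (csize head_cmd).+1.
Definition pos_round := pos_sample + (csize (sample_cmd q)).+3.
Definition pos_final := pos_round + (csize round_cmd).+1.

(** It leaves the array length in register 1. The input, stored from address 0 on, becomes array
    0. *)
Definition prologue : program :=
  [:: Const 2 0; Read 3 2; Const 4 1; Op Add 3 3 4; Op Mul 3 3 3; Const 1 array_factor; Op Mul 1 1 3].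

Definition prog : program :=
  prologue ++ compile 7 (init_cmd q) ++ compile pos_head head_cmd ++
  (JumpZero Ra.+2 pos_final :: JumpZero Rt.+2 pos_round :: Rand Ra.+2 ::
   compile pos_sample.+2 (sample_cmd q)) ++
  (Jump pos_sample :: compile pos_round round_cmd) ++ (Jump pos_head :: compile pos_final final_cmd) ++
  [:: Const 0 OUT; Op Mul 0 0 1; Halt].

Definition pos_end := pos_final + csize final_cmd.

Lemma prog_code :
  [/\ code_at prog 0 prologue, code_at prog 7 (compile 7 (init_cmd q)),
      code_at prog pos_head (compile pos_head head_cmd) &
   [/\ nth Halt prog (pos_head + csize head_cmd) = JumpZero Ra.+2 pos_final,
      nth Halt prog pos_sample = JumpZero Rt.+2 pos_round,
      nth Halt prog pos_sample.+1 = Rand Ra.+2,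
      code_at prog pos_sample.+2 (compile pos_sample.+2 (sample_cmd q)) &
      nth Halt prog (pos_sample.+2 + csize (sample_cmd q)) = Jump pos_sample] /\
   [/\ code_at prog pos_round (compile pos_round round_cmd),
      nth Halt prog (pos_round + csize round_cmd) = Jump pos_head,
      code_at prog pos_final (compile pos_final final_cmd) &
      code_at prog pos_end [:: Const 0 OUT; Op Mul 0 0 1; Halt]]].
Proof.
have : code_at prog 0 prog by move=> i; rewrite add0n.
rewrite {2}/prog => /code_at_cat[c0 /code_at_cat[c1 /code_at_cat[c2 /code_at_cat[c3 /code_at_cat[c4 /code_at_cat[c5 c6]]]]]].
move: c0 c1 c2 c3 c4 c5 c6; rewrite !add0n !size_compile.
have sc (x : instr) l : size (x :: l) = (size l).+1 by [].
rewrite (_ : size prologue = 7) // !(sc (JumpZero Ra.+2 pos_final)) !(sc (JumpZero Rt.+2 pos_round)) !(sc (Rand Ra.+2)).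
rewrite !(sc (Jump pos_sample)) !(sc (Jump pos_head)) !size_compile -/pos_head => c0 c1 c2.
have E1 : (pos_head + csize head_cmd).+1 = pos_sample by rewrite /pos_sample addnS.
have E2 : pos_head + csize head_cmd + (csize (sample_cmd q)).+3 = pos_sample.+2 + csize (sample_cmd q).
  by rewrite /pos_sample; lia.
have E3 : (pos_sample.+2 + csize (sample_cmd q)).+1 = pos_round by rewrite /pos_round; lia.
have E4 : (pos_round + csize round_cmd).+1 = pos_final by rewrite /pos_final addnS.
rewrite !E2 ![_ + (csize round_cmd).+1]addnS -addSn E3 ![_ + (csize final_cmd).+1]addnS -addSn E4 -/pos_end.
move=> /code_at_cons[d0]; rewrite E1 => /code_at_cons[d1 /code_at_cons[d2 d3]].
move=> /code_at_cons[d4]; rewrite E3 => d5 /code_at_cons[d6]; rewrite E4 => d7 d8.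
by split=> //; split.
Qed.
End Code.

Section Exec.
Variables (n m q L : nat) (g : rel nat) (adj : nat -> seq nat) (w Z : nat).
Hypothesis par_ok : params n m q L g adj w Z.
Hypothesis n0 : 0 < n.
Local Notation W := (2 ^ w).
Local Notation prog := (prog q).
Local Notation run := (run prog).
Local Notation reach := (reach prog w).
Local Notation rep := (represents 32 Z).
Local Notation wp := (wp w 32 Z).
Local Notation base_ok := (base_ok n m L adj Z).
Local Notation tree_ok := (tree_ok n L g).
Local Notation flags_ok := (flags_ok n).
Local Notation close_pair := (close_pair n L g).

Lemma W_large : 32 * Z <= W /\ 100 < Z /\ 4 * q < Z /\ n < Z.
Proof. by have := p_ZW par_ok; have := p_Zn par_ok; have := p_ZL par_ok; lia. Qed.

Lemma wp_reach c (Q : store -> Prop) s pos t : wp c Q s -> code_at prog pos (compile pos c) ->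
  pc t = pos -> rep s t ->
  exists s' t' k, [/\ Q s', tm s' = k + tm s, reach k t t', pc t' = pos + csize c & rep s' t'].
Proof.
have [ZW [Z0 _]] := W_large.
move=> [s' [e q']] cd pt st.
have [k [t' [h1 h2 h3 h4]]] := @compile_ok prog w 32 Z ZW isT (ltn_trans (isT : 0 < 100) Z0) c s s' e pos t cd pt st.
by exists s', t', k.
Qed.

Definition Head (A : pred nat) (s : store) (t : state) : Prop :=
  [/\ pc t = pos_head q, rep s t, base_ok s, flags_ok s & tree_ok s A /\ forall x, A x -> x < n].

(** [ws] lists the words drawn so far in this round, on which alone the sample depends. *)
Definition Sampling (A : pred nat) (i : nat) (ws : seq nat) (s : store) (t : state) : Prop :=
  [/\ pc t = pos_sample q, rep s t, base_ok s, flags_ok s & tree_ok s A /\ forall x, A x -> x < n] /\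
  [/\ rg s Ri = i, rg s Rt = (i < n), size ws = i &
      forall x, x < i -> ar s MARK x = (q %| nth 0 ws x)].

Lemma pc_code pos pos' t x : pc t = pos -> nth Halt prog pos' = x -> pos = pos' -> fetch prog t = x.
Proof. by rewrite /fetch => -> <- ->. Qed.

Lemma head_sampling A s t : Head A s t -> 1 < count A (iota 0 n) ->
  exists s' t', reach 5 t t' /\ Sampling A 0 [::] s' t'.
Proof.
move=> [pt st bs fl [tr An]] c1; have [ZW [Z0 [_ nZ]]] := W_large.
have [_ _ cd [[d1 _ _ _ _] _]] := prog_code q.
have [rp [PA [PB [_ _ _ _ [ec _]]]]] := tr.
have [en _ _ _ _] := bs.
pose Q s' := [/\ base_ok s', flags_ok s', tree_ok s' A, rg s' Ra = 1 &
  [/\ rg s' Ri = 0, rg s' Rt = 1 & tm s' = 4 + tm s]].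
have : wp head_cmd Q s.
  wgo; split=> //=; first by rewrite ec c1.
  by rewrite en n0.
move=> /wp_reach/(_ cd pt st)[s' [t' [k [[h1 h2 h3 h4 [h5 h6 h7]] h8 h9 h10 h11]]]].
have k4 : k = 4 by lia.
subst k; exists s', (State (pos_sample q) (reg t') (Defs.mem t')); split; last first.
  by split; split; rewrite ?h5 ?h6 ?n0.
apply: (@reach_trans _ _ 4 1 _ _ _ h9); apply: reach1 => x.
rewrite /step (pc_code h10 d1) //; case: h11 => -> _ _; rewrite h4 /=.
by rewrite h10 /pos_sample; congr State; lia.
Qed.

(** The tape offers a word at every step, but of the 14 words spent on a vertex only the second,
    read by [Rand], matters. *)
Lemma sampling_step A i ws s t : Sampling A i ws s t -> i < n -> forall x : 'I_W,
  exists s' t', Sampling A i.+1 (rcons ws x) s' t' /\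
    forall (y : 'I_W) l, size l = 12 -> run t [:: y, x & l] = t'.
Proof.
move=> [[pt st bs fl [tr An]] [ei et sw mk]] ilt x; have [ZW [Z0 [qZ nZ]]] := W_large.
have [_ _ _ [[_ d1 d2 cd d3] _]] := prog_code q.
have [en _ _ _ _] := bs; have [r1 r2 r3] := st.
pose s1 := Store (upd (rg s) Ra x) (ar s) (tm s).
pose t1 := State (pos_sample q).+2 [eta reg t with Ra.+2 |-> val x] (Defs.mem t).
have st1 : rep s1 t1.
  by split=> // r; rewrite /= r1 !eqSS eqnE.
pose Q s' := [/\ base_ok s', flags_ok s', tree_ok s' A, rg s' Ri = i.+1 &
  [/\ rg s' Rt = (i.+1 < n), forall y, y < i.+1 -> ar s' MARK y = (q %| nth 0 (rcons ws x) y)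
   & tm s' = 11 + tm s]].
have : wp (sample_cmd q) Q s1.
  wgo; rewrite ei; split=> //=; first by rewrite addn1.
  split=> //; first by rewrite en addn1.
  move=> y; rewrite eqnE ltnS leq_eqVlt nth_rcons sw /dvdn => /orP[/eqP->|yi].
    by rewrite ltnn eqxx.
  by rewrite ltn_eqF // yi mk.
move=> /wp_reach/(_ cd (erefl (pc t1)) st1)[s' [t' [k [[h1 h2 h3 h4 [h5 h6 h7]] h8 h9 h10 h11]]]].
have k11 : k = 11 by move: h8; rewrite h7 /=; lia.
subst k; exists s', (State (pos_sample q) (reg t') (Defs.mem t')); split.
  by split; split; rewrite // size_rcons sw.
move=> y l l12.
have -> : run t [:: y, x & l] = run t1 l.
  have e1 : step prog w t y = State (pos_sample q).+1 (reg t) (Defs.mem t).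
    by rewrite /step (pc_code pt d1) // r1 et ilt /= pt.
  have e2 : step prog w (State (pos_sample q).+1 (reg t) (Defs.mem t)) x = t1.
    by rewrite /step (@pc_code (pos_sample q).+1 _ (State (pos_sample q).+1 (reg t) (Defs.mem t)) _ erefl d2).
  by rewrite /= e1 e2.
have : reach (11 + 1) t1 (State (pos_sample q) (reg t') (Defs.mem t')); last by apply.
by apply: (reach_trans h9); apply: reach1 => z; rewrite /step (pc_code h10 d3).
Qed.

Lemma round_step A ws s t : Sampling A n ws s t ->
  exists A' s' t' k, [/\ k <= 2500 * (n + m + 1) + 2, reach k t t', Head A' s' t',
    (forall x, A' x -> A x) &
    let S := predI (fun x => q %| nth 0 ws x) A in
    (forall u v, A u -> A v -> same_trace n g S u v -> close_pair A u v) ->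
    forall u v, A' u -> A' v -> same_trace n g S u v -> u = v].
Proof.
move=> [[pt st bs fl [tr An]] [ei et sw mk]]; have [ZW [Z0 [qZ nZ]]] := W_large.
have [_ _ _ [[_ d1 _ _ _] [cd d2 _ _]]] := prog_code q.
have [r1 r2 r3] := st.
pose t1 := State (pos_round q) (reg t) (Defs.mem t).
pose S := predI (fun x => q %| nth 0 ws x) A.
pose Q s' := exists A', [/\ base_ok s', flags_ok s', tree_ok s' A', (forall x, A' x -> A x) &
  ((forall u v, A u -> A v -> same_trace n g S u v -> close_pair A u v) ->
    forall u v, A' u -> A' v -> same_trace n g S u v -> u = v) /\
  tm s' <= tm s + 2500 * (n + m + 1)].
have : wp round_cmd Q s.
  apply: (wp_round par_ok bs fl tr An mk) => s' A' h1 h2 h3 h4 h5 h6.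
  by exists A'.
move=> /wp_reach/(_ cd (erefl (pc t1)) st)[s' [t' [k [[A' [h1 h2 h3 h4 [h5 h6]]] h8 h9 h10 h11]]]].
exists A', s', (State (pos_head q) (reg t') (Defs.mem t')), (1 + (k + 1)); split=> //.
- by lia.
- apply: (@reach_trans _ _ 1 (k + 1) _ t1).
    by apply: reach1 => x; rewrite /step (pc_code pt d1) // r1 et ltnn.
  by apply: (reach_trans h9); apply: reach1 => z; rewrite /step (pc_code h10 d2).
- by split=> //; split=> // x /h4/An.
Qed.

Variable G : sgraph n.
Hypothesis gE : forall x y : 'I_n, g x y = G x y.

Definition good_output (t : state) : Prop :=
  exists (N : nat) (M : signed_tree_model 'I_N),
    outputs_model G t M /\ num_pairs M <= (L + 1) * n.-1.

Lemma count_le1 (A : pred nat) : count A (iota 0 n) <= 1 ->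
  forall x y, x < n -> y < n -> A x -> A y -> x = y.
Proof.
move=> c1 x y xn yn Ax Ay; apply/eqP; apply: contraLR c1 => xy; rewrite -ltnNge -size_filter.
apply: (@uniq_leq_size _ [:: x; y]); first by rewrite /= inE xy.
by move=> z; rewrite !inE mem_filter mem_iota => /orP[]/eqP->; rewrite ?Ax ?Ay.
Qed.

Lemma head_final A s t : Head A s t -> count A (iota 0 n) <= 1 ->
  exists t' k, [/\ k <= 200 * (n + (L + 1) * n + 1) + 7, reach k t t', halted prog t' & good_output t'].
Proof.
move=> [pt st bs fl [tr An]] c1; have [ZW [Z0 [_ nZ]]] := W_large.
have [_ _ cd [[d1 _ _ _ _] [_ _ cf ce]]] := prog_code q.
have tr0 := tr; have [rp [PA0 [PB0 [_ _ _ _ [ec _]]]]] := tr.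
have [en _ _ _ _] := bs.
pose Q s' := [/\ base_ok s', tree_ok s' A, rg s' Ra = 0 & tm s' = 4 + tm s].
have : wp head_cmd Q s.
  by wgo; split=> //=; rewrite ec ltnNge c1.
move=> /wp_reach/(_ cd pt st)[s1 [t1 [k1 [[b1 b2 b3 b4] b5 b6 b7 b8]]]].
have k4 : k1 = 4 by lia.
subst k1.
pose t2 := State (pos_final q) (reg t1) (Defs.mem t1).
have r2 : reach 1 t1 t2.
  apply: reach1 => x; rewrite /step (pc_code b7 d1) //; case: b8 => -> _ _.
  by rewrite b3.
pose Q2 s' := exists rp PA PB, let code := rg s1 Rk :: map (ar s1 PAR) (iota 0 (rg s1 Rk)) ++ iota 0 n
          ++ pairs_nat PA ++ pairs_nat PB in
  [/\ forest_inv n g (rg s1 Rk) (ar s1 PAR) (ar s1 NODE) rp A PA PB,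
      size PA + size PB <= (L + 1) * n.-1,
      forall i, i < size code -> ar s' OUT i = nth 0 code i,
      size code <= Z & tm s' <= tm s1 + 200 * (n + (L + 1) * n + 1)].
have : wp final_cmd Q2 s1.
  apply: (wp_final par_ok b1 b2) => s' rp' PA PB h1 h2 h3 h4 h5.
  by exists rp', PA, PB; split=> // i ip; apply: h3 => //; apply: leq_trans h4.
have st2 : rep s1 t2 by case: b8 => h1 h2 h3; split.
move=> /wp_reach/(_ cf (erefl (pc t2)) st2)[s3 [t3 [k3 [[rp' [PA [PB [inv szP out szc tm3]]]] e5 e6 e7 e8]]]].
move: ce; rewrite /pos_end => /code_at_cons[f1 /code_at_cons[f2 /code_at_cons[f3 _]]].
have [z1 z2 z3] := e8.
have OW : OUT < W by lia.
pose t4 := State (pos_final q + csize final_cmd).+1 (reg (set_reg t3 0 OUT)) (Defs.mem t3).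
have s4 : reach 1 t3 t4.
  by apply: reach1 => x; rewrite /step (pc_code e7 f1) // modn_small // /t4 /set_reg e7.
pose t5 := State (pos_final q + csize final_cmd).+2 (reg (set_reg t4 0 (OUT * Z))) (Defs.mem t3).
have s5 : reach 1 t4 t5.
  apply: reach1 => x; rewrite /step (pc_code (erefl (pc t4)) f2) //=.
  by rewrite z2 modn_small //; lia.
exists t5, (4 + (1 + (k3 + (1 + 1)))); split.
- by lia.
- by do ?[apply: reach_trans; first by eassumption].
- by rewrite /halted (pc_code (erefl (pc t5)) f3).
have nk := fi_k inv; case Ek : (rg s1 Rk) nk inv out szc => [|N] nk inv out szc.
  by lia.
have al1 : forall x y, x < n -> y < n -> A x -> A y -> x = y by apply: count_le1.
exists N.+1, (forest_model inv al1); split; last by rewrite forest_num_pairs.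
exists (leaf_of nk), (ordpairs N PA), (ordpairs N PB).
have [lA lB] := forest_lists inv al1; split=> //.
  exact: forest_modelP.
rewrite forest_code => i ip; rewrite -out //= z3 //; exact: leq_trans ip szc.
Qed.

End Exec.

Lemma count_iota_card n (P : pred nat) : count P (iota 0 n) = #|[set x : 'I_n | P x]|.
Proof.
rewrite -val_enum_ord count_map -sum1_count -sum1_card big_enum_cond /=.
by apply: eq_bigl => x; rewrite inE.
Qed.

(** * Halted states are right on every tape *)

Section Padding.
Variables (n q L w : nat) (G : sgraph n).
Local Notation W := (2 ^ w).
Local Notation prog := (prog q).
Local Notation run := (run prog).

Definition good_upto (N : nat) (t : state) : Prop :=
  forall l : seq 'I_W, size l <= N -> halted prog (run t l) -> good_output L G (run t l).

(* A tape too short to reach the end of a block can be padded: a halted state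
   does not change any more. *)
Lemma good_prefix k N t :
  (forall l : seq 'I_W, size l = k -> good_upto (N - k) (run t l)) -> good_upto N t.
Proof.
have W0 : 0 < W by rewrite expn_gt0.
move=> h l lN hl; have [kl|lk] := leqP k (size l).
  rewrite -(cat_take_drop k l) run_cat in hl *.
  apply: (h (take k l)) hl; first by rewrite size_takel.
  by rewrite size_drop; lia.
have e : run t (l ++ nseq (k - size l) (Ordinal W0)) = run t l.
  by rewrite run_cat halted_run.
have hs : size (l ++ nseq (k - size l) (Ordinal W0)) = k.
  by rewrite size_cat size_nseq; lia.
by have := h _ hs [::] isT; rewrite e; apply.
Qed.

Lemma good_reach k N t t' : reach prog w k t t' -> good_upto (N - k) t' -> good_upto N t.
Proof. by move=> r h; apply: (@good_prefix k) => l lk; rewrite r. Qed.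

End Padding.

(** * Correctness and halting probability of the main loop *)

Section Analysis.
Variables (n m q L d tt : nat) (g : rel nat) (adj : nat -> seq nat) (w Z M : nat).
Hypothesis par_ok : params n m q L g adj w Z.
Hypothesis n0 : 0 < n.
Variable G : sgraph n.
Hypothesis gE : forall x y : 'I_n, g x y = G x y.
Hypothesis tw : twin_width_le d G.
Hypotheses (q0 : 0 < q) (WE : 2 ^ w = q * M) (qc : 16 * trace_const d <= q)
  (tn : 4 * n ^ 2 <= 2 ^ tt) (LE : L = q * tt).
Local Notation W := (2 ^ w).
Local Notation prog := (prog q).
Local Notation run := (run prog).
Local Notation reach := (reach prog w).
Local Notation Head := (Head n m q L g adj Z).
Local Notation Sampling := (Sampling n m q L g adj Z).
Local Notation good_output := (good_output L G).
Local Notation good_upto := (good_upto q L w G).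
Local Notation nonhalting := (nonhalting prog w).

(** Induction on the length of the tape; each round uses at least the five words of [head_cmd] and
    the test after it. *)
Lemma head_good A s t : Head A s t ->
  forall l : seq 'I_W, halted prog (run t l) -> good_output (run t l).
Proof.
clear tw WE q0 qc tn LE.
move=> hd l; move: hd; suff H N : forall A s t, Head A s t -> good_upto N t.
  by move=> hd; apply: (H (size l) _ _ _ hd).
have [N1] := ubnP N; elim: N1 N => // N1 IH N NN1 {}A {}s {}t hd.
have [c1|c1] := leqP (count A (iota 0 n)) 1.
  have [t' [k [_ r ht' gt']]] := head_final par_ok n0 gE hd c1.
  by apply: (good_reach r) => l' _ _; rewrite halted_run.
case: N NN1 => [|N] NN1.
  (* With an empty tape the machine is still at the first instruction of [head_cmd], which is not
     [Halt]. *)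
  move=> l'; rewrite leqn0 => /eqP/size0nil ->.
  have [_ _ cd _] := prog_code q.
  by case: hd => pt _ _ _ _; rewrite /halted /fetch pt -[pos_head q]addn0 cd.
have [s' [t' [r smp]]] := head_sampling par_ok n0 hd c1; apply: (good_reach r).
have : N.+1 - 5 < N1 by lia.
move: (N.+1 - 5) s' t' smp {r} => {hd c1 s t NN1 l}N s t smp NN1.
suff : forall j i ws N s t, n - i = j -> i <= n -> N < N1 -> Sampling A i ws s t -> good_upto N t.
  by move=> /(_ _ _ _ _ _ _ erefl (leq0n n) NN1 smp).
elim => [|j IHj] i ws {smp}N0 {}s {}t ij iln {NN1 N}N0N1 smp.
  have ei : i = n by lia.
  subst i; have [A' [s' [t' [k [_ r hd _ _]]]]] := round_step par_ok n0 smp.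
  by apply: (good_reach r); apply: (IH _ _ _ _ _ hd); lia.
have iltn : i < n by lia.
apply: (@good_prefix _ _ _ _ _ 14) => -[|y [|x l]] // [l12].
have [s' [t' [smp' ->]]] := sampling_step par_ok n0 smp iltn x; last by [].
by apply: (IHj i.+1 _ _ _ _ _ _ _ smp'); lia.
Qed.

(** Of the 14 words per vertex, 13 are irrelevant and give the factor [W ^ (13 * j)]; the remaining
    one is appended to [ws]. *)
Lemma sampling_nonhalting (c1 T : nat) (h : seq nat -> nat) A j i ws s t :
  (forall ws s t, Sampling A n ws s t -> c1 * nonhalting T t <= h ws) ->
  i + j = n -> Sampling A i ws s t ->
  c1 * nonhalting (14 * j + T) t <=
    W ^ (13 * j) * \sum_(v : j.-tuple 'I_W) h (ws ++ map val v).
Proof.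
move=> hT; elim: j i ws s t => [|j IH] i ws s t ij smp.
  rewrite addn0 in ij; subst i; rewrite muln0 add0n mul1n.
  apply: leq_trans (hT _ _ _ smp) _.
  by rewrite (bigD1 [tuple]) //= cats0 leq_addr.
have iltn : i < n by lia.
have step14 (y x : 'I_W) : c1 * nonhalting (12 + (14 * j + T)) (step prog w (step prog w t y) x) <=
    W ^ 12 * (W ^ (13 * j) * \sum_(v : j.-tuple 'I_W) h (rcons ws x ++ map val v)).
  have [s' [t' [smp' r]]] := sampling_step par_ok n0 smp iltn x.
  rewrite (@nonhalting_reach _ _ 12 _ _ t'); last by move=> l l12; apply: (r y l l12).
  by rewrite mulnCA leq_mul2l (IH i.+1 _ _ _ _ smp') ?orbT //; lia.
rewrite mulnS -addnA -[14 + _]/((12 + (14 * j + T)).+2) nonhaltingS.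
under eq_bigr do rewrite nonhaltingS.
rewrite big_distrr /=; apply: (@leq_trans (\sum_(y < W) \sum_(x < W)
   W ^ 12 * (W ^ (13 * j) * \sum_(v : j.-tuple 'I_W) h (rcons ws x ++ map val v)))).
  by apply: leq_sum => y _; rewrite big_distrr /=; apply: leq_sum => x _; apply: step14.
rewrite sum_nat_const card_ord -!big_distrr /= mulnS expnD -[W ^ 13]/(W ^ 12.+1) expnS -!mulnA.
do !(apply: leq_mul; first by []).
rewrite (@big_tupleS 'I_W j (fun v => h (ws ++ map val v))).
by apply: leq_sum => x _; apply: leq_sum => v _; rewrite cat_rcons.
Qed.

Definition alive_set (A : pred nat) : {set 'I_n} := [set x : 'I_n | A x].

Definition sample_set (A : pred nat) (ws : seq nat) : {set 'I_n} :=
  [set x in alive_set A | q %| nth 0 ws x].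

(** A bound on the survivors of a round as a function of the words drawn: the number of traces if
    all classes are close, the trivial bound otherwise. *)
Definition alive_bound (A : pred nat) (ws : seq nat) : nat :=
  if [forall u in alive_set A, forall v in alive_set A,
       (trace G (sample_set A ws) u == trace G (sample_set A ws) v) ==>
       (#|sdiff G (alive_set A) u v| <= L)]
  then #|traces G (sample_set A ws) (alive_set A)| else #|alive_set A|.

(** This carries [drift] from labellings of the vertices over to tuples of drawn words. *)
Lemma alive_bound_drift A : 1 < count A (iota 0 n) ->
  8 * \sum_(v : n.-tuple 'I_W) alive_bound A (map val v) <= 7 * (count A (iota 0 n) * W ^ n).
Proof.
rewrite count_iota_card -/(alive_set A) => A1.
pose F (f : {ffun 'I_n -> 'I_W}) := [tuple f i | i < n].
have nthF f (x : 'I_n) : nth 0 (map val (F f)) x = f x.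
  by rewrite (nth_map (f x)) ?size_tuple // -tnth_nth tnth_mktuple.
have -> : \sum_(v : n.-tuple 'I_W) alive_bound A (map val v) = \sum_f alive_bound A (map val (F f)).
  rewrite (reindex F) //; exists (fun v : n.-tuple 'I_W => [ffun i => tnth v i]) => [f _|v _].
    by apply/ffunP => i; rewrite ffunE tnth_mktuple.
  by apply: eq_from_tnth => i; rewrite tnth_mktuple ffunE.
have sE f : sample_set A (map val (F f)) = sampled q (alive_set A) f.
  by apply/setP => x; rewrite !inE nthF.
apply: (drift tw q0 WE qc tn A1) => f.
  by rewrite /alive_bound; case: ifP => _ //; rewrite leq_imset_card.
move=> cl; rewrite /alive_bound sE ifT //; apply/forall_inP => u uA; apply/forall_inP => v vA.
by apply/implyP => /eqP e; rewrite LE; apply: cl.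
Qed.

Lemma alive_boundP (A A' : pred nat) ws : (forall x, A x -> x < n) -> (forall x, A' x -> A x) ->
  (let S := predI (fun x => q %| nth 0 ws x) A in
    (forall u v, A u -> A v -> same_trace n g S u v -> close_pair n L g A u v) ->
    forall u v, A' u -> A' v -> same_trace n g S u v -> u = v) ->
  count A' (iota 0 n) <= alive_bound A ws.
Proof.
move=> An AA inj; rewrite count_iota_card -/(alive_set A').
have sAA : alive_set A' \subset alive_set A.
  by apply/subsetP => x; rewrite !inE; apply: AA.
have trE (u v : 'I_n) : same_trace n g (predI (fun x => q %| nth 0 ws x) A) u v =
    (trace G (sample_set A ws) u == trace G (sample_set A ws) v).
  apply/allP/eqP => [h|/setP h z].
    apply/setP => z; rewrite !inE; have := h z; rewrite mem_iota /= add0n ltn_ord => /(_ isT).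
    by rewrite andbC; case: (_ && _) => //= /eqP; rewrite !gE ![G z _]adj_sym.
  rewrite mem_iota /= add0n => zn; apply/implyP => Sz; have := h (Ordinal zn).
  by case/andP: Sz => s1 s2; rewrite !inE /= s1 s2 /= -!gE /= ![g z _](p_gsym par_ok) => ->.
rewrite /alive_bound; case: ifP => [/forall_inP cl|_]; last exact: subset_leq_card.
have close u v : A u -> A v -> same_trace n g (predI (fun x => q %| nth 0 ws x) A) u v ->
    close_pair n L g A u v.
  move=> Au Av; have un := An _ Au; have vn := An _ Av.
  rewrite -[u]/(val (Ordinal un)) -[v]/(val (Ordinal vn)) trE => e.
  have : #|sdiff G (alive_set A) (Ordinal un) (Ordinal vn)| <= L.
    have /forall_inP/(_ (Ordinal vn)) : [forall v in alive_set A,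
      (trace G (sample_set A ws) (Ordinal un) == trace G (sample_set A ws) v) ==>
       (#|sdiff G (alive_set A) (Ordinal un) v| <= L)] by apply: cl; rewrite inE.
    by rewrite inE => /(_ Av); rewrite e.
  rewrite /close_pair count_iota_card; congr (_ <= _); apply: eq_card => x.
  by rewrite !inE -!gE.
apply: (@leq_trans #|trace G (sample_set A ws) @: alive_set A'|).
  rewrite card_in_imset // => u v; rewrite !inE => Au Av e; apply: val_inj.
  by apply: (inj close) => //; rewrite trE e.
by apply: subset_leq_card; apply: imsetS.
Qed.

Definition round_time := 14 * n + (2500 * (n + m + 1) + 2) + 5.
Definition final_time := 200 * (n + (L + 1) * n + 1) + 7.

Lemma count_gt0 A s t : Head A s t -> 0 < count A (iota 0 n).
Proof.
move=> [_ _ _ _ [[rp [PA [PB [inv _ _ _ _]]]] _]].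
have [r1 r2 _] := fi_rep inv n0.
by rewrite -has_count; apply/hasP; exists (rp 0); rewrite // mem_iota.
Qed.

(** The number of alive vertices acts as a potential. For [R = 0] it is at least 1 and bounds any
    probability; each round multiplies its mean by at most 7/8 unless one vertex is left, and then
    the program halts within [final_time]. *)
Lemma head_nonhalting R A s t : Head A s t ->
  8 ^ R * nonhalting (R * round_time + final_time) t <=
  7 ^ R * (count A (iota 0 n) * W ^ (R * round_time + final_time)).
Proof.
elim: R A s t => [|R IH] A s t hd.
  rewrite !expn0 !mul1n mul0n add0n; have := nonhalting_le prog w final_time t; move=> /leq_trans; apply.
  by rewrite leq_pmull // (count_gt0 hd).
have [c1|c1] := leqP (count A (iota 0 n)) 1.
  have [t' [k [kf r ht' _]]] := head_final par_ok n0 gE hd c1.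
  have -> : R.+1 * round_time + final_time = k + (R.+1 * round_time + final_time - k).
    by rewrite /final_time; lia.
  by rewrite (nonhalting_reach _ r) nonhalting_halted // !muln0.
have [s1 [t1 [r smp]]] := head_sampling par_ok n0 hd c1.
set T := R * round_time + final_time.
have -> : R.+1 * round_time + final_time = 5 + (14 * n + (2500 * (n + m + 1) + 2 + T)).
  by rewrite mulSn -addnA -/T /round_time; lia.
set T1 := 2500 * (n + m + 1) + 2.
rewrite (nonhalting_reach _ r).
have bound ws s2 t2 : Sampling A n ws s2 t2 ->
    8 ^ R * nonhalting (T1 + T) t2 <= 7 ^ R * W ^ (T1 + T) * alive_bound A ws.
  move=> smp2; have [A' [s3 [t3 [k [kT r3 hd3 AA inj]]]]] := round_step par_ok n0 smp2.
  have -> : T1 + T = k + ((T1 - k) + T) by rewrite addnA subnKC.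
  rewrite (nonhalting_reach _ r3).
  have h1 := nonhalting_mono prog w (T1 - k) T t3.
  have h2 := IH _ _ _ hd3; rewrite -/T in h2.
  have h3 : count A' (iota 0 n) <= alive_bound A ws by apply: alive_boundP => //; case: smp2 => -[_ _ _ _ [_]].
  have h4 : 8 ^ R * nonhalting T t3 <= 7 ^ R * (alive_bound A ws * W ^ T).
    by apply: leq_trans h2 _; rewrite leq_mul2l leq_mul2r h3 !orbT.
  rewrite [W ^ (k + _)]expnD [W ^ (T1 - k + T)]expnD [8 ^ R * _]mulnCA.
  have -> : 7 ^ R * (W ^ k * (W ^ (T1 - k) * W ^ T)) * alive_bound A ws =
     W ^ k * (W ^ (T1 - k) * (7 ^ R * (alive_bound A ws * W ^ T))).
    move: (7 ^ R) (W ^ k) (W ^ (T1 - k)) (W ^ T) (alive_bound _ _) => x1 x2 x3 x4 x5; lia.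
  rewrite leq_mul2l; apply/orP; right.
  apply: leq_trans (_ : W ^ (T1 - k) * (8 ^ R * nonhalting T t3) <= _).
    by rewrite mulnCA leq_mul2l h1 orbT.
  by rewrite leq_mul2l h4 orbT.
have := sampling_nonhalting bound (add0n n) smp; rewrite -big_distrr /=.
have := alive_bound_drift c1.
set S := \sum_v _; move: (nonhalting _ t1) => N1 hS hN.
have -> : W ^ (5 + (14 * n + (T1 + T))) = W ^ 5 * (W ^ (13 * n) * (W ^ n * W ^ (T1 + T))).
  by rewrite -!expnD; congr (_ ^ _); lia.
rewrite [8 ^ R.+1]expnS [7 ^ R.+1]expnS.
apply: (@leq_trans (W ^ 5 * (8 * (W ^ (13 * n) * (7 ^ R * W ^ (T1 + T) * S))))).
  rewrite [8 * 8 ^ R * _]mulnCA leq_mul2l; apply/orP; right.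
  by rewrite -mulnA leq_mul2l hN orbT.
apply: (@leq_trans (W ^ 5 * (W ^ (13 * n) * (7 ^ R * W ^ (T1 + T)) * (7 * (count A (iota 0 n) * W ^ n))))).
  rewrite leq_mul2l; apply/orP; right.
  move: (W ^ (13 * n)) (7 ^ R) (W ^ (T1 + T)) => x1 x2 x3.
  have -> : 8 * (x1 * (x2 * x3 * S)) = x1 * (x2 * x3) * (8 * S) by lia.
  by rewrite leq_mul2l hS orbT.
move: (W ^ 5) (W ^ (13 * n)) (7 ^ R) (W ^ (T1 + T)) (W ^ n) (count _ _) => x1 x2 x3 x4 x5 x6; lia.
Qed.
End Analysis.

(** * Edge lists and their adjacency lists *)

Definition edge_rel (E : seq (nat * nat)) : rel nat := fun x y => ((x, y) \in E) || ((y, x) \in E).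

(** Each edge is listed in one orientation only, which keeps the adjacency lists free of
    repetitions. *)
Definition simple_edges n (E : seq (nat * nat)) : Prop :=
  uniq E /\ forall a b, (a, b) \in E -> [/\ a < n, b < n, a != b & (b, a) \notin E].

Section Edges.
Variables (n : nat) (E : seq (nat * nat)).
Hypothesis simpleE : simple_edges n E.

Let simple_rev : simple_edges n (rev E).
Proof.
by case: simpleE => u h; split; rewrite ?rev_uniq // => a b; rewrite !mem_rev; apply: h.
Qed.

Lemma mem_adjr l v y : (y \in adjr l v) = ((v, y) \in l) || ((y, v) \in l).
Proof. by have := mem_adj_of (rev l) v y; rewrite /adj_of revK !mem_rev. Qed.

Lemma adj_of_uniq v : uniq (adj_of E v).
Proof.
rewrite /adj_of; move: (rev E) simple_rev; elim=> //= -[a b] l IH [/= /andP[abl ul] h].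
have [an bn ab bal] := h a b (mem_head _ _).
have /IH ul' : simple_edges n l.
  split=> // x y xy; have [|h1 h2 h3] := h x y; first by rewrite inE xy orbT.
  by rewrite inE negb_or => /andP[].
rewrite inE negb_or in bal; case/andP: bal => _ bal.
have nb : b == v -> a \notin adjr l v.
  by move=> /eqP<-; rewrite mem_adjr negb_or bal abl.
have na : a == v -> b \notin adjr l v.
  by move=> /eqP<-; rewrite mem_adjr negb_or bal abl.
case: (eqVneq b v) nb => [eb|_] /=; case: (eqVneq a v) na => [ea|_] //= na nb.
- by rewrite ea eb eqxx in ab.
- by rewrite nb.
- by rewrite na.
Qed.

Lemma adj_of_sum : \sum_(0 <= x < n) size (adj_of E x) = 2 * size E.
Proof.
rewrite /adj_of -(size_rev E); move: (rev E) simple_rev; elim=> [|[a b] l IH] [/= u h].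
  by rewrite big1.
have [an bn ab bal] := h a b (mem_head _ _).
rewrite mulnS -IH; last first.
  split=> [|x y xy]; first by case/andP: u.
  have [|h1 h2 h3] := h x y; first by rewrite inE xy orbT.
  by rewrite inE negb_or => /andP[].
under eq_bigr do rewrite !size_cat.
rewrite !big_split /= addnA; congr (_ + _).
have one (c z : nat) : c < n -> \sum_(0 <= x < n) size (if c == x then [:: z] else [::]) = 1.
  move=> cn; rewrite big_mkord (bigD1 (Ordinal cn)) //= eqxx /= big1 ?addn0 // => i.
  by rewrite -(inj_eq val_inj) /= eq_sym => /negbTE->.
by rewrite !one.
Qed.

Lemma adj_of_size x : size (adj_of E x) <= n.
Proof.
rewrite -[leqRHS](size_iota 0 n); apply: uniq_leq_size (adj_of_uniq x) _ => y.
rewrite mem_adj_of mem_iota /= add0n.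
by case/orP => /(proj2 simpleE)[].
Qed.

Lemma size_edges_le : 2 * size E <= n * n.
Proof.
rewrite -adj_of_sum big_mkord; apply: (@leq_trans (\sum_(i < n) n)); last by rewrite sum_nat_const card_ord.
by apply: leq_sum => i _; apply: adj_of_size.
Qed.

End Edges.

Section Listed.
Variables (n : nat) (G : sgraph n) (es : seq ('I_n * 'I_n)).
Hypothesis esP : lists_pairs es (edges G).

Definition nat_edges : seq (nat * nat) := [seq (val e.1, val e.2) | e <- es].

Let mem_sets S : (S \in [seq [set e.1; e.2] | e <- es]) = (S \in edges G).
Proof. by rewrite (perm_mem esP) mem_enum. Qed.

Let set2_eq (T : finType) (a b c d : T) : [set a; b] = [set c; d] ->
  a = c /\ b = d \/ a = d /\ b = c.
Proof.
move=> e.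
have h1 : a \in [set c; d] by rewrite -e set21.
have h2 : b \in [set c; d] by rewrite -e set22.
have h3 : c \in [set a; b] by rewrite e set21.
have h4 : d \in [set a; b] by rewrite e set22.
case/set2P: h1 => ea; case/set2P: h2 => eb; case/set2P: h3 => ec; case/set2P: h4 => ed;
  by [left|right|left; split; congruence].
Qed.

Let edge_adj a b : (a, b) \in es -> G a b.
Proof.
move=> h; have : [set a; b] \in edges G.
  by rewrite -mem_sets; apply/mapP; exists (a, b).
move=> /imsetP[[c d]]; rewrite inE /= => gcd /set2_eq[[-> ->]|[-> ->]] //.
by rewrite adj_sym.
Qed.

(** The two orientations of an edge yield the same set, and the listed sets are distinct. *)
Lemma nat_edges_simple : simple_edges n nat_edges.
Proof.
have us : uniq [seq [set e.1; e.2] | e <- es] by rewrite (perm_uniq esP) enum_uniq.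
have ue : uniq es by apply: map_uniq us.
have inj : injective (fun e : 'I_n * 'I_n => (val e.1, val e.2)).
  by move=> [a b] [c d] [/val_inj-> /val_inj->].
split; first by rewrite map_inj_uniq.
move=> _ _ /mapP[[a b] abe [-> ->]] /=.
have gab := edge_adj abe.
have nab : a != b by apply: contraL gab => /eqP->; rewrite adj_irrefl.
split=> //; apply/mapP => -[[c d] cde [ebc ead]].
have {ebc} ec : c = b by apply: val_inj.
have {ead} ed : d = a by apply: val_inj.
subst c d.
pose f (e : 'I_n * 'I_n) := [set e.1; e.2].
have := @nth_uniq _ (f (a, b)) _ (index (a, b) es) (index (b, a) es).
move=> /(_ [seq f e | e <- es]); rewrite size_map !index_mem => /(_ abe cde us).
rewrite !(nth_map (a, b)) ?index_mem // !nth_index // /f /= [[set b; a]]setUC eqxx => /esym/eqP ei.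
have : (a, b) = (b, a) by rewrite -(nth_index (a, b) abe) ei nth_index.
by case=> ab; rewrite ab eqxx in nab.
Qed.

Lemma edge_relE (x y : 'I_n) : edge_rel nat_edges x y = G x y.
Proof.
have mem_nat (a b : 'I_n) : ((val a, val b) \in nat_edges) = ((a, b) \in es).
  apply/mapP/idP => [[[c d] cd [/val_inj-> /val_inj->]] //|h]; by exists (a, b).
rewrite /edge_rel !mem_nat; apply/orP/idP => [[/edge_adj//|/edge_adj]|gxy].
  by rewrite adj_sym.
have : [set x; y] \in [seq [set e.1; e.2] | e <- es].
  by rewrite mem_sets; apply/imsetP; exists (x, y); rewrite ?inE.
by move=> /mapP[[a b] abe /set2_eq[[-> ->]|[-> ->]]]; auto.
Qed.

Lemma size_nat_edges : size nat_edges = #|edges G|.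
Proof. by rewrite size_map -(size_map (fun e : 'I_n * 'I_n => [set e.1; e.2])) (perm_size esP) -cardE. Qed.

Lemma graph_codeE : graph_code es = [:: n, size nat_edges & flat nat_edges].
Proof. by rewrite /graph_code /pairs_code size_map /flat -map_comp. Qed.

End Listed.

(** * The constants and the initial state *)

Section Start.
Variables (d n : nat) (G : sgraph n) (es : seq ('I_n * 'I_n)).
Hypotheses (n0 : 0 < n) (tw : twin_width_le d G) (esP : lists_pairs es (edges G)).

(** A power of two, so that it divides [2 ^ w] and sampling is exact, and at least the
    [16 * trace_const d] that [drift] asks for. *)
Definition sample_rate : nat := 2 ^ (16 * trace_const d).
(** In [2 ^ w] the summand 2 accounts for [n.+1 * n.+1], the other one for
    [32 * array_factor sample_rate]. *)
Definition word_factor : nat := 2 + 32 * array_factor sample_rate.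
(* Two vertices told apart by more than [q * t] alive vertices have the same
   trace with probability at most [(1 - 1 / q) ^ (q * t) <= 2 ^ - t]; here
   [2 ^ t >= 4 * n ^ 2], enough for a union bound over all pairs. *)
Definition close_bound : nat := sample_rate * (2 * (trunc_log 2 n).+1 + 2).
Local Notation q := sample_rate.
Local Notation L := close_bound.
Local Notation w := (word_size word_factor n).
Local Notation W := (2 ^ w).
Local Notation E := (nat_edges es).
Local Notation m := (size E).
Local Notation Z := (array_factor q * (n.+1 * n.+1)).
Local Notation t0 := (start word_factor es).

Lemma sample_rate_gt0 : 0 < q. Proof. by rewrite expn_gt0. Qed.

Lemma array_bound : 32 * Z <= W.
Proof.
rewrite /word_size /word_factor mulnDl expnD mulnCA mulnA mulnC.
apply: leq_mul.
  by rewrite mulnC expnM mulnn leq_exp2r //; apply: trunc_log_ltn.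
apply: leq_trans (_ : 2 ^ (32 * array_factor q) <= _).
  by apply: ltnW; rewrite [array_factor q * 32]mulnC ltn_expl.
by rewrite leq_exp2l // leq_pmulr.
Qed.

Lemma log_lt : trunc_log 2 n < n.
Proof. by apply: leq_trans (ltn_expl _ (isT : 1 < 2)) _; apply: trunc_logP. Qed.

Lemma start_params : params n m q L (edge_rel E) (adj_of E) w Z.
Proof.
have simpleE := nat_edges_simple esP; have q0 := sample_rate_gt0.
have mn := size_edges_le simpleE; have ln := log_lt.
have Lq : L <= q * (2 * n + 2) by rewrite /close_bound leq_mul2l; apply/orP; right; lia.
have Zq : Z = 16 * (q * (n.+1 * n.+1)) + 200 * (n.+1 * n.+1) by rewrite /array_factor mulnDl -mulnA.
have e1 : q * (n.+1 * n.+1) = q * (n * n) + 2 * (q * n) + q.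
  have -> : n.+1 * n.+1 = n * n + 2 * n + 1 by lia.
  by rewrite !mulnDr muln1 muln0 addn0 mulSn mul1n.
split.
- exact: array_bound.
- have : (L + 1) * n <= 2 * (q * (n * n)) + 2 * (q * n) + n.
    by apply: leq_trans (_ : (q * (2 * n + 2) + 1) * n <= _); [rewrite leq_mul2r; apply/orP; right; lia|lia].
  by move: Zq; rewrite e1; nia.
- by rewrite Zq; nia.
- by rewrite Zq e1; nia.
- by move=> x y; rewrite /edge_rel orbC.
- by move=> x; rewrite /edge_rel orbb; apply/negbTE/negP => /(proj2 simpleE)[_ _]; rewrite eqxx.
- by move=> x y; rewrite /edge_rel => /orP[]/(proj2 simpleE)[].
- by move=> x y _; rewrite mem_adj_of.
- exact: adj_of_uniq simpleE.
- by move=> x _; apply: adj_of_size simpleE _.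
- exact: adj_of_sum simpleE.
Qed.

Lemma input_lt i : nth 0 (graph_code es) i < W.
Proof.
have := array_bound; have := p_Zm start_params; have := p_Zn start_params => z1 z2 z3.
rewrite (graph_codeE es); case: i => [|[|i]] /=; [by lia|by lia|].
have [il|il] := ltnP i (size (flat E)); last by rewrite nth_default //; lia.
apply: (@leq_trans n); last by lia.
have : nth 0 (flat E) i \in flat E by apply: mem_nth.
move=> /flattenP[_ /mapP[[a b] /(proj2 (nat_edges_simple esP))[an bn _ _] ->]].
by rewrite !inE => /orP[]/eqP->.
Qed.

Lemma prologue_reach : exists t1,
  [/\ reach (prog q) w 7 t0 t1, pc t1 = 7, reg t1 1 = Z & Defs.mem t1 = Defs.mem t0].
Proof.
have [c _ _ _] := prog_code q.
have z3 := array_bound; have z2 := p_Zn start_params.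
have m0 : Defs.mem t0 0 = n by rewrite /= modn_small // /graph_code /=; have := input_lt 0.
have nz : n.+1 * n.+1 <= Z by rewrite leq_pmull // /array_factor; lia.
have n1 : n.+1 < W by nia.
have az : array_factor q <= Z by rewrite leq_pmulr.
have fx i t : pc t = i -> i < 7 -> fetch (prog q) t = nth Halt (prologue q) i.
  by move=> <- i7; rewrite /fetch -(c _ i7).
pose a1 := set_reg t0 2 0.
pose a2 := set_reg a1 3 n.
pose a3 := set_reg a2 4 1.
pose a4 := set_reg a3 3 n.+1.
pose a5 := set_reg a4 3 (n.+1 * n.+1).
pose a6 := set_reg a5 1 (array_factor q).
pose a7 := set_reg a6 1 Z.
exists a7; split=> //.
apply: (reach_step (s1 := a1)) => [x|]; first by rewrite /step (@fx 0) //= modn_small //; lia.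
apply: (reach_step (s1 := a2)) => [x|].
  by rewrite /step (@fx 1) //= -[_ %% _]/(Defs.mem t0 0) m0.
apply: (reach_step (s1 := a3)) => [x|]; first by rewrite /step (@fx 2) //= modn_small //; lia.
apply: (reach_step (s1 := a4)) => [x|].
  by rewrite /step (@fx 3) //= modn_small ?addn1 //; lia.
apply: (reach_step (s1 := a5)) => [x|]; first by rewrite /step (@fx 4) //= modn_small //; lia.
apply: (reach_step (s1 := a6)) => [x|]; first by rewrite /step (@fx 5) //= modn_small //; lia.
by apply: reach1 => x; rewrite /step (@fx 6) //= modn_small //; lia.
Qed.

Lemma start_reach : exists t s k, [/\ k <= 7 + 200 * (n + m + 1), reach (prog q) w k t0 t &
  Head n m q L (edge_rel E) (adj_of E) Z (fun x => x < n) s t].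
Proof.
have par := start_params; have z1 := p_Zn par; have z2 := p_Zm par; have z3 := array_bound.
have [t1 [r1 p1 e1 m1]] := prologue_reach.
have [_ c _ _] := prog_code q.
pose s1 := Store (fun r => reg t1 r.+2) (fun a i => Defs.mem t1 (a * Z + i)) 0.
have st1 : represents 32 Z s1 t1 by split.
have memE i : Defs.mem t1 i = nth 0 (graph_code es) i.
  by rewrite m1 /= modn_small //; apply: input_lt.
have sz : size (graph_code es) = 2 + 2 * m by rewrite (graph_codeE es) /= size_flat.
pose Q s' := [/\ base_ok n m L (adj_of E) Z s', flags_ok n s',
  tree_ok n L (edge_rel E) s' (fun x => x < n) & tm s' <= tm s1 + 200 * (n + m + 1)].
have : wp w 32 Z (init_cmd q) Q s1.
  apply: (wp_init par (E := E)) => //.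
  - by move=> a b /(proj2 (nat_edges_simple esP))[].
  - by rewrite /close_bound; lia.
  - by move=> i _; rewrite /= memE (graph_codeE es).
  (* The input ends before address [Z], so all arrays but [IN] start as zero. *)
  - by move=> x xn; rewrite /= memE nth_default // sz; lia.
  - by move=> x xn; rewrite /= memE nth_default // sz; lia.
move=> h; have [s' [t' [k [[h1 h2 h3 h4] h5 h6 h7 h8]]]] := wp_reach par n0 h c p1 st1.
exists t', s', (7 + k); split.
- by move: h4; rewrite h5 /=; lia.
- exact: reach_trans r1 h6.
- by split.
Qed.

Lemma word_factor_div : exists M, W = q * M.
Proof.
exists (2 ^ (w - 16 * trace_const d)); rewrite -expnD subnKC //.
have lq : 16 * trace_const d <= q by apply: ltnW; apply: ltn_expl.
apply: leq_trans lq _; rewrite /word_size /word_factor /array_factor; nia.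
Qed.

Lemma close_bound_log : 4 * n ^ 2 <= 2 ^ (2 * (trunc_log 2 n).+1 + 2).
Proof.
rewrite expnD mulnC leq_mul2r /= mulnC expnM leq_exp2r //.
by apply: ltnW; apply: trunc_log_ltn.
Qed.

Lemma start_good (tape : seq 'I_W) :
  halted (prog q) (run (prog q) t0 tape) -> good_output L G (run (prog q) t0 tape).
Proof.
have [M WE] := word_factor_div; have par := start_params.
have [t [s [k [_ r hd]]]] := start_reach.
suff : good_upto q L w G (size tape) t0 by apply.
apply: (good_reach r) => l _; by apply: (head_good par n0 _ hd) => x y; apply: edge_relE.
Qed.

Lemma start_nonhalting R : exists T,
  T <= 7 + 200 * (n + m + 1) + (R * round_time n m + final_time n L) /\
  8 ^ R * nonhalting (prog q) w T t0 <= 7 ^ R * (n * W ^ T).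
Proof.
have [M WE] := word_factor_div; have par := start_params.
have [t [s [k [kl r hd]]]] := start_reach.
exists (k + (R * round_time n m + final_time n L)); split; first by rewrite leq_add2r.
have lq : 16 * trace_const d <= q by apply: ltnW; apply: ltn_expl.
have gE (x y : 'I_n) : edge_rel E x y = G x y by apply: edge_relE.
have := head_nonhalting par n0 gE tw sample_rate_gt0 WE lq close_bound_log erefl R hd.
have -> : count (fun x => x < n) (iota 0 n) = n.
  by rewrite count_iota_card -[RHS]card_ord -cardsT; apply: eq_card => x; rewrite !inE ltn_ord.
move=> h; rewrite (nonhalting_reach _ r) expnD [8 ^ R * _]mulnCA.
have -> : 7 ^ R * (n * (W ^ k * W ^ (R * round_time n m + final_time n L))) =
  W ^ k * (7 ^ R * (n * W ^ (R * round_time n m + final_time n L))).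
  by rewrite [n * (_ * _)]mulnCA mulnCA.
by rewrite leq_mul2l h orbT.
Qed.

End Start.

(** * Logarithmic bounds *)

(* Any constant from 5021 on would do. *)
Definition time_const : nat := 72 * 72.

Lemma total_time n m L r T : (0 < n)%N ->
  (T <= 7 + 200 * (n + m + 1) + (r * round_time n m + final_time n L))%N ->
  (T <= time_const * ((m + n) * (r + (L + 1) + 1)))%N.
Proof.
move=> n0 /leq_trans; apply.
have rt : (r * round_time n m <= r * (time_const * (m + n)))%N.
  by rewrite leq_mul2l /round_time /time_const; apply/orP; right; lia.
have ft : (final_time n L <= 407 * (m + n) + 200 * ((L + 1) * (m + n)))%N.
  have : ((L + 1) * n <= (L + 1) * (m + n))%N by rewrite leq_mul2l leq_addl orbT.
  by rewrite /final_time; lia.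
have -> : (time_const * ((m + n) * (r + (L + 1) + 1)) =
  r * (time_const * (m + n)) + time_const * ((L + 1) * (m + n)) + time_const * (m + n))%N.
  by lia.
have : (407 * (m + n) + 407 * (m + n) <= time_const * (m + n))%N by rewrite /time_const; lia.
have : (200 * ((L + 1) * (m + n)) <= time_const * ((L + 1) * (m + n)))%N by rewrite leq_mul2r orbT.
by lia.
Qed.

Import Order.TTheory GRing.Theory Num.Theory.
Local Open Scope ring_scope.

Section Real.
Variable R : realType.

Lemma prob_halt_ge0 p w s T : 0 <= prob_halt R p w s T.
Proof. by rewrite /prob_halt divr_ge0. Qed.

Lemma prob_haltE p w s T :
  prob_halt R p w s T = 1 - (nonhalting p w T s)%:R / ((2 ^ w) ^ T)%:R.
Proof.
have W0 : ((2 ^ w) ^ T)%:R != 0 :> R by rewrite pnatr_eq0 -lt0n !expn_gt0.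
have e : ((2 ^ w) ^ T = #|[set t : T.-tuple 'I_(2 ^ w) | halted p (run p s t)]| + nonhalting p w T s)%N.
  rewrite -[in LHS](card_ord (2 ^ w)) -card_tuple -[LHS]sum1_card.
  rewrite (bigID (fun t : T.-tuple 'I_(2 ^ w) => halted p (run p s t))) /= -sum1_card.
  congr (_ + _)%N; first by apply: eq_bigl => t; rewrite inE.
  by rewrite /nonhalting big_mkcond; apply: eq_bigr => t _; case: (halted _ _).
rewrite /prob_halt card_tuple card_ord; apply: (mulIf W0).
by rewrite mulrBl !divfK // mul1r e natrD addrK.
Qed.

Lemma prob_halt_ge p w s T n r :
  (8 ^ r * nonhalting p w T s <= 7 ^ r * (n * (2 ^ w) ^ T))%N ->
  1 - n%:R * (7 / 8) ^+ r <= prob_halt R p w s T.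
Proof.
move=> h; rewrite prob_haltE lerD2l lerN2.
have W0 : 0 < ((2 ^ w) ^ T)%:R :> R by rewrite ltr0n !expn_gt0.
rewrite ler_pdivrMr // expr_div_n mulrA mulrAC ler_pdivlMr ?exprn_gt0 //.
by rewrite -!natrX -!natrM ler_nat mulnC (leq_trans h) // leq_eqVlt; apply/orP; left; apply/eqP; lia.
Qed.

Lemma ln2_gt0 : 0 < ln 2 :> R.
Proof. by apply: ln_gt0; lra. Qed.

Lemma trunc_log_le n : (0 < n)%N -> (trunc_log 2 n)%:R * ln 2 <= ln n%:R :> R.
Proof.
move=> n0; rewrite mulr_natl -lnXn; last by lra.
by rewrite ler_ln ?posrE ?exprn_gt0 ?ltr0n // -natrX ler_nat; apply: trunc_logP.
Qed.

Lemma ln_ge_ln2 n : (1 < n)%N -> ln 2 <= ln n%:R :> R.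
Proof. by move=> n1; rewrite ler_ln ?posrE ?ltr0n ?ler_nat //; lia. Qed.

Definition decay_rate : R := ln (8 / 7).

Lemma decay_rate_gt0 : 0 < decay_rate.
Proof. by apply: ln_gt0; lra. Qed.

Lemma decay n r (x : R) : (0 < n)%N -> 0 < x ->
  ln n%:R - ln x <= r%:R * decay_rate -> n%:R * (7 / 8) ^+ r <= x.
Proof.
move=> n0 x0 h.
have p0 : 0 < n%:R * (7 / 8) ^+ r :> R by rewrite mulr_gt0 ?ltr0n ?exprn_gt0 //; lra.
rewrite -(ler_ln (x := _ * _)) ?posrE // lnM ?posrE ?ltr0n ?exprn_gt0 //; try lra.
rewrite lnXn; last by lra.
have -> : (7 / 8 : R) = (8 / 7)^-1 by rewrite invf_div.
rewrite lnV ?posrE; last by lra.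
by move: h; rewrite /decay_rate mulNrn -mulr_natl; lra.
Qed.

(** With [l = trunc_log 2 n >= 1], [q * (2 * l + 4) + 1 <= (6 * q + 1) * l] and
    [l <= ln n / ln 2]. *)
Definition pairs_factor (d : nat) : R := (6 * sample_rate d + 1)%:R / ln 2.

Lemma close_bound_le d n : (1 < n)%N ->
  (close_bound d n + 1)%:R <= pairs_factor d * ln n%:R :> R.
Proof.
move=> n1; have tl : (0 < trunc_log 2 n)%N by rewrite trunc_log_gt0.
have h : (close_bound d n + 1 <= (6 * sample_rate d + 1) * trunc_log 2 n)%N.
  rewrite /close_bound; move: (sample_rate d) (trunc_log 2 n) tl => q [|k] // _.
  have -> : (2 * k.+2 + 2 = 2 * k + 6)%N by lia.
  by nia.
apply: (@le_trans _ _ ((6 * sample_rate d + 1) * trunc_log 2 n)%:R); first by rewrite ler_nat.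
rewrite natrM /pairs_factor -mulrA ler_wpM2l // mulrC ler_pdivlMr ?ln2_gt0 //.
by apply: trunc_log_le; apply: ltnW.
Qed.

Lemma num_pairs_le d n : (0 < n)%N ->
  ((close_bound d n + 1) * n.-1)%:R <= pairs_factor d * (n%:R * ln n%:R) :> R.
Proof.
case: n => [|[|n]] // _; first by rewrite muln0 ln1 !mulr0.
rewrite natrM mulrCA mulrA mulrC -mulrA; apply: ler_pM => //.
- by rewrite ler_nat.
- by rewrite close_bound_le.
Qed.

(** The summands pay for the rounds, for two additive units and for [L + 1]. The units come from
    rounding the number of rounds up and from the linear overhead; [ln n / ln 2 >= 1] absorbs
    them. *)
Definition time_factor (d : nat) (c : R) : R :=
  time_const%:R * ((c + 1) / decay_rate + 2 / ln 2 + pairs_factor d).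

Lemma time_le d n m r T (c : R) : (1 < n)%N ->
  r%:R <= (c + 1) * ln n%:R / decay_rate + 1 ->
  (T <= time_const * ((m + n) * (r + (close_bound d n + 1) + 1)))%N ->
  T%:R <= time_factor d c * ((m + n)%:R * ln n%:R).
Proof.
move=> n1 hr hT; have hl : 1 <= ln n%:R / ln 2 :> R by rewrite ler_pdivlMr ?ln2_gt0 // mul1r ln_ge_ln2.
have hL := close_bound_le d n1.
apply: (@le_trans _ _ (time_const * ((m + n) * (r + (close_bound d n + 1) + 1)))%:R); first by rewrite ler_nat.
rewrite natrM /time_factor -mulrA; apply: ler_wpM2l; first exact: ler0n.
rewrite natrM [leRHS]mulrCA; apply: ler_wpM2l; first exact: ler0n.
move: hr hl hL; move: (close_bound d n + 1)%N (pairs_factor d) => y a; rewrite !natrD.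

have -> : ((c + 1) / decay_rate + 2 / ln 2 + a) * ln n%:R =
    (c + 1) * ln n%:R / decay_rate + 2 * (ln n%:R / ln 2) + a * ln n%:R.
  by rewrite !mulrDl -!mulrA ![_ * ln n%:R]mulrC.
move: (_ / decay_rate) (ln n%:R / ln 2) (a * _) => x1 x2 x3; lra.
Qed.
End Real.

Theorem theorem1p4 (R : realType) (C : graph_class) (hC : bounded_twin_width C) :
  exists (p : program) (alpha : nat),
    (exists a : R,
       forall (n : nat) (G : sgraph n) (es : seq ('I_n * 'I_n)),
         (0 < n)%N -> C n G -> lists_pairs es (edges G) ->
         (forall tape : seq 'I_(2 ^ word_size alpha n),
            halted p (run p (start alpha es) tape) ->
            exists (N : nat) (M : signed_tree_model 'I_N),
              outputs_model G (run p (start alpha es) tape) M /\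
              (num_pairs M)%:R <= a * (n%:R * ln n%:R))
         /\
         (forall eps : R, 0 < eps ->
            exists T : nat,
              1 - eps <= prob_halt R p (word_size alpha n) (start alpha es) T))
    /\
    (forall c : R, 0 < c ->
       exists K : R,
         forall (n : nat) (G : sgraph n) (es : seq ('I_n * 'I_n)),
           (0 < n)%N -> C n G -> lists_pairs es (edges G) ->
           exists T : nat,
             T%:R <= K * ((#|edges G| + n)%:R * ln n%:R) /\
             1 - n%:R `^ (- c) <=
               prob_halt R p (word_size alpha n) (start alpha es) T).
Proof.
have [d tw] := hC; exists (prog (sample_rate d)), (word_factor d).
have rate0 : 0 < decay_rate R by apply: decay_rate_gt0.
have natS (x : R) : exists r : nat, x <= r%:R /\ (0 <= x -> r%:R <= x + 1).
  have [x0|x0] := ltP x 0; first by exists 0%N; split; [apply: ltW|lra].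
  exists (Num.truncn x).+1; have /andP[h1 h2] := Num.Theory.truncn_itv x0.
  by split=> [|_]; [apply: ltW|rewrite -natr1 lerD2r].
have prob n (G : sgraph n) (es : seq ('I_n * 'I_n)) r (x : R) : (0 < n)%N -> C n G ->
    lists_pairs es (edges G) -> 0 < x -> ln n%:R - ln x <= r%:R * decay_rate R ->
    exists T : nat,
      (T <= time_const * ((#|edges G| + n) * (r + (close_bound d n + 1) + 1)))%N /\
      1 - x <= prob_halt R (prog (sample_rate d)) (word_size (word_factor d) n) (start (word_factor d) es) T.
  move=> n0 CG esP x0 hr; have [T [hT hp]] := start_nonhalting n0 (tw _ _ CG) esP r.
  exists T; split; first by rewrite -(size_nat_edges esP) (total_time n0 hT).
  by apply: le_trans (prob_halt_ge R hp); rewrite lerD2l lerN2 decay.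
split.
  exists (pairs_factor R d) => n G es n0 CG esP; split=> [tape ht|eps eps0].
    have [N [M [out np]]] := start_good n0 esP ht.
    exists N, M; split=> //; apply: le_trans (num_pairs_le R d n0).
    by rewrite ler_nat.
  have [r [hr _]] := natS ((ln n%:R - ln eps) / decay_rate R).
  rewrite ler_pdivrMr // in hr.
  by have [T [_ hT]] := prob n G es r eps n0 CG esP eps0 hr; exists T.
move=> c c0; exists (time_factor d c) => n G es n0 CG esP.
(* For [n = 1] the time bound is 0, but so is the required probability. *)
have [n1|n1] := leqP n 1.
  have nE : n%:R = 1 :> R by have -> : n = 1%N by lia.
  by exists 0%N; rewrite nE ln1 !mulr0 powR1 subrr prob_halt_ge0.
have l0 : 0 <= ln n%:R :> R by apply: le_trans (ln_ge_ln2 R n1); apply/ltW/ln2_gt0.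
(* This gives [n * (7/8) ^ r <= n ^ (- c)]; it is [c + 1] because the potential starts at [n]. *)
have [r [hr1 hr2]] := natS ((c + 1) * ln n%:R / decay_rate R).
have x0 : 0 < n%:R `^ (- c) :> R by rewrite powR_gt0 // ltr0n.
have [|T [hT hp]] := prob n G es r _ n0 CG esP x0.
  by rewrite ln_powR mulNr opprK -ler_pdivrMr // (le_trans _ hr1) // [(c + 1) * _]mulrDl mul1r addrC.
exists T; split=> //; apply: time_le hT => //; apply: hr2.
by rewrite divr_ge0 ?mulr_ge0 ?addr_ge0 ?ler01 ?(ltW c0) ?(ltW rate0).
Qed.
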